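(* Let $f\in L^2(\mathbb{R})$. Let $k\ge1$ and, for $j=1,\dots,k$, let $z_j\in\mathbb{C}$, $0\le r_j<s_j$, $\Delta_j\ge\delta_j>0$, $D_j:=B_{s_j}(z_j)$, $D_{0,j}:=B_{r_j}(z_j)$, and suppose that $$(V_\varphi f)\big|_{D_j}\in\mathcal{H}(D_j,D_{0,j},\delta_j,\Delta_j)\quad\text{for all } j\in\{1,\dots,k\}.$$ Then there exist a continuous function $\rho:[0,1)\to\mathbb{R}_+$ and a constant $c>0$ so that for all $g\in L^2(\mathbb{R})$ $$\inf_{\alpha_1,\dots,\alpha_k\in\mathbb{R}}\sum_{j=1}^k\|V_\varphi f-e^{i\alpha_j}V_\varphi g\|_{L^2(D_j)}\le c\cdot\Biggl(\sum_{j=1}^k\frac{\Delta_j^2}{\delta_j^2}\bigl(1+\rho(r_j/s_j)s_j\bigr)\Bigl(1+r_j^{1/2}\rho(r_j/s_j)(s_j^{1/2}+s_j^{-1/2})e^{r_j^2\pi/2}\Bigr)\Biggr)\cdot\bigl\||V_\varphi f|-|V_\varphi g|\bigr\|_{W^{1,2}\left(\bigcup_{j=1}^k(D_j)_+\right)},$$ where $(D_j)_+:=D_j\setminus\overline{D_{0,j}}$.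
   Context: $\mathbb{R}_+=\{x\in\mathbb{R}:x>0\}$. $\mathbb{C}$ is identified with $\mathbb{R}^2$ via $x+iy\leftrightarrow(x,y)$. $B_r(z)$ is the open disc of radius $r$ and center $z$ (empty if $r=0$). Gabor transform: for $f\in L^2(\mathbb{R})$ and $\varphi(t):=e^{-\pi t^2}$, $V_\varphi f(x,y):=\int_{\mathbb{R}}f(t)\overline{\varphi(t-x)}e^{-2\pi i t y}\,dt$. Atoll functions: for a bounded domain $D\subset\mathbb{C}$, a hole $D_0$ of $D$ (simply connected domain, possibly empty, with $\overline{D_0}\subset D$), $D_+:=D\setminus\overline{D_0}$, and $\Delta\ge\delta>0$, $$\mathcal{H}(D,D_0,\delta,\Delta):=\{F\in C^1(D):\ \max\{|F(z)|,|\nabla|F|(z)|\}\le\Delta\ \text{for all } z\in D,\ |F(z)|\ge\delta\ \text{for all } z\in D_+\}.$$ Sobolev norm: $\|F\|_{W^{1,p}(D)}=\|F\|_{L^p(D)}+\|\nabla F\|_{L^p(D)}$. *)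

(* Defs.v *)
From HB Require Import structures.
From mathcomp Require Export all_boot all_order all_algebra.
From mathcomp Require Export all_classical all_reals all_analysis.
From mathcomp Require Export complex.

Set Implicit Arguments.
Unset Strict Implicit.
Unset Printing Implicit Defensive.

Import Order.TTheory GRing.Theory Num.Theory.
Import numFieldNormedType.Exports.

Local Open Scope classical_set_scope.
Local Open Scope ring_scope.

(* Values of functions are complex numbers R[i]; points of the complex plane
   over which functions are defined are pairs (x, y) : R * R, standing for
   x + iy.  Functions "on D" are total functions of which only the values on D
   matter: D is always open, so derivatives at points of D depend on the
   restriction to D only. *)

Section Plane.
Context {R : realType}.
Implicit Types (D : set (R * R)) (u : R * R -> R) (z : R * R).

Definition lebesgue2 :
    {measure set (measurableTypeR R * measurableTypeR R) -> \bar R} :=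
  (lebesgue_measure \x lebesgue_measure)%E.

(* Euclidean disc: [ball] on R * R is for the sup norm. *)
Definition disc (z : R * R) (r : R) : set (R * R) :=
  [set w | Num.sqrt ((w.1 - z.1) ^+ 2 + (w.2 - z.2) ^+ 2) < r].

Definition norm2 (v : R * R) : R := Num.sqrt (v.1 ^+ 2 + v.2 ^+ 2).

Definition partial1 u z : R := 'D_((1, 0) : R * R) u z.
Definition partial2 u z : R := 'D_((0, 1) : R * R) u z.
Definition grad u z : R * R := (partial1 u z, partial2 u z).

(* Membership of u in C^n(D), for open D. *)
Fixpoint Cn (n : nat) D u : Prop :=
  match n with
  | 0 => {in D, forall z, {for z, continuous u}}
  | n'.+1 => [/\ {in D, forall z, differentiable u z},
                Cn n' D (partial1 u) & Cn n' D (partial2 u)]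
  end.

Definition test_function D u : Prop :=
  [/\ forall n, Cn n setT u,
      compact (closure [set z | u z != 0])
    & closure [set z | u z != 0] `<=` D].

Definition Lp_norm (p : \bar R) D u : \bar R :=
  'N[lebesgue2]_p[EFin \o (u \_ D)]%E.

Definition locally_integrable_on D u : Prop :=
  measurable_fun D u /\
  forall K, compact K -> K `<=` D -> lebesgue2.-integrable K (EFin \o u).

Definition weak_gradient D u (w : R * R -> R * R) : Prop :=
  [/\ locally_integrable_on D u,
      locally_integrable_on D (fst \o w),
      locally_integrable_on D (snd \o w)
    & forall phi, test_function D phi ->
      Rintegral lebesgue2 D (fun z => u z * partial1 phi z) =
        - Rintegral lebesgue2 D (fun z => (w z).1 * phi z) /\
      Rintegral lebesgue2 D (fun z => u z * partial2 phi z) =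
        - Rintegral lebesgue2 D (fun z => (w z).2 * phi z)].

(* The weak gradient is unique up to a null set, so the infimum is over at most
   one value; it is +oo when u has no weak gradient. *)
Definition sobolev_norm (p : \bar R) D u : \bar R :=
  ereal_inf [set (Lp_norm p D u + Lp_norm p D (norm2 \o w))%E
            | w in weak_gradient D u].

End Plane.

Section Complex.
Context {R : realType}.
Implicit Types (D : set (R * R)) (F : R * R -> R[i]).

(* the modulus as an element of R; the generic norm of R[i] lands in R[i] *)
Definition modulus (z : R[i]) : R := ComplexField.Normc.normc z.

Definition expi (t : R) : R[i] := (cos t +i* sin t)%C.

Definition cintegral (h : R -> R[i]) : R[i] :=
  (Rintegral lebesgue_measure setT (fun t => complex.Re (h t)) +i*
   Rintegral lebesgue_measure setT (fun t => complex.Im (h t)))%C.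

Definition L2 (f : R -> R[i]) : Prop :=
  [/\ measurable_fun setT (fun t => complex.Re (f t)),
      measurable_fun setT (fun t => complex.Im (f t))
    & ('N[lebesgue_measure]_2%:E[EFin \o (fun t => modulus (f t))] < +oo)%E].

Definition gaussian (t : R) : R[i] := (expR (- (pi * t ^+ 2)))%:C%C.

Definition gabor (f : R -> R[i]) (z : R * R) : R[i] :=
  cintegral (fun t =>
    f t * (gaussian (t - z.1))^*%C * expi (- (2 * pi * t * z.2))).

Definition absf F : R * R -> R := fun z => modulus (F z).

Definition L2norm D F : \bar R := Lp_norm 2%:E D (absf F).

(* |F| need not be differentiable at a zero of F; the bound on its gradient is
   imposed exactly at the points of D where this gradient exists. *)
Definition atoll D D0 (delta Delta : R) F : Prop :=
  [/\ Cn 1 D (fun z => complex.Re (F z)) /\ Cn 1 D (fun z => complex.Im (F z)),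
      forall z, D z -> absf F z <= Delta,
      forall z, D z -> differentiable (absf F) z ->
        norm2 (grad (absf F) z) <= Delta
    & forall z, (D `\` closure D0) z -> delta <= absf F z].

End Complex.

(* Main.v *)
From HB Require Import structures.
Require Import Defs.
From mathcomp Require Import measurable_realfun.
From mathcomp Require Import ring lra.
Import Order.TTheory GRing.Theory Num.Theory.
Import numFieldNormedType.Exports.
Set Implicit Arguments.
Unset Strict Implicit.
Unset Printing Implicit Defensive.
Local Open Scope classical_set_scope.
Local Open Scope ring_scope.

(** Write F1 and F2 for the Gabor transforms of f and g. Completing the square
    shows that the conjugate of F_i (x, y) is exp (- pi x^2) E_i (x + i y) with
    E_i entire ([gabor_entire]). On an annulus A where |F1| >= delta > 0, the
    quotient h = E2 / E1 is therefore holomorphic, and it carries both data of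
    the problem: |F2| = |h| |F1|, and |h'| is the length of the gradient of
    |h|. With u = |F1| - |F2| this gives
      |F1| (1 - |h|) = u  and
      |F1| grad |h| = (1 - |h|) grad |F1| - grad u,
    hence |h'|^2 <= 2 (|grad u|^2 / delta^2 + u^2 Delta^2 / delta^4) wherever
    E2 does not vanish ([sqr_dquo_le]). At a zero of E2 either h' = 0 or the
    zero is simple, and there are only countably many simple zeros
    ([simple_zeros_null]).

    The Poincare inequality of the annulus ([annulus_poincare]) then bounds the
    distance in L^2(A) from h to a constant c. Its constant is of order s^2,
    whatever the inner radius: a holomorphic function has the same mean on all
    circles of the annulus, so it is enough to integrate the one-dimensional
    inequality of each circle over the radius. If al is the argument of c, then
    |F1 - e^(i al) F2| = |F1| |e^(i al) - h| is controlled by |h - c| and |u|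
    ([annulus_estimate]).

    It remains to reach the hole. The function E1 - e^(- i al) E2 is entire,
    and multiplying it by a suitable zero-free entire function makes the
    Gaussian weight radial about the centre of the disc. The circular means of
    the squared modulus of an entire function increase with the radius, so the
    mass of the hole is at most a constant times the mass of a ring around it
    ([hole_estimate], [weighted_hole_estimate]). That constant contains the
    factor r^2 / (s^2 - r^2), which the choice rho(t) = 1 / (1 - t) absorbs
    ([stability_constant]).

    The norm in the theorem refers to a weak gradient of u. On an open set
    where u is continuously differentiable, it agrees almost everywhere with
    the classical gradient ([weak_gradient_ae]); this follows by testing against
    smooth bumps that increase to the indicator function of a rectangle. The
    phases of different discs are chosen independently, so the estimates for
    the single discs add up to the theorem. *)

(** * Boxes of the plane *)

Section PlaneBoxes.
Context {R : realType}.
Implicit Types (U D : set (R * R)) (z : R * R).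

Definition open_box (a b c d : R) : set (R * R) :=
  `]a, b[%classic `*` `]c, d[%classic.
Definition closed_box (a b c d : R) : set (R * R) :=
  `[a, b]%classic `*` `[c, d]%classic.

(** Numbers that encode nothing stand for the degenerate box at the origin. *)
Definition rat_code (n : nat) : (rat * rat) * (rat * rat) :=
  odflt ((0, 0), (0, 0)) (unpickle n).
Definition rat_open_box n : set (R * R) :=
  let q := rat_code n in
  open_box (ratr q.1.1) (ratr q.1.2) (ratr q.2.1) (ratr q.2.2).
Definition rat_closed_box n : set (R * R) :=
  let q := rat_code n in
  closed_box (ratr q.1.1) (ratr q.1.2) (ratr q.2.1) (ratr q.2.2).

Lemma subset_open_closed_box a b c d : open_box a b c d `<=` closed_box a b c d.
Proof.
move=> z [/= z1 z2]; split; exact: subset_itv_oo_cc.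
Qed.

Lemma measurable_open_box (a b c d : R) : measurable (open_box a b c d).
Proof. by apply: measurableX; exact: measurable_itv. Qed.

Lemma measurable_closed_box (a b c d : R) : measurable (closed_box a b c d).
Proof. by apply: measurableX; exact: measurable_itv. Qed.

Lemma open_rat_box U z : open U -> U z ->
  exists n, rat_open_box n z /\ rat_closed_box n `<=` U.
Proof.
move=> oU Uz; have /nbhs_ballP[e /= e0 ballU] : nbhs z U by exact: open_nbhs_nbhs.
have bet (x y : R) : x < y -> exists q : rat, x < ratr q < y.
  move=> xy; have [q] := rat_in_itvoo xy.
  by rewrite in_itv/= => xqy; exists q.
have [a /andP[a1 a2]] : exists q : rat, z.1 - e < ratr q < z.1 by apply: bet; lra.
have [b /andP[b1 b2]] : exists q : rat, z.1 < ratr q < z.1 + e by apply: bet; lra.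
have [c /andP[c1 c2]] : exists q : rat, z.2 - e < ratr q < z.2 by apply: bet; lra.
have [d /andP[d1 d2]] : exists q : rat, z.2 < ratr q < z.2 + e by apply: bet; lra.
exists (pickle ((a, b), (c, d))).
rewrite /rat_open_box /rat_closed_box /rat_code pickleK /=.
split; first by split; rewrite /= in_itv/=; apply/andP.
move=> w [/=]; rewrite !in_itv/= => /andP[w1 w2] /andP[w3 w4].
by apply: ballU; split; rewrite /= /ball/= ltr_norml; apply/andP; split; lra.
Qed.

Lemma open_bigcup_rat_box U : open U ->
  U = \bigcup_(n in [set n | rat_closed_box n `<=` U]) rat_open_box n.
Proof.
move=> oU; apply/seteqP; split => [z Uz|z [n /= nU nz]].
  by have [n [nz nU]] := open_rat_box oU Uz; exists n.
by apply: nU; exact: subset_open_closed_box.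
Qed.

(** Open sets are countable unions of boxes with rational vertices. *)
Lemma open2_measurable U : open U -> measurable U.
Proof.
move=> oU; rewrite (open_bigcup_rat_box oU).
by apply: bigcup_measurable => n _; exact: measurable_open_box.
Qed.

(** At the points of D, the preimage of an open interval coincides with its
    interior, which is open and hence measurable. *)
Lemma continuous_at_measurable2 D (f : R * R -> R) :
  measurable D -> (forall z, D z -> {for z, continuous f}) -> measurable_fun D f.
Proof.
move=> mD cf; apply: (measurability _ (RGenOpens.measurableE R)).
move=> _ [_ [a [b ->] <-]].
have -> : D `&` f @^-1` `]a, b[%classic = D `&` interior (f @^-1` `]a, b[%classic).
  apply/seteqP; split => z [Dz fz]; split=> //; last exact: interior_subset.
  by apply: cf => //; apply: open_nbhs_nbhs; split=> //; exact: interval_open.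
by apply: measurableI => //; apply: open2_measurable; exact: open_interior.
Qed.

Lemma lebesgue2_closed_box (a b c d : R) : a <= b -> c <= d ->
  lebesgue2 (closed_box a b c d) = ((b - a) * (d - c))%:E.
Proof.
move=> ab cd; transitivity (lebesgue_measure (`[a, b]%classic : set (measurableTypeR R)) *
  lebesgue_measure (`[c, d]%classic : set (measurableTypeR R)))%E.
  by apply: product_measure1E; exact: measurable_itv.
rewrite /= !lebesgue_measure_itv/= !lte_fin.
have len (x y : R) : x <= y -> (if (x < y)%R then (y%:E - x%:E) else 0)%E = (y - x)%:E.
  by move=> xy; case: ltP => // yx; congr EFin; lra.
by rewrite !len.
Qed.

End PlaneBoxes.

(** * Changes of variables *)

Section Affine.
Context {R : realType}.
Local Notation mu := (@lebesgue_measure R).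

(** The image of Lebesgue measure under x |-> c x + d, multiplied by c, gives
    intervals their length, hence it is Lebesgue measure. *)
Lemma ge0_integral_affine (c d : R) (f : R -> \bar R) : 0 < c ->
  measurable_fun setT f -> (forall x, 0 <= f x)%E ->
  (\int[mu]_x f x = c%:E * \int[mu]_x f (c * x + d)%R)%E.
Proof.
move=> c0 mf f0.
pose phi : measurableTypeR R -> measurableTypeR R := fun x => c * x + d.
have mphi : measurable_fun setT phi.
  by apply: measurable_funD => //; apply: measurable_funM.
have c0' : 0 <= c by exact: ltW.
pose nu0 := mscale (NngNum c0') (pushforward mu phi) :
  {measure set (measurableTypeR R) -> \bar R}.
pose nu' := nu0 mphi.
transitivity (\int[nu']_x f x)%E.
  apply: eq_measure_integral => A mA _.
  apply: lebesgue_measure_unique => // _ [[a b] _ <-].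
  rewrite /nu' /nu0 /= /mscale /= /pushforward.
  have -> : phi @^-1` `]a, b]%classic = `](a - d) / c, (b - d) / c]%classic.
    apply/seteqP; split => x /=; rewrite !in_itv/= /phi.
      by rewrite ltr_pdivrMr// ler_pdivlMr// => /andP[xa xb]; apply/andP; split; lra.
    by rewrite ltr_pdivrMr// ler_pdivlMr// => /andP[xa xb]; apply/andP; split; lra.
  rewrite !lebesgue_measure_itv/= !lte_fin ltr_pM2r ?invr_gt0// ltrD2r.
  case: ifPn => // _; last by rewrite mule0.
  by rewrite -!EFinB -EFinM; congr EFin; field; rewrite gt_eqF.
rewrite ge0_integral_mscale//; congr (_ * _)%E.
by rewrite ge0_integral_pushforward.
Qed.

End Affine.

Section PlaneMaps.
Context {R : realType}.
Local Notation mu := (@lebesgue_measure R).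
Implicit Types (f : R * R -> \bar R) (z : R * R).

Lemma lebesgue2_tonelli1 f : measurable_fun setT f -> (forall z, 0 <= f z)%E ->
  (\int[lebesgue2]_z f z = \int[mu]_x \int[mu]_y f (x, y))%E.
Proof. by move=> mf f0; apply: fubini_tonelli1. Qed.

Lemma lebesgue2_tonelli2 f : measurable_fun setT f -> (forall z, 0 <= f z)%E ->
  (\int[lebesgue2]_z f z = \int[mu]_y \int[mu]_x f (x, y))%E.
Proof. by move=> mf f0; apply: fubini_tonelli2. Qed.

Lemma measurable_pair1 f x : measurable_fun setT f ->
  measurable_fun setT (fun y => f (x, y)).
Proof. by move=> mf; apply: measurableT_comp. Qed.

Lemma measurable_pair2 f y : measurable_fun setT f ->
  measurable_fun setT (fun x => f (x, y)).
Proof. by move=> mf; apply: measurableT_comp. Qed.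

Definition preserves_lebesgue2 (T : R * R -> R * R) :=
  measurable_fun setT T /\
  forall f, measurable_fun setT f -> (forall z, 0 <= f z)%E ->
    (\int[lebesgue2]_z f (T z) = \int[lebesgue2]_z f z)%E.

Lemma preserves_lebesgue2_comp T1 T2 :
  preserves_lebesgue2 T1 -> preserves_lebesgue2 T2 ->
  preserves_lebesgue2 (T1 \o T2).
Proof.
move=> [mT1 p1] [mT2 p2]; split; first exact: measurableT_comp.
move=> f mf f0; rewrite -(p1 f)// -(p2 (f \o T1))//; first exact: measurableT_comp.
by move=> z; exact: f0.
Qed.

(** By Tonelli, since a shear is a translation of each horizontal line. *)
Lemma preserves_lebesgue2_shear1 (k c : R) :
  preserves_lebesgue2 (fun z => (z.1 + (k * z.2 + c), z.2)).
Proof.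
have mT : measurable_fun setT (fun z : R * R => (z.1 + (k * z.2 + c), z.2)).
  apply: measurable_fun_pair => //; apply: measurable_funD => //.
  by apply: measurable_funD => //; apply: measurable_funM.
split=> // f mf f0.
rewrite lebesgue2_tonelli2//; last exact: (measurableT_comp mf mT).
rewrite lebesgue2_tonelli2//; apply: eq_integral => y _ /=.
rewrite (@ge0_integral_affine _ 1 (k * y + c) (fun x => f (x, y)))//.
  by rewrite mul1e; apply: eq_integral => x _; rewrite mul1r.
exact: measurable_pair2.
Qed.

Lemma preserves_lebesgue2_shear2 (k c : R) :
  preserves_lebesgue2 (fun z => (z.1, z.2 + (k * z.1 + c))).
Proof.
have mT : measurable_fun setT (fun z : R * R => (z.1, z.2 + (k * z.1 + c))).
  apply: measurable_fun_pair => //; apply: measurable_funD => //.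
  by apply: measurable_funD => //; apply: measurable_funM.
split=> // f mf f0.
rewrite lebesgue2_tonelli1//; last exact: (measurableT_comp mf mT).
rewrite lebesgue2_tonelli1//; apply: eq_integral => x _ /=.
rewrite (@ge0_integral_affine _ 1 (k * x + c) (fun y => f (x, y)))//.
  by rewrite mul1e; apply: eq_integral => y _; rewrite mul1r.
exact: measurable_pair1.
Qed.

Definition rotation (z0 : R * R) (c s : R) (z : R * R) : R * R :=
  (z0.1 + (c * (z.1 - z0.1) - s * (z.2 - z0.2)),
   z0.2 + (s * (z.1 - z0.1) + c * (z.2 - z0.2))).

(** A rotation other than the half turn is a product of three shears, and the
    half turn is the square of a quarter turn. *)
Lemma preserves_lebesgue2_rotation z0 (c s : R) : c ^+ 2 + s ^+ 2 = 1 ->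
  preserves_lebesgue2 (rotation z0 c s).
Proof.
have Hs (c' s' : R) : s' != 0 -> c' ^+ 2 + s' ^+ 2 = 1 ->
    preserves_lebesgue2 (rotation z0 c' s').
  (* k is the tangent of half the angle *)
  move=> s0 cs; pose k := (1 - c') / s'.
  have ks : k * s' = 1 - c' by rewrite /k mulfVK.
  have kc : k * (1 + c') = s'.
    by apply: (mulIf s0); rewrite mulrAC ks; move: cs; rewrite !expr2 => cs; lra.
  have -> : rotation z0 c' s' =
      (fun z => (z.1 + (- k * z.2 + k * z0.2), z.2)) \o
      (fun z => (z.1, z.2 + (s' * z.1 + - (s' * z0.1)))) \o
      (fun z => (z.1 + (- k * z.2 + k * z0.2), z.2)).
    apply/funext => z; rewrite /rotation /=; congr (_, _).
      have -> : c' = 1 - k * s' by lra.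
      have -> : s' = k * (1 + (1 - k * s')) by rewrite -{1}kc; congr (_ * _); lra.
      have <- : s' = k * (1 + (1 - k * s')) by rewrite -{1}kc; congr (_ * _); lra.
      by rewrite -[in X in _ - X * _]kc (_ : c' = 1 - k * s'); [ring|lra].
    by rewrite (_ : c' = 1 - k * s'); [ring|lra].
  apply: preserves_lebesgue2_comp; last exact: preserves_lebesgue2_shear1.
  apply: preserves_lebesgue2_comp; last exact: preserves_lebesgue2_shear2.
  exact: preserves_lebesgue2_shear1.
move=> cs; have [s0|] := eqVneq s 0; last by move=> s0; exact: Hs.
have := cs; rewrite s0 expr0n addr0 => /eqP; rewrite sqrf_eq1 => /orP[]/eqP c1.
  have -> : rotation z0 c 0 = fun z => (z.1 + (0 * z.2 + 0), z.2).
    by apply/funext => -[x y]; rewrite /rotation c1/=; congr (_, _); ring.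
  exact: preserves_lebesgue2_shear1.
have -> : rotation z0 c 0 = rotation z0 0 1 \o rotation z0 0 1.
  by apply/funext => -[x y]; rewrite /rotation c1/=; congr (_, _); ring.
have H01 : preserves_lebesgue2 (rotation z0 0 1).
  by apply: Hs; rewrite ?oner_neq0// expr0n expr1n add0r.
exact: preserves_lebesgue2_comp.
Qed.

Lemma ge0_integral2_scale (c : R) z0 f : 0 < c ->
  measurable_fun setT f -> (forall z, 0 <= f z)%E ->
  (\int[lebesgue2]_z f z =
   (c ^+ 2)%:E * \int[lebesgue2]_z f (c * z.1 + z0.1, c * z.2 + z0.2)%R)%E.
Proof.
move=> c0 mf f0.
have mT : measurable_fun setT (fun z : R * R => (c * z.1 + z0.1, c * z.2 + z0.2)).
  by apply: measurable_fun_pair; apply: measurable_funD => //; apply: measurable_funM.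
rewrite lebesgue2_tonelli1// [in RHS]lebesgue2_tonelli1//; last first.
  exact: (measurableT_comp mf mT).
rewrite (@ge0_integral_affine _ c z0.1)//; last 2 first.
  exact: measurable_fun_fubini_tonelli_F.
  by move=> x; exact: integral_ge0.
rewrite expr2 EFinM -muleA; congr (_ * _)%E.
rewrite -ge0_integralZl//=; last 3 first.
- apply: (@measurable_fun_fubini_tonelli_F _ _ _ _ _ mu
    (fun z : R * R => f (c * z.1 + z0.1, c * z.2 + z0.2))) => //.
  exact: (measurableT_comp mf mT).
- by move=> x _; exact: integral_ge0.
- by rewrite lee_fin ltW.
apply: eq_integral => x _.
rewrite (@ge0_integral_affine _ c z0.2)//.
exact: measurable_pair1.
Qed.

End PlaneMaps.

(** * Integration over rectangles *)

Section Calculus.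
Context {R : realType}.
Local Notation mu := (@lebesgue_measure R).

Lemma continuous_add (U : topologicalType) (f g : U -> R) x :
  {for x, continuous f} -> {for x, continuous g} ->
  {for x, continuous (fun y => f y + g y)}.
Proof. by move=> cf cg; exact: (@continuousD _ _ _ f g). Qed.

Lemma continuous_sub (U : topologicalType) (f g : U -> R) x :
  {for x, continuous f} -> {for x, continuous g} ->
  {for x, continuous (fun y => f y - g y)}.
Proof. by move=> cf cg; exact: (@continuousB _ _ _ f g). Qed.

Lemma continuous_mul (U : topologicalType) (f g : U -> R) x :
  {for x, continuous f} -> {for x, continuous g} ->
  {for x, continuous (fun y => f y * g y)}.
Proof. by move=> cf cg; exact: (@continuousM _ _ f g). Qed.

Lemma continuous_sqr (U : topologicalType) (f : U -> R) x :
  {for x, continuous f} -> {for x, continuous (fun y => f y ^+ 2)}.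
Proof.
move=> cf; rewrite (_ : (fun x => f x ^+ 2) = f \* f); first exact: continuousM.
by apply/funext => y; rewrite /= expr2.
Qed.

Lemma compact_closed_box (a b c d : R) : compact (closed_box a b c d).
Proof. by apply: compact_setX; exact: segment_compact. Qed.

Lemma integrable_closed_box (a b c d : R) (f : R * R -> R) :
  (forall z, closed_box a b c d z -> {for z, continuous f}) ->
  lebesgue2.-integrable (closed_box a b c d) (EFin \o f).
Proof.
move=> cf; have mB := @measurable_closed_box R a b c d.
apply: measurable_bounded_integrable => //.
(* the larger box has its bounds in order even if the smaller one is empty *)
- have B1 : closed_box a b c d `<=` closed_box a (a + `|b - a|) c (c + `|d - c|).
    have h (x y : R) : y <= x + `|y - x| by have := ler_norm (y - x); lra.
    move=> z [/=]; rewrite !in_itv/= => /andP[z1 z2] /andP[z3 z4].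
    split; rewrite /= in_itv/=; apply/andP; split=> //; exact: (le_trans _ (h _ _)).
  apply: (@le_lt_trans _ _ (lebesgue2 (closed_box a (a + `|b - a|) c (c + `|d - c|)))).
    by apply: le_measure; rewrite ?inE//; exact: measurable_closed_box.
  by rewrite lebesgue2_closed_box ?lerDl// ltry.
- exact: continuous_at_measurable2.
- have cB := @compact_closed_box a b c d.
  have /continuous_compact/(_ cB)/compact_bounded[M [_ mrt]] :
      {within closed_box a b c d, continuous f}.
    by apply: continuous_in_subspaceT => z; rewrite inE => /cf.
  by exists M; split; rewrite ?num_real // => ? ? ? ?; exact: mrt.
Qed.

Lemma FTC_segment (F f : R -> R) (a b : R) : a <= b ->
  (forall x, a <= x <= b -> is_derive x 1 F (f x)) ->
  (forall x, a <= x <= b -> {for x, continuous f}) ->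
  \int[mu]_(x in `[a, b]) f x = F b - F a.
Proof.
move=> ab dF cf; move: ab; rewrite le_eqVlt => /predU1P[ab|ab].
  by rewrite -ab set_itv1 Rintegral_set1 subrr.
rewrite /Rintegral (@continuous_FTC2 _ f F)//.
- apply: continuous_in_subspaceT => x; rewrite inE/= in_itv/=; exact: cf.
- have cF x : a <= x <= b -> {for x, continuous F}.
    by move=> /dF dFx; apply/differentiable_continuous/derivable1_diffP.
  split.
  + by move=> x; rewrite in_itv/= => /andP[ax xb]; have [] := dF x; rewrite ?ltW.
  + by apply: cvg_at_right_filter; apply: cF; rewrite lexx ltW.
  + by apply: cvg_at_left_filter; apply: cF; rewrite lexx ltW.
- move=> x; rewrite in_itv/= => /andP[ax xb].
  by rewrite derive1E; apply: derive_val; apply: dF; rewrite !ltW.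
Qed.

Lemma continuous_pair (T U V : topologicalType) (f : T -> U) (g : T -> V) (x : T) :
  {for x, continuous f} -> {for x, continuous g} ->
  {for x, continuous (fun t => (f t, g t))}.
Proof. by move=> cf cg; exact: (cvg_pair cf cg). Qed.

Lemma continuous_slice1 (f : R * R -> R) x y : {for (x, y), continuous f} ->
  {for x, continuous (fun x => f (x, y))}.
Proof.
move=> cf; apply: (@continuous_comp _ _ _ (fun x => (x, y)) f); last exact: cf.
by apply: continuous_pair; [exact: cvg_id|exact: cvg_cst].
Qed.

Lemma continuous_slice2 (f : R * R -> R) x y : {for (x, y), continuous f} ->
  {for y, continuous (fun y => f (x, y))}.
Proof.
move=> cf; apply: (@continuous_comp _ _ _ (fun y => (x, y)) f); last exact: cf.
by apply: continuous_pair; [exact: cvg_cst|exact: cvg_id].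
Qed.

Lemma integrable_segment (f : R -> R) (a b : R) :
  (forall x, a <= x <= b -> {for x, continuous f}) ->
  mu.-integrable `[a, b] (EFin \o f).
Proof.
move=> cf; apply: continuous_compact_integrable; first exact: segment_compact.
by apply: continuous_in_subspaceT => x; rewrite inE/= in_itv; exact: cf.
Qed.

Lemma EFin_Rintegral_segment (f : R -> R) (a b : R) :
  (forall x, a <= x <= b -> {for x, continuous f}) ->
  (\int[mu]_(x in `[a, b]) (f x)%:E)%E = (\int[mu]_(x in `[a, b]) f x)%:E.
Proof.
move=> cf; rewrite /Rintegral fineK//.
have mab : measurable (`[a, b]%classic : set (measurableTypeR R)) by exact: measurable_itv.
exact: (integrable_fin_num mab (integrable_segment cf)).
Qed.

Lemma Rintegral_closed_box21 (a b c d : R) (f : R * R -> R) :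
  (forall z, closed_box a b c d z -> {for z, continuous f}) ->
  Rintegral lebesgue2 (closed_box a b c d) f =
  \int[mu]_(y in `[c, d]) \int[mu]_(x in `[a, b]) f (x, y).
Proof.
move=> cf; have If := integrable_closed_box cf.
have mB := @measurable_closed_box R a b c d.
have If' : lebesgue2.-integrable setT (EFin \o (f \_ (closed_box a b c d))).
  by rewrite -restrict_EFin; apply/integrable_restrict => //; rewrite setTI.
rewrite Rintegral_mkcond {1}/Rintegral.
rewrite -[X in fine X](integral21_prod_meas1 If').
rewrite [RHS]Rintegral_mkcond {1}/Rintegral; congr fine.
apply: eq_integral => y _; rewrite /fubini_G /= patchE.
case: ifPn => [|]; rewrite ?inE ?notin_setE => ycd.
  have -> : (fun x => ((f \_ (closed_box a b c d)) (x, y))%:E) =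
      ((EFin \o (fun x => f (x, y))) \_ `[a, b]%classic)%E.
    apply/funext => x; rewrite /= !patchE.
    case: (boolP (x \in `[a, b]%classic)); rewrite ?inE ?notin_setE => xab.
      by rewrite ifT// inE; split.
    by rewrite ifF//; apply/negbTE; rewrite notin_setE => -[].
  rewrite -integral_mkcond -EFin_Rintegral_segment// => x xab.
  by apply: continuous_slice1; apply: cf; split=> //=; rewrite in_itv.
rewrite integral0_eq// => x _; rewrite patchE ifF//.
by apply/negbTE; rewrite notin_setE => -[].
Qed.

Lemma Rintegral_closed_box12 (a b c d : R) (f : R * R -> R) :
  (forall z, closed_box a b c d z -> {for z, continuous f}) ->
  Rintegral lebesgue2 (closed_box a b c d) f =
  \int[mu]_(x in `[a, b]) \int[mu]_(y in `[c, d]) f (x, y).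
Proof.
move=> cf; have If := integrable_closed_box cf.
have mB := @measurable_closed_box R a b c d.
have If' : lebesgue2.-integrable setT (EFin \o (f \_ (closed_box a b c d))).
  by rewrite -restrict_EFin; apply/integrable_restrict => //; rewrite setTI.
rewrite Rintegral_mkcond {1}/Rintegral.
rewrite -[X in fine X](integral12_prod_meas1 If').
rewrite [RHS]Rintegral_mkcond {1}/Rintegral; congr fine.
apply: eq_integral => x _; rewrite /fubini_F /= patchE.
case: ifPn => [|]; rewrite ?inE ?notin_setE => xab.
  have -> : (fun y => ((f \_ (closed_box a b c d)) (x, y))%:E) =
      ((EFin \o (fun y => f (x, y))) \_ `[c, d]%classic)%E.
    apply/funext => y; rewrite /= !patchE.
    case: (boolP (y \in `[c, d]%classic)); rewrite ?inE ?notin_setE => ycd.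
      by rewrite ifT// inE; split.
    by rewrite ifF//; apply/negbTE; rewrite notin_setE => -[].
  rewrite -integral_mkcond -EFin_Rintegral_segment// => y ycd.
  by apply: continuous_slice2; apply: cf; split=> //=; rewrite in_itv.
rewrite integral0_eq// => y _; rewrite patchE ifF//.
by apply/negbTE; rewrite notin_setE => -[].
Qed.

Lemma Rintegral_closed_box_derive1 (a b c d : R) (P P' : R * R -> R) : a <= b ->
  (forall x y, closed_box a b c d (x, y) ->
     is_derive x 1 (fun x => P (x, y)) (P' (x, y))) ->
  (forall z, closed_box a b c d z -> {for z, continuous P'}) ->
  Rintegral lebesgue2 (closed_box a b c d) P' =
  \int[mu]_(y in `[c, d]) (P (b, y) - P (a, y)).
Proof.
move=> ab dP cP; rewrite Rintegral_closed_box21//.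
apply: eq_Rintegral => y; rewrite inE/= => ycd.
apply: (@FTC_segment (fun x => P (x, y)) (fun x => P' (x, y))) => // x xab.
  by apply: dP; split=> //=; rewrite in_itv.
by apply: continuous_slice1; apply: cP; split=> //=; rewrite in_itv.
Qed.

Lemma Rintegral_closed_box_derive2 (a b c d : R) (P P' : R * R -> R) : c <= d ->
  (forall x y, closed_box a b c d (x, y) ->
     is_derive y 1 (fun y => P (x, y)) (P' (x, y))) ->
  (forall z, closed_box a b c d z -> {for z, continuous P'}) ->
  Rintegral lebesgue2 (closed_box a b c d) P' =
  \int[mu]_(x in `[a, b]) (P (x, d) - P (x, c)).
Proof.
move=> cd dP cP; rewrite Rintegral_closed_box12//.
apply: eq_Rintegral => x; rewrite inE/= => xab.
apply: (@FTC_segment (fun y => P (x, y)) (fun y => P' (x, y))) => // y ycd.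
  by apply: dP; split=> //=; rewrite in_itv.
by apply: continuous_slice2; apply: cP; split=> //=; rewrite in_itv.
Qed.

(** Green's formula on the rectangle for the field (P, Q): the boundary terms
    on the sides y = 0 and y = p cancel by periodicity of Q. *)
Lemma Rintegral_period_const (a b p : R) (P Q D : R * R -> R) :
  a <= b -> 0 <= p ->
  (forall x y, closed_box a b 0 p (x, y) ->
     is_derive x 1 (fun x => P (x, y)) (D (x, y))) ->
  (forall x y, closed_box a b 0 p (x, y) ->
     is_derive y 1 (fun y => Q (x, y)) (D (x, y))) ->
  (forall z, closed_box a b 0 p z -> {for z, continuous P}) ->
  (forall z, closed_box a b 0 p z -> {for z, continuous D}) ->
  (forall x, a <= x <= b -> Q (x, p) = Q (x, 0)) ->
  \int[mu]_(y in `[0, p]) P (a, y) = \int[mu]_(y in `[0, p]) P (b, y).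
Proof.
move=> ab p0 dP dQ cP cD perQ.
have /esym := Rintegral_closed_box_derive1 ab dP cD.
rewrite (Rintegral_closed_box_derive2 p0 dQ cD).
rewrite [X in _ = X](_ : _ = 0); last first.
  rewrite (@eq_Rintegral _ _ _ mu _ (cst 0)).
    by rewrite Rintegral_cst// mul0r.
  by move=> x; rewrite inE/= in_itv/= => xab; rewrite perQ// subrr.
have iP x : a <= x <= b -> mu.-integrable `[0, p] (EFin \o (fun y => P (x, y))).
  move=> xab; apply: integrable_segment => y yp; apply: continuous_slice2.
  by apply: cP; split=> //=; rewrite in_itv.
rewrite RintegralB//; try by apply: iP; rewrite lexx ab.
by move/eqP; rewrite subr_eq0 => /eqP.
Qed.

End Calculus.

(** * Gradients and complex derivatives *)

Section Gradients.
Context {R : realType}.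
Implicit Types (f g : R * R -> R) (z : R * R).

(** Naming the two components of the differential lets the rules below compute
    gradients by unification. *)
Definition has_grad f z (p q : R) : Prop :=
  is_diff z f (fun v => p * v.1 + q * v.2).

Lemma has_grad_eq f z p q p' q' :
  has_grad f z p q -> p = p' -> q = q' -> has_grad f z p' q'.
Proof. by move=> H <- <-. Qed.

Lemma has_grad_differentiable f z p q : has_grad f z p q -> differentiable f z.
Proof. by move=> [H _]. Qed.

Lemma has_grad_continuous f z p q : has_grad f z p q -> {for z, continuous f}.
Proof. by move=> /has_grad_differentiable /differentiable_continuous. Qed.

Lemma has_grad_partial f z p q : has_grad f z p q ->
  partial1 f z = p /\ partial2 f z = q.
Proof.
move=> [df ddf]; rewrite /partial1 /partial2 !deriveE// ddf /=.
by rewrite !mulr1 !mulr0 addr0 add0r.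
Qed.

(** Taylor estimates provide remainders of this quadratic form. *)
Lemma has_grad_of_bound f z p q (C : R) :
  (forall v : R * R, `|v| <= 1 ->
     `|f (z + v) - f z - (p * v.1 + q * v.2)| <= C * `|v| ^+ 2) ->
  has_grad f z p q.
Proof.
move=> H; pose L (v : R * R) : R := p * v.1 + q * v.2.
have linL : linear L by move=> k u v; rewrite /L /= /GRing.scale/=; ring.
pose Lm := GRing.isLinear.Build _ _ _ _ L linL.
pose L' : {linear (R * R)%type -> R} := HB.pack L Lm.
have cL : continuous L'.
  move=> v; apply: (@continuousD _ _ _ (fun v : R * R => p * v.1) (fun v => q * v.2)).
    by apply: continuousM; [exact: cvg_cst|exact: cvg_fst].
  by apply: continuousM; [exact: cvg_cst|exact: cvg_snd].
suff Hf : forall e : R, 0 < e -> \forall v \near (0 : (R * R)%type),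
    `|f (v + z) - (f z + L' v)| <= e * `|v|.
  have dL : 'd f z = L' :> (R * R -> R).
    by apply: diff_unique => //; apply/eqaddoP => e e0; exact: Hf.
  split => //; apply/diff_locallyP; split; rewrite ?dL//.
  by apply/eqaddoP => e e0; exact: Hf.
move=> e e0; pose C' := `|C| + 1.
have C'0 : 0 < C' by rewrite /C' ltr_wpDl.
have eC : 0 < e / C' by rewrite divr_gt0.
near=> v.
  rewrite opprD addrA [v + z]addrC; apply: (le_trans (H v _)).
    near: v; apply/nbhs_ballP; exists 1 => //= v.
    by rewrite -ball_normE /= sub0r normrN => /ltW.
have Cv : C * `|v| <= e.
  apply: (@le_trans _ _ (C' * `|v|)).
    by rewrite ler_wpM2r// /C'; have := ler_norm C; lra.
  rewrite -ler_pdivlMl// mulrC; near: v; apply/nbhs_ballP; exists (e / C') => // v.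
  by rewrite -ball_normE /= sub0r normrN => /ltW.
by rewrite expr2 mulrA ler_wpM2r.
Unshelve. all: by end_near. Qed.

Lemma has_grad_cst c z : has_grad (cst c) z 0 0.
Proof.
by apply: is_diff_eq; apply/funext => v; rewrite !mul0r addr0.
Qed.

Lemma has_grad_fst z : has_grad (@fst R R) z 1 0.
Proof.
apply: (@has_grad_of_bound _ _ _ _ 0) => v _.
by rewrite (_ : _ - _ = 0) ?normr0 ?mul0r//=; ring.
Qed.

Lemma has_grad_snd z : has_grad (@snd R R) z 0 1.
Proof.
apply: (@has_grad_of_bound _ _ _ _ 0) => v _.
by rewrite (_ : _ - _ = 0) ?normr0 ?mul0r//=; ring.
Qed.

Lemma has_gradD f g z p q p' q' : has_grad f z p q -> has_grad g z p' q' ->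
  has_grad (fun w => f w + g w) z (p + p') (q + q').
Proof.
move=> df dg; apply: (is_diff_eq (is_diffD df dg)).
by apply/funext => v; rewrite !fctE; ring.
Qed.

Lemma has_gradB f g z p q p' q' : has_grad f z p q -> has_grad g z p' q' ->
  has_grad (fun w => f w - g w) z (p - p') (q - q').
Proof.
move=> df dg; apply: (is_diff_eq (is_diffB df dg)).
by apply/funext => v; rewrite !fctE; ring.
Qed.

Lemma has_gradN f z p q : has_grad f z p q ->
  has_grad (fun w => - f w) z (- p) (- q).
Proof.
move=> df; apply: (is_diff_eq (is_diffN df)).
by apply/funext => v; rewrite !fctE; ring.
Qed.

Lemma has_gradM f g z p q p' q' : has_grad f z p q -> has_grad g z p' q' ->
  has_grad (fun w => f w * g w) z (f z * p' + p * g z) (f z * q' + q * g z).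
Proof.
move=> df dg; apply: (is_diff_eq (is_diffM df dg)).
by apply/funext => v; rewrite !fctE /GRing.scale/=; ring.
Qed.

Lemma is_derive_is_diff (phi : R -> R) (x d : R) : is_derive x 1 phi d ->
  is_diff x phi (fun t => d * t).
Proof.
move=> [dphi vphi]; split; first exact/derivable1_diffP.
by rewrite diff1E; [rewrite derive1E vphi; apply/funext => t; rewrite mulrC|exact/derivable1_diffP].
Qed.

Lemma is_diff_is_derive (phi : R -> R) (x d : R) : is_diff x phi (fun t => d * t) ->
  is_derive x 1 phi d.
Proof.
move=> [dphi vphi]; split; first exact/derivable1_diffP.
by rewrite deriveE// vphi mulr1.
Qed.

Lemma has_grad_comp (phi : R -> R) f z (p q d : R) :
  has_grad f z p q -> is_derive (f z) 1 phi d ->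
  has_grad (fun w => phi (f w)) z (d * p) (d * q).
Proof.
move=> df /is_derive_is_diff dphi; apply: (is_diff_eq (is_diff_comp df dphi)).
by apply/funext => v /=; ring.
Qed.

Lemma has_grad_curve f (g1 g2 : R -> R) (t d1 d2 p q : R) :
  has_grad f (g1 t, g2 t) p q -> is_derive t 1 g1 d1 -> is_derive t 1 g2 d2 ->
  is_derive t 1 (fun t => f (g1 t, g2 t)) (p * d1 + q * d2).
Proof.
move=> df /is_derive_is_diff dg1 /is_derive_is_diff dg2.
apply: is_diff_is_derive.
apply: (is_diff_eq (is_diff_comp (is_diff_pair dg1 dg2) df)).
by apply/funext => v /=; ring.
Qed.

Lemma has_grad_slice1 f x y p q : has_grad f (x, y) p q ->
  is_derive x 1 (fun x => f (x, y)) p.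
Proof.
move=> df; have := has_grad_curve (g1 := id) (g2 := cst y) df
  (is_derive_id _ _) (is_derive_cst _ _ _).
by rewrite mulr1 mulr0 addr0.
Qed.

Lemma has_grad_slice2 f x y p q : has_grad f (x, y) p q ->
  is_derive y 1 (fun y => f (x, y)) q.
Proof.
move=> df; have := has_grad_curve (g1 := cst x) (g2 := id) df
  (is_derive_cst _ _ _) (is_derive_id _ _).
by rewrite mulr1 mulr0 add0r.
Qed.

Lemma has_gradV f z p q : f z != 0 -> has_grad f z p q ->
  has_grad (fun w => (f w)^-1) z (- (p / f z ^+ 2)) (- (q / f z ^+ 2)).
Proof.
move=> f0 df; have dinv : is_derive (f z) 1 (@GRing.inv R) (- (f z) ^- 2).
  have dV : derivable (fun x : R => x^-1) (f z) 1.
    by apply: derivableV => //; exact: derivable_id.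
  apply: DeriveDef => //.
  by rewrite (@deriveV _ _ id)// derive_id /GRing.scale /= mulr1.
by apply: (has_grad_eq (has_grad_comp df dinv)); rewrite mulNr mulrC.
Qed.

End Gradients.

Section Holomorphic.
Context {R : realType}.
Implicit Types (a b : R * R -> R) (z : R * R).

(** The Cauchy-Riemann equations for a + i b, with complex derivative d + i e. *)
Definition holo a b z (d e : R) : Prop :=
  has_grad a z d (- e) /\ has_grad b z e d.

Lemma holoD a b a' b' z d e d' e' : holo a b z d e -> holo a' b' z d' e' ->
  holo (fun w => a w + a' w) (fun w => b w + b' w) z (d + d') (e + e').
Proof.
move=> [da db] [da' db']; split.
  by apply: (has_grad_eq (has_gradD da da')) => //; rewrite opprD.
exact: has_gradD.
Qed.

(** Multiplication by the constant c + i s. *)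
Lemma holo_scale a b z d e (c s : R) : holo a b z d e ->
  holo (fun w => c * a w - s * b w) (fun w => s * a w + c * b w) z
       (c * d - s * e) (s * d + c * e).
Proof.
move=> [da db].
split; [apply: (has_grad_eq (has_gradB (has_gradM (has_grad_cst c z) da) (has_gradM (has_grad_cst s z) db)))
       |apply: (has_grad_eq (has_gradD (has_gradM (has_grad_cst s z) da) (has_gradM (has_grad_cst c z) db)))];
  rewrite /=; ring.
Qed.

Lemma holoM a b a' b' z d e d' e' : holo a b z d e -> holo a' b' z d' e' ->
  holo (fun w => a w * a' w - b w * b' w) (fun w => a w * b' w + b w * a' w) z
       (a z * d' + d * a' z - (b z * e' + e * b' z))
       (a z * e' + d * b' z + (b z * d' + e * a' z)).
Proof.
move=> [da db] [da' db'].
split; [apply: (has_grad_eq (has_gradB (has_gradM da da') (has_gradM db db')))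
       |apply: (has_grad_eq (has_gradD (has_gradM da db') (has_gradM db da')))]; ring.
Qed.

(** The pair is the inverse (a - i b) / (a^2 + b^2), with derivative
    - (d + i e) / (a + i b)^2. *)
Lemma holoV a b z d e : a z ^+ 2 + b z ^+ 2 != 0 -> holo a b z d e ->
  let n := a z ^+ 2 + b z ^+ 2 in
  holo (fun w => a w * (a w ^+ 2 + b w ^+ 2)^-1)
       (fun w => - b w * (a w ^+ 2 + b w ^+ 2)^-1) z
       (- ((a z ^+ 2 - b z ^+ 2) * d + (2 * a z * b z) * e) / n ^+ 2)
       (- ((a z ^+ 2 - b z ^+ 2) * e - (2 * a z * b z) * d) / n ^+ 2).
Proof.
move=> n0 [da db] n.
have dn : has_grad (fun w => a w ^+ 2 + b w ^+ 2) z
    (2 * (a z * d + b z * e)) (2 * (b z * d - a z * e)).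
  under [X in has_grad X]eq_fun do rewrite !expr2.
  by apply: (has_grad_eq (has_gradD (has_gradM da da) (has_gradM db db))); ring.
have dV := has_gradV n0 dn.
by split; [apply: (has_grad_eq (has_gradM da dV))
       |apply: (has_grad_eq (has_gradM (has_gradN db) dV))]; rewrite /n; field.
Qed.

End Holomorphic.

(** * Laplace transforms of rapidly decreasing functions *)

Section ExpEstimates.
Context {R : realType}.
Implicit Types (a b x : R).

Lemma MVT_zero (f df : R -> R) b K : (forall x, is_derive x 1 f (df x)) ->
  (forall x, `|x| <= `|b| -> `|df x| <= K) -> `|f b - f 0| <= K * `|b|.
Proof.
move=> dF dK.
have cf x : {for x, continuous f}.
  by apply/differentiable_continuous/derivable1_diffP; case: (dF x).
have [b0|b0] := leP 0 b.
  have [|c] := @MVT_segment _ f df 0 b b0 (fun x _ => dF x).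
    by apply: continuous_in_subspaceT => x _; exact: cf.
  rewrite in_itv/= subr0 => /andP[c0 cb] ->; rewrite normrM ler_wpM2r//.
  by apply: dK; rewrite !ger0_norm.
have [|c] := @MVT_segment _ f df b 0 (ltW b0) (fun x _ => dF x).
  by apply: continuous_in_subspaceT => x _; exact: cf.
rewrite in_itv/= sub0r => /andP[cb c0] e.
rewrite distrC e normrM normrN ler_wpM2r//.
by apply: dK; rewrite !ler0_norm ?(ltW b0)// lerN2.
Qed.

Lemma norm_sin_le b : `|sin b| <= `|b|.
Proof.
have := @MVT_zero sin cos b 1 _ (fun x _ => cos_max x).
by rewrite sin0 subr0 mul1r; apply.
Qed.

Lemma norm_cosB1_le1 b : `|cos b - 1| <= `|b|.
Proof.
have := @MVT_zero cos (fun x => - sin x) b 1 _.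
by rewrite cos0 mul1r; apply => // x _; rewrite normrN sin_max.
Qed.

Lemma norm_cosB1_le b : `|cos b - 1| <= `|b| * `|b|.
Proof.
have := @MVT_zero cos (fun x => - sin x) b `|b| _.
by rewrite cos0; apply => // x xb; rewrite normrN (le_trans (norm_sin_le x)).
Qed.

Lemma norm_sinB_le b : `|sin b - b| <= `|b| * `|b|.
Proof.
have := @MVT_zero (fun x => sin x - x) (fun x => cos x - 1) b `|b| _.
rewrite sin0 !subr0; apply => // x xb.
by rewrite (le_trans (norm_cosB1_le1 x)).
Qed.

Lemma norm_expRB1_le a : `|expR a - 1| <= expR `|a| * `|a|.
Proof.
have := @MVT_zero expR expR a (expR `|a|) _.
rewrite expR0; apply => // x xa; rewrite ger0_norm ?expR_ge0// ler_expR.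
exact: le_trans (ler_norm _) xa.
Qed.

Lemma norm_expRB1B_le a : `|expR a - 1 - a| <= expR `|a| * `|a| * `|a|.
Proof.
have -> : expR a - 1 - a = (expR a - a) - 1 by ring.
have := @MVT_zero (fun x => expR x - x) (fun x => expR x - 1) a (expR `|a| * `|a|) _.
rewrite expR0 subr0; apply => // x xa.
by rewrite (le_trans (norm_expRB1_le x))// ler_pM// ?ler_expR// expR_ge0.
Qed.

(** Second order Taylor bounds for the two components of the complex
    exponential exp (a + i b). *)
Lemma norm_expR_cos_taylor a b m : `|a| + `|b| <= m ->
  `|expR a * cos b - 1 - a| <= m ^+ 2 * expR m.
Proof.
move=> abm; have e1 : expR `|a| <= expR m.
  by rewrite ler_expR; have := normr_ge0 b; lra.
have -> : expR a * cos b - 1 - a = (expR a - 1 - a) + expR a * (cos b - 1) by ring.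
apply: (le_trans (ler_normD _ _)).
rewrite normrM (ger0_norm (expR_ge0 a)).
have h1 : `|expR a - 1 - a| <= expR m * (`|a| * `|a|).
  by rewrite (le_trans (norm_expRB1B_le a))// -mulrA ler_wpM2r// mulr_ge0.
have h2 : expR a * `|cos b - 1| <= expR m * (`|b| * `|b|).
  rewrite ler_pM ?expR_ge0//; last exact: norm_cosB1_le.
  by rewrite (le_trans _ e1)// ler_expR ler_norm.
apply: (le_trans (lerD h1 h2)); rewrite -mulrDr mulrC ler_wpM2r ?expR_ge0//.
have : (`|a| + `|b|) ^+ 2 <= m ^+ 2 by rewrite ler_sqr ?nnegrE ?addr_ge0// (le_trans _ abm)// addr_ge0.
by apply: le_trans; have := mulr_ge0 (normr_ge0 a) (normr_ge0 b); rewrite sqrrD !expr2; lra.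
Qed.

Lemma norm_expR_sin_taylor a b m : `|a| + `|b| <= m ->
  `|expR a * sin b - b| <= m ^+ 2 * expR m.
Proof.
move=> abm; have e1 : expR `|a| <= expR m.
  by rewrite ler_expR; have := normr_ge0 b; lra.
have -> : expR a * sin b - b = expR a * (sin b - b) + (expR a - 1) * b by ring.
apply: (le_trans (ler_normD _ _)).
rewrite !normrM (ger0_norm (expR_ge0 a)).
have h1 : `|expR a - 1| * `|b| <= expR m * (`|a| * `|b|).
  by rewrite mulrA ler_wpM2r// (le_trans (norm_expRB1_le a))// ler_wpM2r.
have h2 : expR a * `|sin b - b| <= expR m * (`|b| * `|b|).
  rewrite ler_pM ?expR_ge0//; last exact: norm_sinB_le.
  by rewrite (le_trans _ e1)// ler_expR ler_norm.
apply: (le_trans (lerD h2 h1)); rewrite -mulrDr mulrC ler_wpM2r ?expR_ge0//.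
have : (`|a| + `|b|) ^+ 2 <= m ^+ 2 by rewrite ler_sqr ?nnegrE ?addr_ge0// (le_trans _ abm)// addr_ge0.
apply: le_trans; have := mulr_ge0 (normr_ge0 a) (normr_ge0 b).
by have := sqr_ge0 `|a|; rewrite sqrrD !expr2; lra.
Qed.

End ExpEstimates.

Section LaplaceKernel.
Context {R : realType}.
Local Notation mu := (@lebesgue_measure R).
Implicit Types (k : R -> R) (z : R * R).

(** What makes the two-sided Laplace transform converge at every point, together
    with all its derivatives. *)
Definition fast_decay k : Prop := measurable_fun setT k /\
  forall X, mu.-integrable setT (EFin \o (fun t => k t * expR (X * `|t|))).

(** The factor 2 pi t arises when exp (2 pi t z) is differentiated in z. *)
Definition dilate k : R -> R := fun t => 2 * pi * t * k t.

Lemma pi_ge1 : 1 <= pi :> R.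
Proof. by apply: (le_trans _ (pi_ge2 R)); rewrite ler1n. Qed.

Lemma integrable_dominated (f g : R -> R) : measurable_fun setT f ->
  mu.-integrable setT (EFin \o g) -> (forall t, `|f t| <= `|g t|) ->
  mu.-integrable setT (EFin \o f).
Proof.
move=> mf ig fg; apply: (le_integrable _ _ _ ig) => //; first exact/measurable_EFinP.
by move=> t _ /=; rewrite lee_fin.
Qed.

Lemma measurable_expR_norm X : measurable_fun setT (fun t : R => expR (X * `|t|)).
Proof.
by apply: measurableT_comp => //; apply: measurable_funM => //; exact: normr_measurable.
Qed.

Lemma norm_le_expR (t : R) : `|t| <= expR `|t|.
Proof. by have := expR_ge1Dx `|t|; lra. Qed.

Lemma fast_decay_dilate k : fast_decay k -> fast_decay (dilate k).
Proof.
move=> [mk ik]; split; first by do ?apply: measurable_funM.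
move=> X; have := integrableZl (measurableT) (2 * pi) (ik (X + 1)).
move=> /= H; apply: (integrable_dominated _ H).
  apply: measurable_funM; last exact: measurable_expR_norm.
  by do ?apply: measurable_funM.
move=> t /=; rewrite /dilate !normrM mulrDl mul1r expRD -!mulrA ler_wpM2l//.
rewrite ler_wpM2l// mulrCA ler_wpM2l// mulrC !(ger0_norm (expR_ge0 _)) normrM.
rewrite !(ger0_norm (expR_ge0 _)).
by rewrite ler_wpM2l ?expR_ge0// norm_le_expR.
Qed.

(** With v = exp (X |t| - pi t^2), the product |k| v is at most k^2 + v^2, and
    v^2 <= exp (X^2) exp (- t^2) because 2 X |t| <= X^2 + t^2 and pi >= 1. *)
Lemma fast_decay_gauss k : measurable_fun setT k ->
  mu.-integrable setT (EFin \o (fun t => k t ^+ 2)) ->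
  fast_decay (fun t => k t * expR (- (pi * t ^+ 2))).
Proof.
move=> mk ik.
have mG : measurable_fun setT (fun t : R => expR (- (pi * t ^+ 2))).
  apply: measurableT_comp => //; apply: measurableT_comp => //.
  by apply: measurable_funM => //; exact: measurable_funX.
split; first exact: measurable_funM.
move=> X.
have iG := integrableZl measurableT (expR (X ^+ 2)) (@integrableT_gauss R).
have iS := integrableD measurableT ik iG.
apply: (@integrable_dominated _ (fun t => k t ^+ 2 + expR (X ^+ 2) * gauss_fun t)).
- by apply: measurable_funM; [exact: measurable_funM|exact: measurable_expR_norm].
- exact: iS.
move=> t; rewrite [leRHS]ger0_norm; last first.
  by rewrite addr_ge0 ?sqr_ge0// mulr_ge0 ?expR_ge0// gauss_fun_ge0.
rewrite -mulrA -expRD normrM (ger0_norm (expR_ge0 _)).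
set u := expR _.
have uu : u ^+ 2 <= expR (X ^+ 2) * gauss_fun t.
  rewrite /u /gauss_fun -expRD -expRM_natl ler_expR.
  have t2 : `|t| ^+ 2 = t ^+ 2 by rewrite real_normK ?num_real.
  have := ler_wpM2r (sqr_ge0 t) pi_ge1; rewrite mul1r => h.
  have := sqr_ge0 (`|t| - X); rewrite sqrrB t2 => h2.
  by lra.
apply: le_trans (lerD (lexx _) uu).
have : `|k t| ^+ 2 = k t ^+ 2 by rewrite real_normK ?num_real.
have := sqr_ge0 (`|k t| - u); have := sqr_ge0 (`|k t|); have := sqr_ge0 u.
by rewrite sqrrB; lra.
Qed.

Definition kernel_cos z (t : R) : R := expR (2 * pi * t * z.1) * cos (2 * pi * t * z.2).
Definition kernel_sin z (t : R) : R := expR (2 * pi * t * z.1) * sin (2 * pi * t * z.2).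

(** Real and imaginary parts of the two-sided Laplace transform
    z |-> int k(t) exp(2 pi t z) dt. *)
Definition laplace_re k z : R := \int[mu]_t (k t * kernel_cos z t).
Definition laplace_im k z : R := \int[mu]_t (k t * kernel_sin z t).

Lemma measurable_kernel_cos z : measurable_fun setT (kernel_cos z).
Proof.
apply: measurable_funM; apply: measurableT_comp => //; last first.
- by do ?apply: measurable_funM.
- by apply: continuous_measurable_fun; exact: continuous_cos.
by do ?apply: measurable_funM.
Qed.

Lemma measurable_kernel_sin z : measurable_fun setT (kernel_sin z).
Proof.
apply: measurable_funM; apply: measurableT_comp => //; last first.
- by do ?apply: measurable_funM.
- by apply: continuous_measurable_fun; exact: continuous_sin.
by do ?apply: measurable_funM.
Qed.

Lemma expR_kernel_le (x t : R) :
  expR (2 * pi * t * x) <= expR (2 * pi * `|x| * `|t|).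
Proof.
rewrite ler_expR -!mulrA [`|x| * _]mulrC -normrM ler_wpM2l// ler_wpM2l ?pi_ge0//.
exact: ler_norm.
Qed.

Lemma integrable_kernel_cos k z : fast_decay k ->
  mu.-integrable setT (EFin \o (fun t => k t * kernel_cos z t)).
Proof.
move=> [mk ik]; apply: (integrable_dominated _ (ik (2 * pi * `|z.1|))).
  by apply: measurable_funM => //; exact: measurable_kernel_cos.
move=> t; rewrite !normrM ler_wpM2l// !(ger0_norm (expR_ge0 _)).
apply: le_trans (expR_kernel_le _ _).
by rewrite ler_piMr ?expR_ge0// cos_max.
Qed.

Lemma integrable_kernel_sin k z : fast_decay k ->
  mu.-integrable setT (EFin \o (fun t => k t * kernel_sin z t)).
Proof.
move=> [mk ik]; apply: (integrable_dominated _ (ik (2 * pi * `|z.1|))).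
  by apply: measurable_funM => //; exact: measurable_kernel_sin.
move=> t; rewrite !normrM ler_wpM2l// !(ger0_norm (expR_ge0 _)).
apply: le_trans (expR_kernel_le _ _).
by rewrite ler_piMr ?expR_ge0// sin_max.
Qed.

Lemma Rintegral_taylor (f1 f2 f3 f4 g : R -> R) (c d K : R) :
  mu.-integrable setT (EFin \o f1) -> mu.-integrable setT (EFin \o f2) ->
  mu.-integrable setT (EFin \o f3) -> mu.-integrable setT (EFin \o f4) ->
  mu.-integrable setT (EFin \o g) ->
  (forall t, `|f1 t - f2 t - (f3 t * c + f4 t * d)| <= K * g t) ->
  `|\int[mu]_t f1 t - \int[mu]_t f2 t -
    ((\int[mu]_t f3 t) * c + (\int[mu]_t f4 t) * d)| <= K * \int[mu]_t g t.
Proof.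
move=> i1 i2 i3 i4 ig H.
have i12 := integrableB measurableT i1 i2.
have i3c := integrableZr measurableT c i3.
have i4d := integrableZr measurableT d i4.
have i34 := integrableD measurableT i3c i4d.
have i := integrableB measurableT i12 i34.
have iKg := integrableZl measurableT K ig.
rewrite -(RintegralZr _ _ i3)// -(RintegralZr _ _ i4)// -RintegralB// -RintegralD//.
rewrite -RintegralB// -RintegralZl//.
apply: (le_trans (le_normr_Rintegral measurableT i)).
apply: (le_Rintegral measurableT (integrable_norm i) iKg).
by move=> t _; exact: H.
Qed.

Lemma sqr_le_expR (t : R) : t ^+ 2 <= 2 * expR `|t|.
Proof.
have := expR_ge1Dxn 1 (normr_ge0 t).
rewrite real_normK ?num_real// (_ : 2`!%:R = 2 :> R)//; lra.
Qed.

(** For an increment (p, q) of size n <= 1, the quadratic Taylor remainder of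
    exp (2 pi t z) is n^2 times an exponential of |t|, uniformly in (p, q). *)
Lemma kernel_remainder (x y p q t n : R) : `|p| <= n -> `|q| <= n -> n <= 1 ->
  let a := 2 * pi * t * p in let b := 2 * pi * t * q in
  let m := 4 * pi * n * `|t| in
  `|a| + `|b| <= m /\
  expR (2 * pi * t * x) * (m ^+ 2 * expR m + m ^+ 2 * expR m) <=
    n ^+ 2 * (64 * pi ^+ 2 * expR ((2 * pi * `|x| + 4 * pi + 1) * `|t|)).
Proof.
move=> pn qn n1 a b m.
have n0 : 0 <= n by rewrite (le_trans _ pn).
have pi0 := @pi_ge0 R.
split.
  rewrite /a /b /m !normrM (ger0_norm pi0) (ger0_norm (ler0n R 2)).
  have := ler_wpM2l (normr_ge0 t) (lerD pn qn) => h.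
  have := ler_wpM2l pi0 h; lra.
have e1 := expR_kernel_le x t.
have mt : expR m <= expR (4 * pi * `|t|).
  by rewrite ler_expR /m; have := ler_wpM2r (normr_ge0 t) (ler_wpM2l pi0 n1); lra.
have m2 : m ^+ 2 <= n ^+ 2 * (32 * pi ^+ 2 * expR `|t|).
  rewrite /m !exprMn real_normK ?num_real//.
  have h := ler_wpM2l (mulr_ge0 (sqr_ge0 pi) (sqr_ge0 n)) (sqr_le_expR t).
  have -> : (4 : R) ^+ 2 = 16 by ring.
  by lra.
have -> : m ^+ 2 * expR m + m ^+ 2 * expR m = 2 * (m ^+ 2 * expR m) by ring.
have -> : expR ((2 * pi * `|x| + 4 * pi + 1) * `|t|) =
    expR (2 * pi * `|x| * `|t|) * expR (4 * pi * `|t|) * expR `|t|.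
  by rewrite -!expRD; congr expR; ring.
apply: (@le_trans _ _ (expR (2 * pi * `|x| * `|t|) * (2 *
   (n ^+ 2 * (32 * pi ^+ 2 * expR `|t|) * expR (4 * pi * `|t|))))).
  apply: ler_pM => //.
    by rewrite mulr_ge0// mulr_ge0 ?expR_ge0 ?sqr_ge0.
  by apply: ler_wpM2l => //; apply: ler_pM => //; rewrite ?sqr_ge0 ?expR_ge0.
by rewrite le_eqVlt; apply/orP; left; apply/eqP; ring.
Qed.

Lemma pair_norm_bound (v : R * R) : `|v.1| <= `|v| /\ `|v.2| <= `|v|.
Proof. by rewrite prod_normE /= !le_max !lexx orbT. Qed.

(** Differentiation under the integral sign, by integrating the second order
    Taylor bound of the kernel. *)
Lemma holo_laplace k z : fast_decay k ->
  holo (laplace_re k) (laplace_im k) z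
       (laplace_re (dilate k) z) (laplace_im (dilate k) z).
Proof.
move=> dk; have [mk ik] := dk; have dk' := fast_decay_dilate dk.
pose C := 2 * pi * `|z.1| + 4 * pi + 1.
pose g t := 64 * pi ^+ 2 * `|k t * expR (C * `|t|)|.
have ig : mu.-integrable setT (EFin \o g).
  exact: (integrableZl measurableT (64 * pi ^+ 2) (integrable_norm (ik C))).
have gE t n : n ^+ 2 * g t = `|k t| * (n ^+ 2 * (64 * pi ^+ 2 * expR (C * `|t|))).
  by rewrite /g normrM (ger0_norm (expR_ge0 _)); ring.
split; apply: (@has_grad_of_bound _ _ _ _ _ (\int[mu]_t g t)) => v v1;
  have [v1n v2n] := pair_norm_bound v; rewrite [leRHS]mulrC.
- rewrite /laplace_re /laplace_im mulNr -mulrN.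
  apply: Rintegral_taylor => //; try exact: integrable_kernel_cos;
    try exact: integrable_kernel_sin.
  move=> t; rewrite gE.
  have [ab rem] := kernel_remainder z.1 z.2 t v1n v2n v1.
  set a := 2 * pi * t * v.1 in ab; set b := 2 * pi * t * v.2 in ab.
  set m := 4 * pi * `|v| * `|t| in ab rem.
  rewrite (_ : _ - _ = k t * (expR (2 * pi * t * z.1) *
     (cos (2 * pi * t * z.2) * (expR a * cos b - 1 - a)
      - sin (2 * pi * t * z.2) * (expR a * sin b - b)))); last first.
    rewrite /kernel_cos /kernel_sin /dilate /a /b [(z + v).1]/= [(z + v).2]/= !(mulrDr (2 * pi * t)) expRD cosD; ring.
  rewrite normrM ler_wpM2l//; apply: le_trans rem.
  rewrite normrM (ger0_norm (expR_ge0 _)) ler_wpM2l ?expR_ge0//.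
  apply: (le_trans (ler_normB _ _)); rewrite !normrM; apply: lerD.
    rewrite -[leRHS]mul1r ler_pM// ?cos_max//.
    exact: norm_expR_cos_taylor.
  rewrite -[leRHS]mul1r ler_pM// ?sin_max//.
  exact: norm_expR_sin_taylor.
- rewrite /laplace_re /laplace_im.
  apply: Rintegral_taylor => //; try exact: integrable_kernel_cos;
    try exact: integrable_kernel_sin.
  move=> t; rewrite gE.
  have [ab rem] := kernel_remainder z.1 z.2 t v1n v2n v1.
  set a := 2 * pi * t * v.1 in ab; set b := 2 * pi * t * v.2 in ab.
  set m := 4 * pi * `|v| * `|t| in ab rem.
  rewrite (_ : _ - _ = k t * (expR (2 * pi * t * z.1) *
     (cos (2 * pi * t * z.2) * (expR a * sin b - b)
      + sin (2 * pi * t * z.2) * (expR a * cos b - 1 - a)))); last first.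
    rewrite /kernel_cos /kernel_sin /dilate /a /b [(z + v).1]/= [(z + v).2]/= !(mulrDr (2 * pi * t)) expRD sinD; ring.
  rewrite normrM ler_wpM2l//; apply: le_trans rem.
  rewrite normrM (ger0_norm (expR_ge0 _)) ler_wpM2l ?expR_ge0//.
  apply: (le_trans (ler_normD _ _)); rewrite !normrM; apply: lerD.
    rewrite -[leRHS]mul1r ler_pM// ?cos_max//.
    exact: norm_expR_sin_taylor.
  rewrite -[leRHS]mul1r ler_pM// ?sin_max//.
  exact: norm_expR_cos_taylor.
Qed.

End LaplaceKernel.

(** * Square norms and the Gabor transform *)

Section SquareNorms.
Context {R : realType}.
Local Open Scope ereal_scope.

Lemma Lnorm2_sqr d (T : measurableType d) (mu : {measure set T -> \bar R})
    (F : T -> R) :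
  'N[mu]_2%:E[EFin \o F] `^ 2 = \int[mu]_x ((F x) ^+ 2)%:E.
Proof.
rewrite poweR_Lnorm//; apply: eq_integral => x _ /=.
by rewrite powR_mulrn// real_normK ?num_real.
Qed.

Lemma Lp_norm2_sqr (D : set (R * R)) (F : R * R -> R) :
  Lp_norm 2%:E D F `^ 2 = \int[lebesgue2]_(z in D) ((F z) ^+ 2)%:E.
Proof.
rewrite /Lp_norm Lnorm2_sqr [RHS]integral_mkcond; apply: eq_integral => z _.
by rewrite !patchE; case: ifP => // _; rewrite expr0n.
Qed.

(** Passes from squared norms back to norms; the norms may be infinite. *)
Lemma le_of_sqr_le (K : R) (X Y W : \bar R) : (0 < K)%R ->
  0 <= X -> 0 <= Y -> 0 <= W ->
  X `^ 2 <= (K ^+ 2)%:E * (Y `^ 2 + W `^ 2) -> X <= K%:E * (Y + W).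
Proof.
move=> K0 X0 Y0 W0.
have [->|Yy] := eqVneq Y +oo.
  by move=> _; rewrite addye ?gt_eqF// ?(lt_le_trans _ W0)// gt0_muley ?leey// lte_fin.
have [->|Wy] := eqVneq W +oo.
  by move=> _; rewrite addey ?gt_eqF// ?(lt_le_trans _ Y0)// gt0_muley ?leey// lte_fin.
move: Y Y0 Yy W W0 Wy X X0 => [y||]// y0 _ [w||]// w0 _ [x||]// x0; last first.
  by rewrite !poweR_EFin poweRyr// -EFinD -EFinM leye_eq.
rewrite !poweR_EFin -!EFinD -!EFinM !lee_fin in x0 y0 w0 *.
rewrite !powR_mulrn// => H.
rewrite -(@ler_sqr _ x) ?nnegrE ?mulr_ge0 ?addr_ge0// ?(ltW K0)//.
apply: (le_trans H); rewrite exprMn ler_wpM2l ?sqr_ge0// sqrrD.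
by have := mulr_ge0 y0 w0; lra.
Qed.

End SquareNorms.

Section GaborEntire.
Context {R : realType}.
Local Notation mu := (@lebesgue_measure R).

Lemma modulusE (x : R[i]) :
  modulus x = Num.sqrt (complex.Re x ^+ 2 + complex.Im x ^+ 2).
Proof. by case: x. Qed.

Lemma L2_square_integrable (g : R -> R[i]) : L2 g ->
  mu.-integrable setT (EFin \o (fun t => complex.Re (g t) ^+ 2)) /\
  mu.-integrable setT (EFin \o (fun t => complex.Im (g t) ^+ 2)).
Proof.
move=> [mr mi ng].
have : ('N[mu]_2%:E[EFin \o (fun t => modulus (g t))] `^ 2 < +oo)%E.
  exact: poweR_lty.
rewrite Lnorm2_sqr => H.
have mr2 : measurable_fun setT (fun t => complex.Re (g t) ^+ 2) by exact: measurable_funX.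
have mi2 : measurable_fun setT (fun t => complex.Im (g t) ^+ 2) by exact: measurable_funX.
have iS : mu.-integrable setT
    (EFin \o (fun t => complex.Re (g t) ^+ 2 + complex.Im (g t) ^+ 2)).
  apply/integrableP; split; first by apply/measurable_EFinP; exact: measurable_funD.
  apply: le_lt_trans H; rewrite le_eqVlt; apply/orP; left; apply/eqP.
  apply: eq_integral => t _ /=; rewrite modulusE sqr_sqrtr ?addr_ge0 ?sqr_ge0//.
  by rewrite ger0_norm// addr_ge0 ?sqr_ge0.
by split; apply: (integrable_dominated _ iS) => // t;
   rewrite !ger0_norm ?addr_ge0 ?sqr_ge0// ?lerDl ?lerDr sqr_ge0.
Qed.

(** Expanding (t - x)^2 turns the Gabor transform into exp (- pi x^2) times a
    Laplace transform of g(t) exp (- pi t^2). For g = k1 + i k2 its conjugate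
    has the parts a = re k1 + im k2 and b = im k1 - re k2 in terms of the real
    and imaginary parts of the transforms of k1 and k2. *)
Lemma gabor_entire (g : R -> R[i]) : L2 g ->
  exists a b d e : R * R -> R,
  [/\ forall z, holo a b z (d z) (e z),
      continuous d, continuous e &
      forall z, gabor g z = ((expR (- (pi * z.1 ^+ 2)) * a z) +i*
                             (- (expR (- (pi * z.1 ^+ 2)) * b z)))%C].
Proof.
move=> Lg; have [mr mi _] := Lg; have [i1 i2] := L2_square_integrable Lg.
pose k1 t := complex.Re (g t) * expR (- (pi * t ^+ 2)).
pose k2 t := complex.Im (g t) * expR (- (pi * t ^+ 2)).
have f1 : fast_decay k1 by exact: fast_decay_gauss.
have f2 : fast_decay k2 by exact: fast_decay_gauss.
have H (j1 j2 : R -> R) z : fast_decay j1 -> fast_decay j2 ->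
    holo (fun z => laplace_re j1 z + laplace_im j2 z)
         (fun z => laplace_im j1 z - laplace_re j2 z) z
         (laplace_re (dilate j1) z + laplace_im (dilate j2) z)
         (laplace_im (dilate j1) z - laplace_re (dilate j2) z).
  move=> /holo_laplace-/(_ z) [h1 h1'] /holo_laplace-/(_ z) [h2 h2'].
  split; [apply: (has_grad_eq (has_gradD h1 h2')) => //; ring
         |apply: (has_grad_eq (has_gradB h1' h2)) => //; ring].
have f1' := fast_decay_dilate f1; have f2' := fast_decay_dilate f2.
exists (fun z => laplace_re k1 z + laplace_im k2 z),
  (fun z => laplace_im k1 z - laplace_re k2 z),
  (fun z => laplace_re (dilate k1) z + laplace_im (dilate k2) z),
  (fun z => laplace_im (dilate k1) z - laplace_re (dilate k2) z).
split.
- by move=> z; exact: H.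
- by move=> z; have [/has_grad_continuous] := H _ _ z f1' f2'.
- by move=> z; have [_ /has_grad_continuous] := H _ _ z f1' f2'.
move=> z; rewrite /gabor /cintegral.
have c1 := integrable_kernel_cos z f1; have s1 := integrable_kernel_sin z f1.
have c2 := integrable_kernel_cos z f2; have s2 := integrable_kernel_sin z f2.
have gaussE t : expR (- (pi * (t - z.1) ^+ 2)) = expR (- (pi * z.1 ^+ 2)) *
    (expR (- (pi * t ^+ 2)) * expR (2 * pi * t * z.1)).
  by rewrite -!expRD; congr expR; ring.
congr (_ +i* _)%C.
- rewrite /laplace_re /laplace_im -RintegralD// -RintegralZl//; last exact: (integrableD _ c1 s2).
  apply: eq_Rintegral => t _; rewrite /kernel_cos /kernel_sin /k1 /k2.
  rewrite /gaussian /expi cosN sinN gaussE; case: (g t) => gr gi /=; ring.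
- rewrite /laplace_re /laplace_im -RintegralB// -mulNr -RintegralZl//; last exact: (integrableB _ s1 c2).
  apply: eq_Rintegral => t _; rewrite /kernel_cos /kernel_sin /k1 /k2.
  rewrite /gaussian /expi cosN sinN gaussE; case: (g t) => gr gi /=; ring.
Qed.

End GaborEntire.

(** * Circular means of holomorphic functions *)

Section Polar.
Context {R : realType}.
Local Notation mu := (@lebesgue_measure R).
Local Notation T := (pi *+ 2 : R).
Implicit Types (z w : R * R) (t th tau phi : R).

Lemma period_gt0 : 0 < T. Proof. by rewrite mulrn_wgt0// pi_gt0. Qed.
Lemma period_ge0 : 0 <= T. Proof. exact/ltW/period_gt0. Qed.

(** The variance of f on the interval is nonnegative. *)
Lemma Rintegral_sqr_le (f : R -> R) (a b : R) : a < b ->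
  (forall x, a <= x <= b -> {for x, continuous f}) ->
  (\int[mu]_(x in `[a, b]) f x) ^+ 2 <=
  (b - a) * \int[mu]_(x in `[a, b]) (f x ^+ 2).
Proof.
move=> ab cf; set I := \int[mu]_(x in `[a, b]) f x; pose c := I / (b - a).
have ba0 : 0 < b - a by rewrite subr_gt0.
have cf2 x : a <= x <= b -> {for x, continuous (fun x => f x ^+ 2)}.
  by move=> xab; apply: continuous_sqr; exact: cf.
have i1 := integrable_segment cf; have i2 := integrable_segment cf2.
have mab : measurable (`[a, b]%classic : set (measurableTypeR R)) by exact: measurable_itv.
have ic : mu.-integrable `[a, b] (EFin \o cst (c ^+ 2)).
  by apply: integrable_segment => x _; exact: cvg_cst.
have i1' := integrableZl mab (2 * c) i1.
have : 0 <= \int[mu]_(x in `[a, b]) (f x ^+ 2 - 2 * c * f x + c ^+ 2).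
  apply: Rintegral_ge0 => x _.
  by rewrite (_ : _ + _ = (f x - c) ^+ 2) ?sqr_ge0//; ring.
rewrite RintegralD//; last exact: (integrableB mab i2 i1').
rewrite RintegralB// (RintegralZl _ mab i1) -/I Rintegral_cst//.
have -> : fine (mu `[a, b]%classic) = b - a.
  by rewrite /= lebesgue_measure_itv/= lte_fin ab.
set J := \int[mu]_(x in `[a, b]) (f x ^+ 2); have -> : I = c * (b - a) by rewrite /c divfK ?gt_eqF.
move=> H; rewrite -subr_ge0 (_ : _ - _ = (b - a) * (J - 2 * c * (c * (b - a)) + c ^+ 2 * (b - a))).
  by rewrite mulr_ge0// ltW.
by ring.
Qed.

Lemma is_derive_addl (c x : R) : is_derive x 1 (fun y => c + y) 1.
Proof.
have H := is_deriveD (is_derive_cst c x 1) (is_derive_id x 1).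
by apply: (is_derive_eq H); rewrite add0r.
Qed.

Lemma is_derive_addr (c x : R) : is_derive x 1 (fun y => y + c) 1.
Proof.
have H := is_deriveD (is_derive_id x 1) (is_derive_cst c x 1).
by apply: (is_derive_eq H); rewrite addr0.
Qed.

(** Polar coordinates with the logarithm of the radius as first coordinate:
    these are conformal, so the Cauchy-Riemann equations keep their form. *)
Definition polar z0 tau th : R * R :=
  (z0.1 + expR tau * cos th, z0.2 + expR tau * sin th).

Lemma polar_periodic z0 tau th : polar z0 tau (th + T) = polar z0 tau th.
Proof. by rewrite /polar cosD2pi sinD2pi. Qed.

Lemma polar_derive (p : R * R -> R) z0 (g1 g2 : R -> R) t (d1 d2 a b : R) :
  has_grad p (polar z0 (g1 t) (g2 t)) a b ->
  is_derive t 1 g1 d1 -> is_derive t 1 g2 d2 ->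
  is_derive t 1 (fun t => p (polar z0 (g1 t) (g2 t)))
    ((a * (expR (g1 t) * cos (g2 t)) + b * (expR (g1 t) * sin (g2 t))) * d1 +
     (b * (expR (g1 t) * cos (g2 t)) - a * (expR (g1 t) * sin (g2 t))) * d2).
Proof.
move=> dp dg1 dg2.
have de : is_derive t 1 (fun t => expR (g1 t)) (expR (g1 t) * d1).
  by apply: (is_derive_eq (is_derive1_comp _ _)); rewrite mulrC.
have dc : is_derive t 1 (fun t => cos (g2 t)) (- sin (g2 t) * d2).
  by apply: (is_derive_eq (is_derive1_comp _ _)); rewrite mulrC.
have ds : is_derive t 1 (fun t => sin (g2 t)) (cos (g2 t) * d2).
  by apply: (is_derive_eq (is_derive1_comp _ _)); rewrite mulrC.
have d1' : is_derive t 1 (fun t => z0.1 + expR (g1 t) * cos (g2 t))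
    (expR (g1 t) * cos (g2 t) * d1 - expR (g1 t) * sin (g2 t) * d2).
  apply: (is_derive_eq (is_deriveD (is_derive_cst _ _ _) (is_deriveM de dc))).
  by rewrite /GRing.scale /=; ring.
have d2' : is_derive t 1 (fun t => z0.2 + expR (g1 t) * sin (g2 t))
    (expR (g1 t) * sin (g2 t) * d1 + expR (g1 t) * cos (g2 t) * d2).
  apply: (is_derive_eq (is_deriveD (is_derive_cst _ _ _) (is_deriveM de ds))).
  by rewrite /GRing.scale /=; ring.
have := has_grad_curve (g1 := fun t => z0.1 + expR (g1 t) * cos (g2 t))
  (g2 := fun t => z0.2 + expR (g1 t) * sin (g2 t)) dp d1' d2'.
by move=> H; apply: (is_derive_eq H); ring.
Qed.

Lemma continuous_polar (U : topologicalType) z0 (g1 g2 : U -> R) (x : U) :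
  {for x, continuous g1} -> {for x, continuous g2} ->
  {for x, continuous (fun x => polar z0 (g1 x) (g2 x))}.
Proof.
move=> c1 c2; apply: continuous_pair.
  apply: (@continuousD _ _ _ (cst z0.1)); first exact: cvg_cst.
  apply: (@continuousM _ _ (expR \o g1) (cos \o g2)); apply: continuous_comp => //.
    exact: continuous_expR.
  exact: continuous_cos.
apply: (@continuousD _ _ _ (cst z0.2)); first exact: cvg_cst.
apply: (@continuousM _ _ (expR \o g1) (sin \o g2)); apply: continuous_comp => //.
  exact: continuous_expR.
exact: continuous_sin.
Qed.

Definition dist2 z0 z : R := Num.sqrt ((z.1 - z0.1) ^+ 2 + (z.2 - z0.2) ^+ 2).

Definition annulus z0 (r s : R) : set (R * R) := [set z | r < dist2 z0 z < s].

Lemma dist2_polar z0 tau th : dist2 z0 (polar z0 tau th) = expR tau.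
Proof.
rewrite /dist2 /polar /= ![_ + _ - _]addrAC !subrr !add0r !exprMn -mulrDr.
by rewrite cos2Dsin2 mulr1 sqrtr_sqr ger0_norm ?expR_ge0.
Qed.

Lemma polar_exists z0 w : 0 < dist2 z0 w ->
  exists phi, 0 <= phi /\ w = polar z0 (ln (dist2 z0 w)) phi.
Proof.
set D := dist2 z0 w => D0.
pose x := (w.1 - z0.1) / D; pose y := (w.2 - z0.2) / D.
have D2 : D ^+ 2 = (w.1 - z0.1) ^+ 2 + (w.2 - z0.2) ^+ 2.
  by rewrite sqr_sqrtr// addr_ge0 ?sqr_ge0.
have xy : x ^+ 2 + y ^+ 2 = 1.
  by rewrite /x /y !expr_div_n -mulrDl -D2 divff// expf_neq0// gt_eqF.
have [phi [phi0 cp sp]] : exists phi, [/\ 0 <= phi, cos phi = x & sin phi = y].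
  have x1 : -1 <= x <= 1.
    rewrite -ler_norml -(@ler_sqr _ `|x|) ?nnegrE// real_normK ?num_real//.
    by rewrite expr1n -xy lerDl sqr_ge0.
  have cx : cos (acos x) = x by rewrite acosK// in_itv/=.
  have sx : sin (acos x) = Num.sqrt (1 - x ^+ 2) by rewrite sin_acos.
  have s2 : 1 - x ^+ 2 = y ^+ 2 by rewrite -xy; ring.
  rewrite s2 sqrtr_sqr in sx.
  have [y0|y0] := leP 0 y.
    exists (acos x); split=> //; first exact: acos_ge0.
    by rewrite sx ger0_norm.
  exists (T - acos x); split.
  - by rewrite subr_ge0 mulr2n (le_trans (acos_lepi x1))// lerDl pi_ge0.
  - by rewrite cosB cos2pi sin2pi mul1r mul0r addr0.
  - by rewrite sinB cos2pi sin2pi mul1r mul0r sub0r sx ltr0_norm// opprK.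
exists phi; split=> //; rewrite /polar cp sp lnK ?posrE// /x /y.
by rewrite [RHS]surjective_pairing [LHS]surjective_pairing /=; congr (_, _); field; rewrite gt_eqF.
Qed.

Lemma rotation_polar z0 tau phi th :
  rotation z0 (cos th) (sin th) (polar z0 tau phi) = polar z0 tau (phi + th).
Proof. by rewrite /rotation /polar /= cosD sinD; congr (_, _); ring. Qed.

Lemma dist2_rotation z0 th w :
  dist2 z0 (rotation z0 (cos th) (sin th) w) = dist2 z0 w.
Proof.
rewrite /dist2 /rotation /=; congr Num.sqrt.
transitivity ((cos th ^+ 2 + sin th ^+ 2) *
  ((w.1 - z0.1) ^+ 2 + (w.2 - z0.2) ^+ 2)); first by ring.
by rewrite cos2Dsin2 mul1r.
Qed.

Lemma continuous_rotation_angle z0 w th :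
  {for th, continuous (fun th => rotation z0 (cos th) (sin th) w)}.
Proof.
have cc : {for th, continuous (@cos R)} by exact: continuous_cos.
have cs : {for th, continuous (@sin R)} by exact: continuous_sin.
apply: continuous_pair; apply: continuous_add; try exact: cvg_cst.
  by apply: continuous_sub; apply: continuous_mul => //; exact: cvg_cst.
by apply: continuous_add; apply: continuous_mul => //; exact: cvg_cst.
Qed.

(** The integral over the circle about z0 through w, parametrized by the angle.
    Taking a point w instead of a radius makes it a function on the plane that
    can be integrated over w. *)
Definition circle_int z0 (F : R * R -> R) w : R :=
  \int[mu]_(th in `[0, T]) F (rotation z0 (cos th) (sin th) w).

(** A full turn may start anywhere: [Rintegral_period_const] applies to
    F (polar z0 tau (x + y)), whose derivatives in x and in y agree. *)
Lemma circle_int_polar z0 (F Fx Fy : R * R -> R) tau phi : 0 <= phi ->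
  (forall z, dist2 z0 z = expR tau -> has_grad F z (Fx z) (Fy z)) ->
  (forall z, dist2 z0 z = expR tau ->
     {for z, continuous Fx} /\ {for z, continuous Fy}) ->
  circle_int z0 F (polar z0 tau phi) = \int[mu]_(th in `[0, T]) F (polar z0 tau th).
Proof.
move=> phi0 dF cF; rewrite /circle_int.
under eq_Rintegral do rewrite rotation_polar.
under [in RHS]eq_Rintegral do rewrite -[X in polar _ _ X]add0r.
pose X (y : R * R) := polar z0 tau (y.1 + y.2).
have cX y : {for y, continuous X}.
  apply: continuous_polar; first exact: cvg_cst.
  by apply: continuousD; [exact: cvg_fst|exact: cvg_snd].
have dX y : dist2 z0 (X y) = expR tau by rewrite dist2_polar.
pose D (y : R * R) := Fy (X y) * (expR tau * cos (y.1 + y.2)) -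
  Fx (X y) * (expR tau * sin (y.1 + y.2)).
have cD y : {for y, continuous D}.
  have cS : {for y, continuous (fun y : R * R => y.1 + y.2)}.
    by apply: continuousD; [exact: cvg_fst|exact: cvg_snd].
  have [cx cy] := cF _ (dX y).
  apply: continuousB; apply: (@continuousM _ _ (_ \o X)).
  - exact: continuous_comp.
  - apply: continuousM; first exact: cvg_cst.
    by apply: (@continuous_comp _ _ _ _ cos) => //; exact: continuous_cos.
  - exact: continuous_comp.
  - apply: continuousM; first exact: cvg_cst.
    by apply: (@continuous_comp _ _ _ _ sin) => //; exact: continuous_sin.
have dFX1 (x y : R) : is_derive x 1 (fun x => F (X (x, y))) (D (x, y)).
  apply: (is_derive_eq (polar_derive (g1 := cst tau) (g2 := fun x => x + y)
    (dF _ (dX (x, y))) (is_derive_cst _ _ _) (is_derive_addr y x))).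
  by rewrite /D /=; ring.
have dFX2 (x y : R) : is_derive y 1 (fun y => F (X (x, y))) (D (x, y)).
  apply: (is_derive_eq (polar_derive (g1 := cst tau) (g2 := fun y => x + y)
    (dF _ (dX (x, y))) (is_derive_cst _ _ _) (is_derive_addl x y))).
  by rewrite /D /=; ring.
apply/esym.
apply: (@Rintegral_period_const _ 0 phi T (F \o X) (F \o X) D) => //.
- exact: period_ge0.
- by move=> y _; apply: continuous_comp => //; apply: has_grad_continuous (dF _ (dX y)).
- by move=> x _; rewrite /= /X /= polar_periodic addr0.
Qed.

(** In the coordinates tau and th, the Cauchy-Riemann equations are the
    hypothesis of [Rintegral_period_const]. *)
Lemma circle_int_const_le z0 (r s : R) (p q d e : R * R -> R) tau1 tau2 :
  (forall z, annulus z0 r s z -> holo p q z (d z) (e z)) ->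
  (forall z, annulus z0 r s z -> {for z, continuous d} /\ {for z, continuous e}) ->
  r < expR tau1 -> tau1 <= tau2 -> expR tau2 < s ->
  \int[mu]_(th in `[0, T]) p (polar z0 tau1 th) =
  \int[mu]_(th in `[0, T]) p (polar z0 tau2 th).
Proof.
move=> dpq cde r1 t12 s2.
pose X (y : R * R) := polar z0 y.1 y.2.
have cX y : {for y, continuous X}.
  by apply: continuous_polar; [exact: cvg_fst|exact: cvg_snd].
have AX y : closed_box tau1 tau2 0 T y -> annulus z0 r s (X y).
  move=> [/=]; rewrite in_itv/= => /andP[y1 y2] _.
  by rewrite /annulus /= dist2_polar (lt_le_trans r1) ?ler_expR//= (le_lt_trans _ s2)// ler_expR.
pose D (y : R * R) := d (X y) * (expR y.1 * cos y.2) - e (X y) * (expR y.1 * sin y.2).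
have cD y : closed_box tau1 tau2 0 T y -> {for y, continuous D}.
  move=> /AX/cde[cd ce].
  have cexp : {for y, continuous (fun y : R * R => expR y.1)}.
    apply: (@continuous_comp _ _ _ (@fst R R) expR); first exact: cvg_fst.
    exact: continuous_expR.
  apply: continuousB; apply: (@continuousM _ _ (_ \o X)).
  - exact: continuous_comp.
  - apply: continuousM; first exact: cexp.
    apply: (@continuous_comp _ _ _ (@snd R R) cos); first exact: cvg_snd.
    exact: continuous_cos.
  - exact: continuous_comp.
  - apply: continuousM; first exact: cexp.
    apply: (@continuous_comp _ _ _ (@snd R R) sin); first exact: cvg_snd.
    exact: continuous_sin.
apply: (@Rintegral_period_const _ tau1 tau2 T (p \o X) (q \o X) D) => //.
- exact: period_ge0.
- move=> x y /AX/dpq[dp _].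
  have H := polar_derive (g1 := id) (g2 := cst y) dp (is_derive_id _ _) (is_derive_cst _ _ _).
  by apply: (is_derive_eq H); rewrite /D /=; ring.
- move=> x y /AX/dpq[_ dq].
  have H := polar_derive (g1 := cst x) (g2 := id) dq (is_derive_cst _ _ _) (is_derive_id _ _).
  by apply: (is_derive_eq H); rewrite /D /=; ring.
- move=> y /AX/dpq[dp _]; apply: continuous_comp => //.
  exact: has_grad_continuous dp.
- by move=> x _; rewrite /= /X /= -[X in polar _ _ X]add0r polar_periodic.
Qed.

Lemma circle_int_const z0 (r s : R) (p q d e : R * R -> R) w w' : 0 <= r ->
  (forall z, annulus z0 r s z -> holo p q z (d z) (e z)) ->
  (forall z, annulus z0 r s z -> {for z, continuous d} /\ {for z, continuous e}) ->
  annulus z0 r s w -> annulus z0 r s w' ->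
  circle_int z0 p w = circle_int z0 p w'.
Proof.
move=> r0 dpq cde.
have H x : annulus z0 r s x -> circle_int z0 p x =
    \int[mu]_(th in `[0, T]) p (polar z0 (ln (dist2 z0 x)) th).
  move=> Ax; have /andP[rx xs] := Ax; have x0 := le_lt_trans r0 rx.
  have [phi [phi0 xE]] := polar_exists x0.
  rewrite {1}xE; apply: (@circle_int_polar _ _ d (fun z => - e z)) => // z;
      rewrite lnK ?posrE// => zx.
    by have [] : holo p q z (d z) (e z) by apply: dpq; rewrite /annulus /= zx.
  have [cd ce] : {for z, continuous d} /\ {for z, continuous e}.
    by apply: cde; rewrite /annulus /= zx.
  by split=> //; exact: continuousN.
have Hle x y : annulus z0 r s x -> annulus z0 r s y -> dist2 z0 x <= dist2 z0 y ->
    circle_int z0 p x = circle_int z0 p y.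
  move=> Ax Ay xy; rewrite (H x Ax) (H y Ay).
  have /andP[rx xs] := Ax; have x0 := le_lt_trans r0 rx.
  have /andP[ry ys] := Ay; have y0 := le_lt_trans r0 ry.
  apply: (circle_int_const_le dpq cde); rewrite ?lnK ?posrE//.
  by rewrite ler_ln ?posrE.
move=> Aw Aw'; have [ww'|/ltW ww'] := leP (dist2 z0 w) (dist2 z0 w'); first exact: Hle.
by apply/esym; exact: Hle.
Qed.

(** Integration by parts along the circle against the kernel th / T - 1, which
    jumps at w, compares the value at w with the mean over the circle. *)
Lemma circle_poincare z0 w (p px py : R * R -> R) : 0 < dist2 z0 w ->
  (forall z, dist2 z0 z = dist2 z0 w -> has_grad p z (px z) (py z)) ->
  (forall z, dist2 z0 z = dist2 z0 w ->
     {for z, continuous px} /\ {for z, continuous py}) ->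
  (p w - circle_int z0 p w / T) ^+ 2 <=
  T * (dist2 z0 w) ^+ 2 * circle_int z0 (fun z => px z ^+ 2 + py z ^+ 2) w.
Proof.
move=> w0 dp cp; have T0 := period_gt0.
have [phi [phi0 wE]] := polar_exists w0.
set D := dist2 z0 w in w0 dp cp wE *; set tau := ln D in wE.
have eD : expR tau = D by rewrite /tau lnK.
pose X th := rotation z0 (cos th) (sin th) w.
have XE th : X th = polar z0 tau (phi + th) by rewrite /X wE rotation_polar.
have dX th : dist2 z0 (X th) = D by rewrite /X dist2_rotation.
have cX th : {for th, continuous X}.
  have -> : X = fun th => polar z0 tau (phi + th) by apply/funext.
  apply: continuous_polar; first exact: cvg_cst.
  by apply: continuousD; [exact: cvg_cst|exact: cvg_id].
pose u th := py (X th) * (D * cos (phi + th)) - px (X th) * (D * sin (phi + th)).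
have du th : is_derive th 1 (fun th => p (X th)) (u th).
  have -> : (fun th => p (X th)) = fun th => p (polar z0 tau (phi + th)).
    by apply/funext => x; rewrite XE.
  have H := polar_derive (p := p) (z0 := z0) (g1 := cst tau) (g2 := fun th => phi + th) (t := th)
    (d1 := 0) (d2 := 1) (a := px (X th)) (b := py (X th)).
  have := H _ _ _; rewrite /= -XE => H'.
  apply: (is_derive_eq (H' _ _ _)).
  - exact: dp.
  - exact: is_derive_addl.
  - by rewrite /u /= eD; ring.
have ccos th : {for th, continuous (fun th => D * cos (phi + th))}.
  apply: continuousM; first exact: cvg_cst.
  apply: (@continuous_comp _ _ _ (fun th => phi + th) cos).
    by apply: continuousD; [exact: cvg_cst|exact: cvg_id].
  exact: continuous_cos.
have csin th : {for th, continuous (fun th => D * sin (phi + th))}.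
  apply: continuousM; first exact: cvg_cst.
  apply: (@continuous_comp _ _ _ (fun th => phi + th) sin).
    by apply: continuousD; [exact: cvg_cst|exact: cvg_id].
  exact: continuous_sin.
have cpx th : {for th, continuous (px \o X)}.
  by apply: continuous_comp => //; have [] := cp _ (dX th).
have cpy th : {for th, continuous (py \o X)}.
  by apply: continuous_comp => //; have [] := cp _ (dX th).
have cu th : {for th, continuous u}.
  by apply: continuousB; [apply: (@continuousM _ _ (py \o X))|apply: (@continuousM _ _ (px \o X))].
have cpX th : {for th, continuous (p \o X)}.
  by apply: continuous_comp => //; exact: has_grad_continuous (dp _ (dX th)).
pose k (th : R) := th / T - 1.
have ck th : {for th, continuous k}.
  by apply: continuousB; [apply: continuousM; [exact: cvg_id|exact: cvg_cst]|exact: cvg_cst].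
have dk th : is_derive th 1 k T^-1.
  apply: (is_derive_eq (is_deriveB (is_deriveM (is_derive_id _ _) (is_derive_cst (T^-1) _ _)) (is_derive_cst _ _ _))).
  by rewrite /GRing.scale /=; ring.
have cku th : {for th, continuous (fun th => u th * k th)} by exact: continuousM.
have cpT th : {for th, continuous (fun th => p (X th) * T^-1)}.
  by apply: (@continuousM _ _ (p \o X)) => //; exact: cvg_cst.
have XT : X T = X 0 by rewrite !XE polar_periodic addr0.
have X0 : X 0 = w by rewrite XE addr0 -wE.
have ftc : \int[mu]_(th in `[0, T]) (u th * k th + p (X th) * T^-1) = p w.
  transitivity (p (X T) * k T - p (X 0) * k 0).
    apply: (@FTC_segment _ (fun th => p (X th) * k th)
      (fun th => u th * k th + p (X th) * T^-1)); first exact: ltW.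
    - move=> x _; apply: (is_derive_eq (is_deriveM (du x) (dk x))).
      by rewrite /GRing.scale /=; ring.
    - by move=> x _; apply: (@continuousD _ _ _ (fun th => u th * k th)).
  by rewrite XT X0 /k divff ?gt_eqF// mul0r; ring.
have mT : measurable (`[0, T]%classic : set (measurableTypeR R)) by exact: measurable_itv.
have i1 : mu.-integrable `[0, T] (EFin \o (fun th => u th * k th)) by exact: integrable_segment.
have i2 : mu.-integrable `[0, T] (EFin \o (fun th => p (X th))) by apply: integrable_segment => x _; exact: cpX.
have i3 : mu.-integrable `[0, T] (EFin \o (fun th => p (X th) * T^-1)) by exact: integrable_segment.
move: ftc; rewrite RintegralD// (RintegralZr _ mT i2) => ftc.
have -> : p w - circle_int z0 p w / T = \int[mu]_(th in `[0, T]) (u th * k th).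
  by rewrite -ftc /circle_int addrK.
apply: (le_trans (Rintegral_sqr_le T0 (fun x _ => cku x))).
rewrite subr0 -mulrA; apply: ler_wpM2l; first exact: ltW.
have cg th : {for th, continuous (fun th => px (X th) ^+ 2 + py (X th) ^+ 2)}.
  by apply: continuous_add; [apply: (continuous_sqr (f := px \o X))|apply: (continuous_sqr (f := py \o X))].
have ig : mu.-integrable `[0, T] (EFin \o (fun th => px (X th) ^+ 2 + py (X th) ^+ 2)).
  exact: integrable_segment.
have iu : mu.-integrable `[0, T] (EFin \o (fun th => (u th * k th) ^+ 2)).
  by apply: integrable_segment => x _; exact: continuous_sqr.
have E : D ^+ 2 * circle_int z0 (fun z => px z ^+ 2 + py z ^+ 2) w =
    \int[mu]_(th in `[0, T]) (D ^+ 2 * (px (X th) ^+ 2 + py (X th) ^+ 2)).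
  by rewrite RintegralZl.
rewrite E.
apply: (le_Rintegral mT iu (integrableZl mT (D ^+ 2) ig)).
move=> th; rewrite /= in_itv/= => /andP[th0 thT].
rewrite exprMn; apply: (@le_trans _ _ (u th ^+ 2)).
  rewrite ler_piMr ?sqr_ge0// /k -real_normK ?num_real// expr_le1//.
  have h1 : 0 <= th / T by rewrite divr_ge0// ltW.
  have h2 : th / T <= 1 by rewrite ler_pdivrMr ?mul1r.
  rewrite ler_norml; move: (th / T) h1 h2 => y h1 h2.
  by apply/andP; split; lra.
have cs := cos2Dsin2 (phi + th).
rewrite -[leRHS]mul1r -cs -subr_ge0 /u.
set c := cos _; set ss := sin _; set a := px _; set b := py _.
rewrite (_ : _ - _ = (D * (a * c + b * ss)) ^+ 2) ?sqr_ge0//.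
by ring.
Qed.

End Polar.

(** * Monotonicity of circular square means *)

Section Subharmonic.
Context {R : realType}.
Local Notation mu := (@lebesgue_measure R).
Local Notation T := (pi *+ 2 : R).
Implicit Types (z w : R * R) (t th tau phi : R).

Lemma is_derive_affine (c k x : R) : is_derive x 1 (fun y => c + k * y) k.
Proof.
have H := is_deriveD (is_derive_cst c x 1)
  (is_deriveM (is_derive_cst k x 1) (is_derive_id x 1)).
by apply: (is_derive_eq H); rewrite /GRing.scale /=; ring.
Qed.

Lemma is_derive_mul_fun (f g : R -> R) (x df dg : R) :
  is_derive x 1 f df -> is_derive x 1 g dg ->
  is_derive x 1 (fun y => f y * g y) (f x * dg + df * g x).
Proof.
move=> hf hg; apply: (is_derive_eq (is_deriveM hf hg)).
by rewrite /GRing.scale /= [g x * df]mulrC.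
Qed.

Lemma is_derive_add_fun (f g : R -> R) (x df dg : R) :
  is_derive x 1 f df -> is_derive x 1 g dg ->
  is_derive x 1 (fun y => f y + g y) (df + dg).
Proof. by move=> hf hg; exact: (is_deriveD hf hg). Qed.

Lemma is_derive_sub_fun (f g : R -> R) (x df dg : R) :
  is_derive x 1 f df -> is_derive x 1 g dg ->
  is_derive x 1 (fun y => f y - g y) (df - dg).
Proof. by move=> hf hg; exact: (is_deriveB hf hg). Qed.

(** If m decreased somewhere, midpoint convexity would make it grow at least
    linearly towards - oo. *)
Lemma midpoint_convex_nondecreasing (m : R -> R) :
  (forall tau sg, 0 <= sg -> m tau <= (m (tau + sg) + m (tau - sg)) / 2) ->
  (forall tau, 0 <= m tau) ->
  (forall tau0, exists M, forall tau, tau <= tau0 -> m tau <= M) ->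
  forall tau1 tau2, tau1 <= tau2 -> m tau1 <= m tau2.
Proof.
move=> midpoint m_ge0 bounded tau1 tau2 t12; pose sg := tau2 - tau1; have sg0 : 0 <= sg by rewrite subr_ge0.
rewrite leNgt; apply/negP => lt21.
pose ep := m tau1 - m tau2; have ep0 : 0 < ep by rewrite subr_gt0.
have step n : ep <= m (tau1 - n.+1%:R * sg) - m (tau1 - n%:R * sg).
  elim: n => [|n IH].
    have := midpoint tau1 _ sg0; rewrite mul0r subr0 mul1r.
    have -> : tau1 + sg = tau2 by rewrite /sg; ring.
    by rewrite /ep; lra.
  have := midpoint (tau1 - n.+1%:R * sg) _ sg0.
  have -> : tau1 - n.+1%:R * sg + sg = tau1 - n%:R * sg by rewrite -natr1; ring.
  have -> : tau1 - n.+1%:R * sg - sg = tau1 - n.+2%:R * sg by rewrite -[in RHS]natr1; ring.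
  by move: IH; lra.
have grow n : n%:R * ep <= m (tau1 - n%:R * sg).
  elim: n => [|n IH]; first by rewrite mul0r; exact: m_ge0.
  by have := step n; rewrite -natr1 mulrDl mul1r natr1; move: IH; lra.
have [M HM] := bounded tau1.
have [n Hn] : exists n : nat, M / ep < n%:R.
  by exists (Num.truncn (M / ep)).+1; exact: Num.Theory.truncnS_gt.
have : n%:R * ep <= M.
  by apply: (le_trans (grow n)); apply: HM; rewrite gerBl mulr_ge0.
by rewrite -ler_pdivlMr// leNgt Hn.
Qed.

Lemma inner_le_half_sqr (a a' b b' : R) :
  a * a' + b * b' <= (a ^+ 2 + b ^+ 2 + (a' ^+ 2 + b' ^+ 2)) * 2^-1.
Proof. by have := sqr_ge0 (a - a'); have := sqr_ge0 (b - b'); rewrite !sqrrB; lra. Qed.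

Variables (z0 : R * R) (A B d e : R * R -> R).
Hypothesis dH : forall z, holo A B z (d z) (e z).
Hypothesis cd : continuous d.
Hypothesis ce : continuous e.

Let F z := A z ^+ 2 + B z ^+ 2.
Let m tau := \int[mu]_(th in `[0, T]) F (polar z0 tau th).

Let cA : continuous A. Proof. by move=> z; have [/has_grad_continuous] := dH z. Qed.
Let cB : continuous B. Proof. by move=> z; have [_ /has_grad_continuous] := dH z. Qed.
Let cF : continuous F.
Proof.
move=> z; apply: (@continuousD _ _ _ (fun z => A z ^+ 2) (fun z => B z ^+ 2)).
  by apply: continuous_sqr; exact: cA.
by apply: continuous_sqr; exact: cB.
Qed.

Let cFpolar tau th : {for th, continuous (fun th => F (polar z0 tau th))}.
Proof.
apply: continuous_comp; last exact: cF.
by apply: continuous_polar; [exact: cvg_cst|exact: cvg_id].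
Qed.

(** Let H = A + i B in the coordinate tau + i th. The product
    H (tau + zeta) conj (H (tau - conj zeta)) is holomorphic in
    zeta = sigma + i th, so its mean over a period of th does not depend on
    sigma. At sigma = 0 the mean is m tau, and in general its real part is
    estimated by 2 Re (x conj y) <= |x|^2 + |y|^2. *)
Lemma circle_sqr_midpoint tau sg : 0 <= sg ->
  m tau <= (m (tau + sg) + m (tau - sg)) / 2.
Proof.
move=> sg0.
pose X k (y : R * R) := polar z0 (tau + k * y.1) y.2.
have cX k y : {for y, continuous (X k)}.
  apply: continuous_polar; last exact: cvg_snd.
  apply: continuousD; first exact: cvg_cst.
  by apply: continuousM; [exact: cvg_cst|exact: cvg_fst].
pose C k (y : R * R) := expR (tau + k * y.1) * cos y.2.
pose S k (y : R * R) := expR (tau + k * y.1) * sin y.2.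
have cE k y : {for y, continuous (fun y : R * R => expR (tau + k * y.1))}.
  apply: (@continuous_comp _ _ _ (fun y : R * R => tau + k * y.1) expR); last exact: continuous_expR.
  apply: continuousD; first exact: cvg_cst.
  by apply: continuousM; [exact: cvg_cst|exact: cvg_fst].
have cC k y : {for y, continuous (C k)}.
  apply: continuousM; first exact: cE.
  by apply: (@continuous_comp _ _ _ (@snd R R) cos); [exact: cvg_snd|exact: continuous_cos].
have cS k y : {for y, continuous (S k)}.
  apply: continuousM; first exact: cE.
  by apply: (@continuous_comp _ _ _ (@snd R R) sin); [exact: cvg_snd|exact: continuous_sin].
pose u k y := d (X k y) * C k y - e (X k y) * S k y.
pose v k y := e (X k y) * C k y + d (X k y) * S k y.
have cdX k y : {for y, continuous (d \o X k)} by apply: continuous_comp; [exact: cX|exact: cd].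
have ceX k y : {for y, continuous (e \o X k)} by apply: continuous_comp; [exact: cX|exact: ce].
have cAX k y : {for y, continuous (A \o X k)} by apply: continuous_comp; [exact: cX|exact: cA].
have cBX k y : {for y, continuous (B \o X k)} by apply: continuous_comp; [exact: cX|exact: cB].
have cu k y : {for y, continuous (u k)}.
  by apply: continuousB; [apply: (@continuousM _ _ (d \o X k))|apply: (@continuousM _ _ (e \o X k))].
have cv k y : {for y, continuous (v k)}.
  by apply: continuousD; [apply: (@continuousM _ _ (e \o X k))|apply: (@continuousM _ _ (d \o X k))].
have A1 k (x y : R) : is_derive x 1 (fun x => A (X k (x, y))) (k * u k (x, y)).
  have [dA _] := dH (X k (x, y)).
  have H := polar_derive (g1 := fun x => tau + k * x) (g2 := cst y) (t := x) dA (is_derive_affine tau k x) (is_derive_cst _ _ _).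
  by apply: (is_derive_eq H); rewrite /u /C /S /=; ring.
have B1 k (x y : R) : is_derive x 1 (fun x => B (X k (x, y))) (k * v k (x, y)).
  have [_ dB] := dH (X k (x, y)).
  have H := polar_derive (g1 := fun x => tau + k * x) (g2 := cst y) (t := x) dB (is_derive_affine tau k x) (is_derive_cst _ _ _).
  by apply: (is_derive_eq H); rewrite /v /C /S /=; ring.
have A2 k (x y : R) : is_derive y 1 (fun y => A (X k (x, y))) (- v k (x, y)).
  have [dA _] := dH (X k (x, y)).
  have H := polar_derive (g1 := cst (tau + k * x)) (g2 := id) (t := y) dA (is_derive_cst _ _ _) (is_derive_id _ _).
  by apply: (is_derive_eq H); rewrite /v /C /S /=; ring.
have B2 k (x y : R) : is_derive y 1 (fun y => B (X k (x, y))) (u k (x, y)).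
  have [_ dB] := dH (X k (x, y)).
  have H := polar_derive (g1 := cst (tau + k * x)) (g2 := id) (t := y) dB (is_derive_cst _ _ _) (is_derive_id _ _).
  by apply: (is_derive_eq H); rewrite /u /C /S /=; ring.
pose P (y : R * R) := A (X 1 y) * A (X (-1) y) + B (X 1 y) * B (X (-1) y).
pose Q (y : R * R) := B (X 1 y) * A (X (-1) y) - A (X 1 y) * B (X (-1) y).
pose D (y : R * R) := u 1 y * A (X (-1) y) + v 1 y * B (X (-1) y)
  - (A (X 1 y) * u (-1) y + B (X 1 y) * v (-1) y).
have cP y : {for y, continuous P}.
  by apply: continuousD; [apply: (@continuousM _ _ (A \o X 1) (A \o X (-1)))|apply: (@continuousM _ _ (B \o X 1) (B \o X (-1)))].
have cD y : {for y, continuous D}.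
  apply: continuousB; apply: continuousD.
  - by apply: (@continuousM _ _ _ (A \o X (-1))).
  - by apply: (@continuousM _ _ _ (B \o X (-1))).
  - by apply: (@continuousM _ _ (A \o X 1)).
  - by apply: (@continuousM _ _ (B \o X 1)).
have mE : m tau = \int[mu]_(th in `[0, T]) P (0, th).
  apply: eq_Rintegral => th _; rewrite /P /F /X /= !mulr0 !addr0; ring.
have mid : m tau = \int[mu]_(th in `[0, T]) P (sg, th).
  rewrite mE; apply: (@Rintegral_period_const _ 0 sg T P Q D).
  - exact: sg0.
  - exact: period_ge0.
  - move=> x y _.
    have H := is_derive_add_fun (is_derive_mul_fun (A1 1 x y) (A1 (-1) x y))
      (is_derive_mul_fun (B1 1 x y) (B1 (-1) x y)).
    by apply: (is_derive_eq H); rewrite /D; ring.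
  - move=> x y _.
    have H := is_derive_sub_fun (is_derive_mul_fun (B2 1 x y) (A2 (-1) x y))
      (is_derive_mul_fun (A2 1 x y) (B2 (-1) x y)).
    by apply: (is_derive_eq H); rewrite /D; ring.
  - by move=> y _; exact: cP.
  - by move=> y _; exact: cD.
  - have XT k x : X k (x, T) = X k (x, 0).
      by rewrite /X /= -[T in LHS]add0r polar_periodic.
    by move=> x _; rewrite /Q !XT.
have mT : measurable (`[0, T]%classic : set (measurableTypeR R)) by exact: measurable_itv.
have iF ta : mu.-integrable `[0, T] (EFin \o (fun th => F (polar z0 ta th))).
  by apply: integrable_segment => x _; exact: cFpolar.
have iP : mu.-integrable `[0, T] (EFin \o (fun th => P (sg, th))).
  by apply: integrable_segment => x _; exact: continuous_slice2.
have iS := integrableD mT (iF (tau + sg)) (iF (tau - sg)).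
have iS2 := integrableZr mT 2^-1 iS.
have -> : (m (tau + sg) + m (tau - sg)) / 2 = \int[mu]_(th in `[0, T])
    ((F (polar z0 (tau + sg) th) + F (polar z0 (tau - sg) th)) * 2^-1).
  by rewrite (RintegralZr 2^-1 mT iS) (RintegralD mT (iF _) (iF _)).
rewrite mid; apply: (le_Rintegral mT iP iS2) => th _.
rewrite /P /F /X /= mul1r mulN1r.
exact: inner_le_half_sqr.
Qed.

Lemma circle_sqr_ge0 tau : 0 <= m tau.
Proof. by apply: Rintegral_ge0 => th _; rewrite addr_ge0 ?sqr_ge0. Qed.

Lemma circle_sqr_bounded tau0 : exists M, forall tau, tau <= tau0 -> m tau <= M.
Proof.
pose r := expR tau0.
have cK := @compact_closed_box R (z0.1 - r) (z0.1 + r) (z0.2 - r) (z0.2 + r).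
have [M [_ HM]] : bounded_set (F @` closed_box (z0.1 - r) (z0.1 + r) (z0.2 - r) (z0.2 + r)).
  apply: compact_bounded; apply: continuous_compact cK.
  by apply: continuous_subspaceT => z; exact: cF.
exists (T * (`|M| + 1)) => tau tau0r.
have mT : measurable (`[0, T]%classic : set (measurableTypeR R)) by exact: measurable_itv.
have iF : mu.-integrable `[0, T] (EFin \o (fun th => F (polar z0 tau th))).
  by apply: integrable_segment => x _; exact: cFpolar.
have ic : mu.-integrable `[0, T] (EFin \o cst (`|M| + 1)).
  by apply: integrable_segment => x _; exact: cvg_cst.
have -> : T * (`|M| + 1) = \int[mu]_(th in `[0, T]) (cst (`|M| + 1) th).
  rewrite (Rintegral_cst _ mT) mulrC; congr (_ * _).
  by rewrite /= lebesgue_measure_itv/= lte_fin period_gt0 -EFinB subr0.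
apply: (le_Rintegral mT iF ic) => th _ /=.
apply: (le_trans (ler_norm _)); apply: (HM (`|M| + 1)).
  by rewrite (le_lt_trans (ler_norm M))// ltrDl.
exists (polar z0 tau th) => //.
have er : expR tau <= r by rewrite /r ler_expR.
have b x : `|x| <= 1 -> - r <= expR tau * x <= r.
  move=> x1; rewrite -ler_norml normrM ger0_norm ?expR_ge0//.
  by rewrite (le_trans _ er)// ler_piMr// expR_ge0.
split; rewrite /polar /= in_itv/=.
  by have /andP[h1 h2] := b _ (cos_max th); apply/andP; split; lra.
by have /andP[h1 h2] := b _ (sin_max th); apply/andP; split; lra.
Qed.

Lemma circle_sqr_nondecreasing tau1 tau2 : tau1 <= tau2 -> m tau1 <= m tau2.
Proof.
apply: midpoint_convex_nondecreasing.
- exact: circle_sqr_midpoint.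
- exact: circle_sqr_ge0.
- exact: circle_sqr_bounded.
Qed.

Lemma circle_int_sqr_polar w : 0 < dist2 z0 w ->
  circle_int z0 F w = m (ln (dist2 z0 w)).
Proof.
move=> w0; have [phi [phi0 wE]] := polar_exists w0.
rewrite {1}wE; apply: (@circle_int_polar _ _ _
  (fun z => 2 * (A z * d z + B z * e z)) (fun z => 2 * (B z * d z - A z * e z))) => // z _.
  have [dA dB] := dH z; rewrite /F.
  rewrite (_ : (fun z => _) = fun z => A z * A z + B z * B z); last first.
    by apply/funext => y; rewrite !expr2.
  by apply: (has_grad_eq (has_gradD (has_gradM dA dA) (has_gradM dB dB))); ring.
split; (apply: continuousM; first exact: cvg_cst).
  apply: (@continuousD _ _ _ (fun z => A z * d z) (fun z => B z * e z)); apply: continuousM;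
    solve [exact: cA|exact: cB|exact: cd|exact: ce].
apply: (@continuousB _ _ _ (fun z => B z * d z) (fun z => A z * e z)); apply: continuousM;
  solve [exact: cA|exact: cB|exact: cd|exact: ce].
Qed.

(** The square mean is midpoint convex in the logarithm of the radius, and
    bounded near the centre. *)
Lemma circle_int_sqr_le w w' : 0 < dist2 z0 w -> dist2 z0 w <= dist2 z0 w' ->
  circle_int z0 F w <= circle_int z0 F w'.
Proof.
move=> w0 ww'; have w'0 := lt_le_trans w0 ww'.
rewrite (circle_int_sqr_polar w0) (circle_int_sqr_polar w'0).
apply: circle_sqr_nondecreasing.
by rewrite ler_ln ?posrE.
Qed.

End Subharmonic.

(** * The Poincare inequality on an annulus *)

Section RotationAverage.
Context {R : realType}.
Local Notation mu := (@lebesgue_measure R).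
Local Notation T := (pi *+ 2 : R).
Implicit Types (z w : R * R) (th : R).

Lemma sigma_finite_lebesgue2 : sigma_finite setT (@lebesgue2 R).
Proof.
exists (fun n => closed_box (- n%:R) n%:R (- n%:R) n%:R).
  apply/esym; rewrite -subTset => -[x y] _.
  pose n := (Num.truncn (`|x| + `|y|)).+1.
  have xyn : `|x| + `|y| < n%:R by exact: truncnS_gt.
  have nx : `|x| <= n%:R by rewrite (le_trans _ (ltW xyn))// lerDl.
  have ny : `|y| <= n%:R by rewrite (le_trans _ (ltW xyn))// lerDr.
  by exists n => //; split; rewrite /= in_itv/= -ler_norml.
move=> n; split; first exact: measurable_closed_box.
have n0 : - n%:R <= n%:R :> R by rewrite ge0_cp.
by rewrite lebesgue2_closed_box// ltry.
Qed.

(** Lets Tonelli exchange the integrals over the plane and over the angle. *)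
Definition lebesgue2_sigma_finite :
    {sigma_finite_measure set (measurableTypeR R * measurableTypeR R)%type -> \bar R} :=
  HB.pack (Measure.sort (@lebesgue2 R))
    (Measure_isSigmaFinite.Build _ _ _ (@lebesgue2 R) sigma_finite_lebesgue2).

Lemma measurable_rotation z0 : measurable_fun setT
  (fun x : (R * R) * R => rotation z0 (cos x.2) (sin x.2) x.1).
Proof.
have m1 : measurable_fun setT (fun x : (R * R) * R => x.1.1).
  by apply: measurableT_comp.
have m2 : measurable_fun setT (fun x : (R * R) * R => x.1.2).
  by apply: measurableT_comp.
have mc : measurable_fun setT (fun x : (R * R) * R => cos x.2).
  by apply: measurableT_comp => //; apply: continuous_measurable_fun; exact: continuous_cos.
have ms : measurable_fun setT (fun x : (R * R) * R => sin x.2).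
  by apply: measurableT_comp => //; apply: continuous_measurable_fun; exact: continuous_sin.
apply: measurable_fun_pair; apply: measurable_funD => //.
  by apply: measurable_funB; apply: measurable_funM => //; exact: measurable_funB.
by apply: measurable_funD; apply: measurable_funM => //; exact: measurable_funB.
Qed.

(** By Tonelli and the invariance of the measure under each rotation. *)
Lemma integral_rotation_average z0 (G : R * R -> \bar R) :
  measurable_fun setT G -> (forall z, 0 <= G z)%E ->
  measurable_fun setT
    (fun w => \int[mu]_(th in `[0%R, T]) G (rotation z0 (cos th) (sin th) w))%E /\
  (\int[lebesgue2]_w \int[mu]_(th in `[0%R, T]) G (rotation z0 (cos th) (sin th) w)
   = T%:E * \int[lebesgue2]_w G w)%E.
Proof.
move=> mG G0.
pose Phi (x : (R * R) * R) : \bar R :=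
  (G (rotation z0 (cos x.2) (sin x.2) x.1) * (\1_(`[0%R, T]%classic) x.2)%:E)%E.
have mI : measurable_fun setT (\1_(`[0%R, T]%classic : set (measurableTypeR R)) : _ -> R).
  by apply: measurable_indic; exact: measurable_itv.
have mPhi : measurable_fun setT Phi.
  apply: emeasurable_funM; first exact: (measurableT_comp mG (measurable_rotation z0)).
  by apply/measurable_EFinP; exact: (measurableT_comp mI measurable_snd).
have Phi0 x : (0 <= Phi x)%E by rewrite mule_ge0// lee_fin.
have E w : (\int[mu]_(th in `[0%R, T]) G (rotation z0 (cos th) (sin th) w) =
    \int[mu]_th Phi (w, th))%E.
  rewrite integral_mkcond; apply: eq_integral => th _.
  by rewrite patchE /Phi /= indicE; case: ifP => _; rewrite ?mule1 ?mule0.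
under eq_fun do rewrite E.
split; first exact: (@measurable_fun_fubini_tonelli_F _ _ _ _ _ mu Phi mPhi Phi0).
have H := @fubini_tonelli _ _ _ _ _ lebesgue2_sigma_finite mu Phi mPhi Phi0.
transitivity (\int[mu]_th \int[lebesgue2]_w Phi (w, th))%E; first exact: H.
have -> : (fun th => \int[lebesgue2]_w Phi (w, th))%E =
   (fun th => (\int[lebesgue2]_w G w) * (\1_(`[0%R, T]%classic) th)%:E)%E.
  apply/funext => th; rewrite /Phi /=.
  have [mrot prot] := @preserves_lebesgue2_rotation R z0 (cos th) (sin th) (cos2Dsin2 th).
  rewrite ge0_integralZr//; last exact: (measurableT_comp mG mrot).
  by rewrite prot.
rewrite ge0_integralZl//=; last 2 first.
- exact/measurable_EFinP.
- exact: integral_ge0.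
rewrite muleC; congr (_ * _)%E.
rewrite integral_indic//= setIT lebesgue_measure_itv/= lte_fin period_gt0.
by rewrite -EFinB subr0.
Qed.

Definition rotation_invariant z0 (A : set (R * R)) :=
  forall th w, A (rotation z0 (cos th) (sin th) w) <-> A w.

(** This replaces integration in polar coordinates. *)
Lemma integral_circle_int z0 (A : set (R * R)) (N : R * R -> R) :
  measurable A -> rotation_invariant z0 A ->
  (forall z, A z -> {for z, continuous N}) -> (forall z, 0 <= N z) ->
  measurable_fun A (fun w => (circle_int z0 N w)%:E) /\
  (\int[lebesgue2]_(w in A) (circle_int z0 N w)%:E =
   T%:E * \int[lebesgue2]_(w in A) (N w)%:E)%E.
Proof.
move=> mA rA cN N0; pose G := ((EFin \o N) \_ A)%E.
have mG : measurable_fun setT G.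
  apply/(measurable_restrictT _ mA)/measurable_EFinP.
  exact: continuous_at_measurable2.
have G0 z : (0 <= G z)%E by rewrite /G patchE; case: ifP => // _; rewrite lee_fin.
have [mavg avg] := integral_rotation_average z0 mG G0.
have E w : A w -> (circle_int z0 N w)%:E =
    (\int[mu]_(th in `[0%R, T]) G (rotation z0 (cos th) (sin th) w))%E.
  move=> Aw; rewrite /circle_int -EFin_Rintegral_segment.
    apply: eq_integral => th _; rewrite /G patchE ifT// inE; exact/rA.
  move=> th _; apply: (@continuous_comp _ _ _ (fun th => rotation z0 (cos th) (sin th) w) N).
    exact: continuous_rotation_angle.
  by apply: cN; exact/rA.
split.
  apply: (@eq_measurable_fun _ _ _ _ _
    (fun w => \int[mu]_(th in `[0%R, T]) G (rotation z0 (cos th) (sin th) w))%E).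
    by move=> w; rewrite inE => /E ->.
  exact: measurable_funTS.
rewrite [in RHS]integral_mkcond -avg integral_mkcond.
apply: eq_integral => w _; rewrite patchE.
case: ifPn => [|]; rewrite ?inE ?notin_setE => Aw; first exact: E.
rewrite integral0_eq// => th _; rewrite /G patchE ifF//.
by apply/negbTE; rewrite notin_setE => /rA.
Qed.

Lemma continuous_dist2 z0 : continuous (dist2 z0).
Proof.
move=> z; apply: (@continuous_comp _ _ _
  (fun z : R * R => (z.1 - z0.1) ^+ 2 + (z.2 - z0.2) ^+ 2) Num.sqrt); last exact: sqrt_continuous.
apply: (@continuousD _ _ _ (fun z : R * R => (z.1 - z0.1) ^+ 2)); apply: continuous_sqr;
  apply: continuousB; solve [exact: cvg_cst|exact: cvg_fst|exact: cvg_snd].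
Qed.

Lemma open_annulus z0 (r s : R) : open (annulus z0 r s).
Proof.
have -> : annulus z0 r s = dist2 z0 @^-1` `]r, s[%classic.
  by apply/seteqP; split => z; rewrite /annulus /= in_itv.
apply: open_comp; last exact: interval_open.
by move=> z _; exact: (@continuous_dist2 z0 z).
Qed.

Lemma measurable_annulus z0 (r s : R) : measurable (annulus z0 r s).
Proof. by apply: open2_measurable; exact: open_annulus. Qed.

Lemma measurable_dist2_itv z0 (i : interval R) : measurable [set z | dist2 z0 z \in i].
Proof.
have mf : measurable_fun setT (dist2 z0).
  by apply: continuous_at_measurable2 => // z _; exact: continuous_dist2.
by have := mf measurableT _ (measurable_itv i); rewrite setTI.
Qed.

Lemma rotation_invariant_dist2 z0 (P : R -> Prop) :
  rotation_invariant z0 [set z | P (dist2 z0 z)].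
Proof. by move=> th w /=; rewrite dist2_rotation. Qed.

(** The mean is the same on all circles of the annulus, so the same constant is
    subtracted in [circle_poincare] on all of them; this is why the factor
    depends on the outer radius only. *)
Lemma annulus_poincare z0 (r s : R) (p q d e : R * R -> R) : 0 <= r -> r < s ->
  (forall z, annulus z0 r s z -> holo p q z (d z) (e z)) ->
  (forall z, annulus z0 r s z -> {for z, continuous d} /\ {for z, continuous e}) ->
  exists c1 c2 : R,
  (\int[lebesgue2]_(w in annulus z0 r s) ((p w - c1) ^+ 2 + (q w - c2) ^+ 2)%:E
   <= (2 * (T * s) ^+ 2)%:E *
      \int[lebesgue2]_(w in annulus z0 r s) (d w ^+ 2 + e w ^+ 2)%:E)%E.
Proof.
move=> r0 rs dpq cde; set A := annulus z0 r s.
have T0 := @period_gt0 R.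
pose w0 := polar z0 (ln ((r + s) / 2)) 0.
have Aw0 : A w0.
  by rewrite /A /annulus /= dist2_polar lnK ?posrE; [apply/andP; split|]; lra.
exists (circle_int z0 p w0 / T), (circle_int z0 q w0 / T).
have dqp z : A z -> holo q (fun z => - p z) z (e z) (- d z).
  by move=> /dpq[dp dq]; split; [rewrite opprK|exact: (has_grad_eq (has_gradN dp) erefl (opprK _))].
have cde' z : A z -> {for z, continuous e} /\ {for z, continuous (fun z => - d z)}.
  by move=> /cde[cd ce]; split=> //; exact: continuousN.
pose N w := d w ^+ 2 + e w ^+ 2.
have pt w : A w -> (p w - circle_int z0 p w0 / T) ^+ 2 +
    (q w - circle_int z0 q w0 / T) ^+ 2 <= 2 * (T * s ^+ 2) * circle_int z0 N w.
  move=> Aw; have /andP[rw ws] := Aw; have w_gt0 := le_lt_trans r0 rw.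
  rewrite (circle_int_const r0 dpq cde Aw0 Aw) (circle_int_const r0 dqp cde' Aw0 Aw).
  have An z : dist2 z0 z = dist2 z0 w -> A z by rewrite /A /annulus /= => ->.
  have Hp := @circle_poincare R z0 w p d (fun z => - e z) w_gt0
    (fun z zw => (dpq z (An z zw)).1)
    (fun z zw => conj (cde z (An z zw)).1 (continuousN (cde z (An z zw)).2)).
  have Hq := @circle_poincare R z0 w q e d w_gt0
    (fun z zw => (dpq z (An z zw)).2)
    (fun z zw => conj (cde z (An z zw)).2 (cde z (An z zw)).1).
  have Np : (fun z => d z ^+ 2 + (- e z) ^+ 2) = N by apply/funext => z; rewrite sqrrN.
  have Nq : (fun z => e z ^+ 2 + d z ^+ 2) = N by apply/funext => z; rewrite addrC.
  rewrite Np in Hp; rewrite Nq in Hq.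
  apply: (le_trans (lerD Hp Hq)).
  have N0 : 0 <= circle_int z0 N w.
    by apply: Rintegral_ge0 => th _; rewrite addr_ge0 ?sqr_ge0.
  have sD : dist2 z0 w ^+ 2 <= s ^+ 2.
    by rewrite ler_sqr ?nnegrE ?ltW// (lt_trans _ ws).
  have h : T * dist2 z0 w ^+ 2 * circle_int z0 N w <= T * s ^+ 2 * circle_int z0 N w.
    by apply: ler_wpM2r => //; apply: ler_wpM2l => //; exact: ltW.
  by rewrite -[2 * _ * _]mulrA mulr_natl mulr2n lerD.
have mA := measurable_annulus z0 r s.
have cN z : A z -> {for z, continuous N}.
  by move=> /cde[cd ce]; apply: (@continuousD _ _ _ (fun w => d w ^+ 2)); exact: continuous_sqr.
have N0 z : 0 <= N z by rewrite addr_ge0 ?sqr_ge0.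
have [mC cI] : measurable_fun A (fun w => (circle_int z0 N w)%:E) /\
  (\int[lebesgue2]_(w in A) (circle_int z0 N w)%:E =
   T%:E * \int[lebesgue2]_(w in A) (N w)%:E)%E.
  by apply: integral_circle_int => //; exact: (@rotation_invariant_dist2 z0 (fun x => r < x < s)).
have cp z : A z -> {for z, continuous p} by move=> /dpq[dp _]; exact: has_grad_continuous dp.
have cq z : A z -> {for z, continuous q} by move=> /dpq[_ dq]; exact: has_grad_continuous dq.
have k0 : 0 <= 2 * (T * s ^+ 2).
  by rewrite mulr_ge0// mulr_ge0 ?sqr_ge0// ltW.
apply: (@le_trans _ _ (\int[lebesgue2]_(w in A) ((2 * (T * s ^+ 2))%:E * (circle_int z0 N w)%:E))%E).
  have mL : measurable_fun A (fun w => ((p w - circle_int z0 p w0 / T) ^+ 2 +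
      (q w - circle_int z0 q w0 / T) ^+ 2)%:E).
    apply/measurable_EFinP; apply: measurable_funD; apply: measurable_funX;
      apply: measurable_funB => //; exact: continuous_at_measurable2.
  have mR : measurable_fun A (fun w => ((2 * (T * s ^+ 2))%:E * (circle_int z0 N w)%:E)%E).
    exact: emeasurable_funM.
  apply: (ge0_le_integral lebesgue2 mA _ mL mR).
    by move=> w _; rewrite lee_fin addr_ge0 ?sqr_ge0.
  by move=> w Aw; rewrite -EFinM lee_fin; exact: pt.
rewrite ge0_integralZl// ?cI; last first.
  by move=> w _; rewrite lee_fin; apply: Rintegral_ge0 => th _; exact: N0.
rewrite muleA -EFinM le_eqVlt; apply/orP; left; apply/eqP; congr (_%:E * _)%E.
by ring.
Qed.

End RotationAverage.

(** * Filling the hole of an annulus *)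

Section Hole.
Context {R : realType}.
Local Notation mu := (@lebesgue_measure R).
Local Notation T := (pi *+ 2 : R).
Implicit Types (z w : R * R) (r s : R).

Definition closed_disc z0 r : set (R * R) := [set z | dist2 z0 z <= r].

Lemma dist2_ge0 z0 z : 0 <= dist2 z0 z. Proof. exact: sqrtr_ge0. Qed.

Lemma measurable_closed_disc z0 r : measurable (closed_disc z0 r).
Proof.
exact: (measurable_dist2_itv z0 `]-oo, r]).
Qed.

(** Only ratios of areas of discs matter below, so the area of the unit disc is
    never evaluated. *)
Lemma closed_disc_area z0 r : 0 < r ->
  lebesgue2 (closed_disc z0 r) = ((r ^+ 2)%:E * lebesgue2 (closed_disc z0 1))%E.
Proof.
move=> r0; have mD := measurable_closed_disc z0 r; have mD1 := measurable_closed_disc z0 1.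
have indE (D : set (R * R)) : measurable D -> lebesgue2 D = (\int[lebesgue2]_z (\1_D z)%:E)%E.
  by move=> mDD; rewrite integral_indic// setIT.
rewrite (indE _ mD) (indE _ mD1).
rewrite (@ge0_integral2_scale R r ((1 - r) * z0.1, (1 - r) * z0.2) _ r0).
- congr (_ * _)%E; apply: eq_integral => z _; congr EFin; rewrite !indicE.
  have e : dist2 z0 (r * z.1 + (1 - r) * z0.1, r * z.2 + (1 - r) * z0.2) = r * dist2 z0 z.
    rewrite /dist2 /= -[in RHS](ger0_norm (ltW r0)) -sqrtr_sqr -sqrtrM ?sqr_ge0//.
    by congr Num.sqrt; ring.
  suff -> : ((r * z.1 + (1 - r) * z0.1, r * z.2 + (1 - r) * z0.2) \in closed_disc z0 r) =
      (z \in closed_disc z0 1) by [].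
  have r1 : (r * dist2 z0 z <= r) = (dist2 z0 z <= 1) by rewrite ger_pMr.
  by apply/idP/idP; rewrite !inE /closed_disc /= e r1.
- by apply/measurable_EFinP; exact: measurable_indic.
- by move=> z; rewrite lee_fin.
Qed.

Lemma unit_disc_area_fin z0 : (lebesgue2 (closed_disc z0 1) < +oo)%E.
Proof.
apply: (@le_lt_trans _ _ (lebesgue2 (closed_box (z0.1 - 1) (z0.1 + 1) (z0.2 - 1) (z0.2 + 1)))).
  apply: le_measure; rewrite ?inE; [exact: measurable_closed_disc|exact: measurable_closed_box|].
  move=> z; rewrite /closed_disc /= => z1.
  have : dist2 z0 z ^+ 2 <= 1 by rewrite -(expr1n _ 2) ler_sqr ?nnegrE ?dist2_ge0.
  rewrite /dist2 sqr_sqrtr ?addr_ge0 ?sqr_ge0// => h.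
  have n1 (x y : R) : x ^+ 2 + y ^+ 2 <= 1 -> `|x| <= 1.
    move=> xy; rewrite -(@ler_sqr _ `|x|) ?nnegrE// real_normK ?num_real// expr1n.
    by have := sqr_ge0 y; lra.
  have := n1 _ _ h; have := n1 _ _ (_ : (z.2 - z0.2) ^+ 2 + (z.1 - z0.1) ^+ 2 <= 1).
  rewrite addrC => /(_ h); rewrite !ler_norml => /andP[h1 h2] /andP[h3 h4].
  by split; rewrite /= in_itv/=; apply/andP; split; lra.
rewrite lebesgue2_closed_box ?ltry//; lra.
Qed.

Definition half_open_annulus z0 r s : set (R * R) := [set z | r < dist2 z0 z <= s].

Lemma measurable_half_open_annulus z0 r s : measurable (half_open_annulus z0 r s).
Proof.
exact: (measurable_dist2_itv z0 `]r, s]).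
Qed.

Lemma half_open_annulus_area z0 r s : 0 < r -> r < s ->
  lebesgue2 (half_open_annulus z0 r s) =
  ((s ^+ 2 - r ^+ 2)%:E * lebesgue2 (closed_disc z0 1))%E.
Proof.
move=> r0 rs; have s0 := lt_trans r0 rs.
have -> : half_open_annulus z0 r s = closed_disc z0 s `\` closed_disc z0 r.
  apply/seteqP; split => z; rewrite /half_open_annulus /closed_disc /=.
    by move=> /andP[rz zs]; split=> //; apply/negP; rewrite -ltNge.
  by move=> [zs /negP]; rewrite -ltNge => ->.
have fin1 := unit_disc_area_fin z0.
have f1 : lebesgue2 (closed_disc z0 1) \is a fin_num by rewrite ge0_fin_numE.
have fins : (lebesgue2 (closed_disc z0 s) < +oo)%E.
  by rewrite closed_disc_area// lte_mul_pinfty ?lee_fin ?sqr_ge0.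
have sub : closed_disc z0 s `&` closed_disc z0 r = closed_disc z0 r.
  apply/seteqP; split=> [z []//|z zr]; split=> //.
  by move: zr; rewrite /closed_disc /= => /le_trans; apply; exact: ltW.
have mD : (lebesgue2 (closed_disc z0 s `\` closed_disc z0 r) =
    lebesgue2 (closed_disc z0 s) - lebesgue2 (closed_disc z0 s `&` closed_disc z0 r))%E.
  exact: (@measureD _ _ _ lebesgue2 _ _ (measurable_closed_disc z0 s) (measurable_closed_disc z0 r) fins).
rewrite mD sub.
by rewrite (closed_disc_area z0 s0) (closed_disc_area z0 r0) EFinB muleBl.
Qed.

Lemma point_closed_box z0 : [set z0] = closed_box z0.1 z0.1 z0.2 z0.2.
Proof.
rewrite /closed_box !set_itv1; case: z0 => x y.
by apply/seteqP; split => [z -> //|[u v] /= [-> ->]].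
Qed.

Lemma lebesgue2_point z0 : lebesgue2 [set z0] = 0%E.
Proof. by rewrite point_closed_box lebesgue2_closed_box// subrr mul0r. Qed.

Lemma measurable_point z0 : measurable [set z0].
Proof. by rewrite point_closed_box; exact: measurable_closed_box. Qed.

(** The mass of a disc of radius r is compared with that of the ring of outer
    radius q, where q^2 - r^2 is the minimum of 1 and (s^2 - r^2) / 2: the
    Gaussian costs exp (pi q^2) <= exp pi * exp (pi r^2), and the ratio of areas
    is r^2 / (q^2 - r^2) <= r^2 (1 + 2 / (s^2 - r^2)). *)
Definition hole_const r s : R :=
  expR pi * expR (pi * r ^+ 2) * (r ^+ 2 + 2 * (r ^+ 2 / (s ^+ 2 - r ^+ 2))).

Lemma hole_const_ge0 r s : 0 <= r -> r < s -> 0 <= hole_const r s.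
Proof.
move=> r0 rs; have s2r2 : r ^+ 2 <= s ^+ 2.
  by rewrite ler_sqr ?nnegrE//; [exact: ltW|exact: ltW (le_lt_trans r0 rs)].
apply: mulr_ge0; first by rewrite mulr_ge0 ?expR_ge0.
by apply: addr_ge0; [exact: sqr_ge0|rewrite mulr_ge0// divr_ge0 ?sqr_ge0// subr_ge0].
Qed.

Variables (z0 : R * R) (A B d e : R * R -> R).
Hypothesis dH : forall z, holo A B z (d z) (e z).
Hypothesis cd : continuous d.
Hypothesis ce : continuous e.

Let F z := A z ^+ 2 + B z ^+ 2.
Let weight z := expR (- (pi * dist2 z0 z ^+ 2)).
Let G z := F z * weight z.

Let cF : continuous F.
Proof.
move=> z; have [dA dB] := dH z.
apply: (@continuousD _ _ _ (fun z => A z ^+ 2) (fun z => B z ^+ 2)).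
  by apply: continuous_sqr; exact: has_grad_continuous dA.
by apply: continuous_sqr; exact: has_grad_continuous dB.
Qed.

Let cG : continuous G.
Proof.
move=> z; apply: continuousM; first exact: cF.
apply: (@continuous_comp _ _ _ (fun z => - (pi * dist2 z0 z ^+ 2)) expR); last exact: continuous_expR.
apply: continuousN; apply: continuousM; first exact: cvg_cst.
by apply: continuous_sqr; exact: continuous_dist2.
Qed.

Let F0 z : 0 <= F z. Proof. by rewrite addr_ge0 ?sqr_ge0. Qed.
Let G0 z : 0 <= G z. Proof. by rewrite mulr_ge0 ?expR_ge0. Qed.

Let mG (D : set (R * R)) : measurable D -> measurable_fun D (fun z => (G z)%:E).
Proof.
move=> mD; apply/measurable_EFinP; apply: continuous_at_measurable2 => // z _.
exact: cG.
Qed.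

Lemma circle_int_weight w : circle_int z0 G w = circle_int z0 F w * weight w.
Proof.
have mT : measurable (`[0, T]%classic : set (measurableTypeR R)) by exact: measurable_itv.
rewrite /circle_int -(RintegralZr _ mT).
  by apply: eq_Rintegral => th _; rewrite /G /weight dist2_rotation.
apply: integrable_segment => th _.
apply: (@continuous_comp _ _ _ (fun th => rotation z0 (cos th) (sin th) w) F); last exact: cF.
exact: continuous_rotation_angle.
Qed.

(** By [circle_int_sqr_le], the circle of radius r separates the circular means
    of |H|^2 inside and outside; the radial weight is at most 1 in the hole and
    at least exp (- pi q^2) on the ring. *)
Lemma hole_ring r q : 0 < r -> r < q ->
  (\int[lebesgue2]_(w in half_open_annulus z0 0 r) (G w)%:E <=
   (r ^+ 2 * expR (pi * q ^+ 2) / (q ^+ 2 - r ^+ 2))%:E *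
   \int[lebesgue2]_(w in half_open_annulus z0 r q) (G w)%:E)%E.
Proof.
move=> r0 rq; have q0 := lt_trans r0 rq.
set K := half_open_annulus z0 0 r; set K' := half_open_annulus z0 r q.
have mK : measurable K := measurable_half_open_annulus z0 0 r.
have mK' : measurable K' := measurable_half_open_annulus z0 r q.
pose wr := polar z0 (ln r) 0.
have dwr : dist2 z0 wr = r by rewrite dist2_polar lnK ?posrE.
pose M := circle_int z0 F wr.
have M0 : 0 <= M by apply: Rintegral_ge0 => th _; exact: F0.
have T0 := @period_gt0 R.
have [mC cK] := @integral_circle_int R z0 K G mK (@rotation_invariant_dist2 R z0 (fun x => 0 < x <= r)) (fun z _ => @cG z) G0.
have [mC' cK'] := @integral_circle_int R z0 K' G mK' (@rotation_invariant_dist2 R z0 (fun x => r < x <= q)) (fun z _ => @cG z) G0.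
have fin1 := unit_disc_area_fin z0.
have f1 : lebesgue2 (closed_disc z0 1) \is a fin_num by rewrite ge0_fin_numE.
set kp := fine (lebesgue2 (closed_disc z0 1)).
have kE : lebesgue2 (closed_disc z0 1) = kp%:E by rewrite fineK.
have k0 : 0 <= kp by rewrite fine_ge0.
have qr0 : 0 < q ^+ 2 - r ^+ 2 by rewrite subr_gt0 ltr_sqr ?nnegrE ?ltW.
have areaK : (lebesgue2 K <= (r ^+ 2 * kp)%:E)%E.
  rewrite EFinM -kE -closed_disc_area//; apply: le_measure; rewrite ?inE//.
    exact: measurable_closed_disc.
  by move=> z; rewrite /K /half_open_annulus /closed_disc /= => /andP[].
have upper : (T%:E * \int[lebesgue2]_(w in K) (G w)%:E <= (M * (r ^+ 2 * kp))%:E)%E.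
  rewrite -cK; apply: (@le_trans _ _ (\int[lebesgue2]_(w in K) (cst M%:E w))%E).
    apply: (ge0_le_integral lebesgue2 mK _ mC).
    - by move=> w _; rewrite lee_fin; apply: Rintegral_ge0 => th _; exact: G0.
    - exact: measurable_cst.
    move=> w /andP[w0 wr']; rewrite lee_fin circle_int_weight.
    have cM : circle_int z0 F w <= M.
      by apply: (circle_int_sqr_le dH cd ce) => //; rewrite dwr.
    apply: le_trans cM; rewrite ler_piMr//.
      by apply: Rintegral_ge0 => th _; exact: F0.
    by rewrite /weight expR_le1 oppr_le0 mulr_ge0 ?sqr_ge0 ?pi_ge0.
  by rewrite integral_cst// EFinM lee_wpmul2l// lee_fin.
have lower : ((M * expR (- (pi * q ^+ 2)) * ((q ^+ 2 - r ^+ 2) * kp))%:E <=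
    T%:E * \int[lebesgue2]_(w in K') (G w)%:E)%E.
  rewrite -cK'; set c := M * expR _.
  apply: (@le_trans _ _ (\int[lebesgue2]_(w in K') (cst c%:E w))%E).
    by rewrite integral_cst// half_open_annulus_area// kE -!EFinM.
  have mc : measurable_fun K' (cst c%:E : R * R -> \bar R) by exact: measurable_cst.
  apply: (ge0_le_integral lebesgue2 mK' _ mc mC').
    by move=> w _ /=; rewrite lee_fin mulr_ge0 ?expR_ge0.
  move=> w /andP[rw wq] /=; rewrite lee_fin circle_int_weight /c.
  apply: ler_pM => //.
    by apply: (circle_int_sqr_le dH cd ce); rewrite dwr// ltW.
  rewrite /weight ler_expR lerN2 ler_wpM2l ?pi_ge0// ler_sqr ?nnegrE ?dist2_ge0//.
  exact: ltW.
have T0' : (0 < T%:E)%E by rewrite lte_fin.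
rewrite -(@lee_pmul2l _ T%:E)//; apply: (le_trans upper).
set g := r ^+ 2 * _ / _.
have -> : M * (r ^+ 2 * kp) = g * (M * expR (- (pi * q ^+ 2)) * ((q ^+ 2 - r ^+ 2) * kp)).
  rewrite /g expRN; field; rewrite gt_eqF ?expR_gt0//= ?gt_eqF//.
rewrite EFinM muleCA; apply: lee_wpmul2l => //.
by rewrite lee_fin /g divr_ge0 ?(ltW qr0)// mulr_ge0 ?sqr_ge0 ?expR_ge0.
Qed.

Lemma hole_estimate r s : 0 <= r -> r < s ->
  (\int[lebesgue2]_(w in closed_disc z0 r) (G w)%:E <=
   (hole_const r s)%:E * \int[lebesgue2]_(w in annulus z0 r s) (G w)%:E)%E.
Proof.
move=> r0 rs; have s0 := le_lt_trans r0 rs.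
have mA := measurable_annulus z0 r s.
have c0 : 0 <= hole_const r s by exact: hole_const_ge0.
have cD : closed_disc z0 r = half_open_annulus z0 0 r `|` [set z0].
  have dz0 z : dist2 z0 z = 0 -> z = z0.
    move=> /eqP; rewrite sqrtr_eq0 => h.
    have h1 := sqr_ge0 (z.1 - z0.1); have h2 := sqr_ge0 (z.2 - z0.2).
    have /eqP : (z.1 - z0.1) ^+ 2 = 0 by lra.
    have /eqP : (z.2 - z0.2) ^+ 2 = 0 by lra.
    rewrite !sqrf_eq0 !subr_eq0 => /eqP e2 /eqP e1.
    by rewrite [z]surjective_pairing e1 e2 -surjective_pairing.
  apply/seteqP; split => z; rewrite /closed_disc /half_open_annulus /=.
    move=> zr; have := dist2_ge0 z0 z; rewrite le_eqVlt => /predU1P[/esym/dz0|z0'].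
      by right.
    by left; rewrite z0' zr.
  case=> [/andP[]//|->]; rewrite /dist2 !subrr expr0n addr0 sqrtr0//.
have mK := measurable_half_open_annulus z0 0 r.
have mpt := measurable_point z0.
rewrite cD ge0_integral_setU//; last 3 first.
- by apply: mG; exact: measurableU.
- by move=> w _; rewrite lee_fin.
- apply/disj_setPS => z [/= + zz]; rewrite /half_open_annulus /= zz /dist2 !subrr expr0n addr0 sqrtr0.
  by rewrite ltxx.
rewrite [X in (_ + X)%E](_ : _ = 0%E) ?adde0; last first.
  by apply: null_set_integral => //; [exact: mG|exact: lebesgue2_point].
have [r_eq0|rn0] := eqVneq r 0.
  rewrite (_ : half_open_annulus z0 0 r = set0) ?integral_set0.
    by rewrite mule_ge0 ?lee_fin//; apply: integral_ge0 => w _; rewrite lee_fin.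
  rewrite r_eq0; apply/seteqP; split=> // z; rewrite /half_open_annulus /= => /andP[h1 h2].
  by have := lt_le_trans h1 h2; rewrite ltxx.
have rgt0 : 0 < r by rewrite lt_neqAle eq_sym rn0.
(* the ring has area proportional to y; y <= 1 bounds the loss in the weight,
   and y <= x keeps the ring inside the annulus *)
pose x := (s ^+ 2 - r ^+ 2) / 2; pose y := Num.min 1 x; pose q := Num.sqrt (r ^+ 2 + y).
have x0 : 0 < x by rewrite divr_gt0// subr_gt0 ltr_sqr ?nnegrE ?ltW.
have y0 : 0 < y by rewrite /y lt_min x0 ltr01.
have y1 : y <= 1 by rewrite /y ge_min lexx.
have yx : y <= x by rewrite /y ge_min lexx orbT.
have q2 : q ^+ 2 = r ^+ 2 + y by rewrite sqr_sqrtr// addr_ge0 ?sqr_ge0 ?ltW.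
have q0 : 0 <= q by exact: sqrtr_ge0.
have rq : r < q by rewrite -ltr_sqr ?nnegrE// q2 ltrDl.
have qs : q < s.
  rewrite -ltr_sqr ?nnegrE ?(ltW s0)// q2.
  have : x * 2 = s ^+ 2 - r ^+ 2 by rewrite /x divfK.
  by move: yx x0; lra.
apply: (le_trans (hole_ring rgt0 rq)).
apply: (@le_trans _ _ ((hole_const r s)%:E * \int[lebesgue2]_(w in half_open_annulus z0 r q) (G w)%:E)%E).
  apply: lee_wpmul2r; first by apply: integral_ge0 => w _; rewrite lee_fin.
  rewrite lee_fin q2 addrAC subrr add0r /hole_const.
  have e1 : expR (pi * (r ^+ 2 + y)) <= expR pi * expR (pi * r ^+ 2).
    rewrite -expRD ler_expR mulrDr addrC lerD2r -[leRHS]mulr1 ler_wpM2l ?pi_ge0//.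
  have iy : y^-1 <= 1 + x^-1.
    rewrite /y; case: (leP 1 x) => _; first by rewrite invr1 lerDl invr_ge0 ltW.
    by rewrite lerDr.
  have xE : x^-1 = 2 / (s ^+ 2 - r ^+ 2) by rewrite /x invf_div.
  apply: (@le_trans _ _ (expR pi * expR (pi * r ^+ 2) * (r ^+ 2 * (1 + x^-1)))); last first.
    by rewrite xE le_eqVlt; apply/orP; left; apply/eqP; ring.
  rewrite -mulrA mulrCA; apply: ler_pM => //.
    by rewrite mulr_ge0 ?sqr_ge0// invr_ge0 ltW.
  by rewrite ler_wpM2l ?sqr_ge0.
apply: lee_wpmul2l; first by rewrite lee_fin.
apply: ge0_subset_integral => //.
- exact: measurable_half_open_annulus.
- exact: mG.
- by move=> w _; rewrite lee_fin.
- by move=> z /andP[rz zq]; rewrite /annulus /= rz (le_lt_trans zq).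
Qed.

End Hole.

(** * Smooth bumps on rectangles *)

Section Bumps.
Context {R : realType}.
Implicit Types (p : {poly R}) (x t : R) (z : R * R) (u v : R * R -> R).

Lemma Cn_continuous n u : Cn n setT u -> continuous u.
Proof.
case: n => [|n]; first by move=> /= cu z; apply: cu; rewrite inE.
by move=> [du _ _] z; apply: differentiable_continuous; apply: du; rewrite inE.
Qed.

Lemma CnW n u : Cn n.+1 setT u -> Cn n setT u.
Proof.
elim: n u => [|n IH] u; first by move=> /Cn_continuous cu z _; exact: cu.
by move=> [du d1 d2]; split; [exact: du|exact: IH d1|exact: IH d2].
Qed.

Lemma differentiable_has_grad u z : differentiable u z ->
  has_grad u z (partial1 u z) (partial2 u z).
Proof.
move=> du; split=> //; apply/funext => v.
rewrite /partial1 /partial2 !deriveE//.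
have -> : v = v.1 *: ((1, 0) : R * R) + v.2 *: ((0, 1) : R * R).
  rewrite [LHS]surjective_pairing [RHS]surjective_pairing.
  by congr (_, _); rewrite /= /GRing.scale /=; ring.
rewrite linearD !linearZ /= /GRing.scale /=.
by rewrite !mulr1 !mulr0 addr0 add0r; ring.
Qed.

Lemma CnD n u v : Cn n setT u -> Cn n setT v -> Cn n setT (fun z => u z + v z).
Proof.
elim: n u v => [|n IH] u v.
  move=> /Cn_continuous cu /Cn_continuous cv z _.
  by apply: (@continuousD _ _ _ u v); [exact: cu|exact: cv].
move=> [du du1 du2] [dv dv1 dv2].
have H z : has_grad (fun z => u z + v z) z
    (partial1 u z + partial1 v z) (partial2 u z + partial2 v z).
  have zT : z \in setT by rewrite inE.
  exact: (has_gradD (differentiable_has_grad (du z zT)) (differentiable_has_grad (dv z zT))).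
split.
- by move=> z _; exact: has_grad_differentiable (H z).
- rewrite (_ : partial1 _ = fun z => partial1 u z + partial1 v z); first exact: IH.
  by apply/funext => z; case: (has_grad_partial (H z)).
- rewrite (_ : partial2 _ = fun z => partial2 u z + partial2 v z); first exact: IH.
  by apply/funext => z; case: (has_grad_partial (H z)).
Qed.

Lemma CnM n u v : Cn n setT u -> Cn n setT v -> Cn n setT (fun z => u z * v z).
Proof.
elim: n u v => [|n IH] u v.
  move=> /Cn_continuous cu /Cn_continuous cv z _.
  by apply: (@continuousM _ _ u v); [exact: cu|exact: cv].
move=> Cu Cv; have u0 := CnW Cu; have v0 := CnW Cv.
move: Cu Cv => [du du1 du2] [dv dv1 dv2].
have H z : has_grad (fun z => u z * v z) z
    (u z * partial1 v z + partial1 u z * v z) (u z * partial2 v z + partial2 u z * v z).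
  have zT : z \in setT by rewrite inE.
  exact: (has_gradM (differentiable_has_grad (du z zT)) (differentiable_has_grad (dv z zT))).
split.
- by move=> z _; exact: has_grad_differentiable (H z).
- rewrite (_ : partial1 _ = fun z => u z * partial1 v z + partial1 u z * v z).
    by apply: CnD; exact: IH.
  by apply/funext => z; case: (has_grad_partial (H z)).
- rewrite (_ : partial2 _ = fun z => u z * partial2 v z + partial2 u z * v z).
    by apply: CnD; exact: IH.
  by apply/funext => z; case: (has_grad_partial (H z)).
Qed.

Lemma Cn_cst n (c : R) : Cn n setT (fun _ => c).
Proof.
elim: n c => [|n IH] c; first by move=> z _; exact: cvg_cst.
split; first by move=> z _; exact: differentiable_cst.
- rewrite (_ : partial1 _ = fun=> 0); first exact: IH.
  by apply/funext => z; case: (has_grad_partial (has_grad_cst c z)).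
- rewrite (_ : partial2 _ = fun=> 0); first exact: IH.
  by apply/funext => z; case: (has_grad_partial (has_grad_cst c z)).
Qed.

(** The functions p(1/x) exp(-1/x) on x > 0, extended by zero, form a family
    that is stable under differentiation; hence they are all smooth. *)
Definition flat p x : R := if 0 < x then p.[x^-1] * expR (- x^-1) else 0.

Definition flat_deriv p : {poly R} := 'X^2 * (p - p^`()).

Lemma norm_horner_le p (y : R) : 1 <= y ->
  `|p.[y]| <= (\sum_(i < size p) `|p`_i|) * y ^+ size p.
Proof.
move=> y1; have y0 : 0 <= y by exact: le_trans y1.
rewrite horner_coef (le_trans (ler_norm_sum _ _ _))// mulr_suml.
apply: ler_sum => i _; rewrite normrM ler_wpM2l// ger0_norm ?exprn_ge0//.
by rewrite ler_weXn2l// ltnW.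
Qed.

(** The exponential beats the pole of p(1/x) at 0, so that [flat p] has
    derivative 0 there. *)
Lemma flat_le_sqr p : exists C, forall x, x <= 1 -> `|flat p x| <= C * x ^+ 2.
Proof.
set S := \sum_(i < size p) `|p`_i|; set n := size p.
have S0 : 0 <= S by exact: sumr_ge0.
(* of n + 2 powers of x, the polynomial consumes n *)
exists (S * (n.+2)`!%:R) => x x1; rewrite /flat; case: ifPn => [x0|_]; last first.
  by rewrite normr0 mulr_ge0 ?sqr_ge0// mulr_ge0.
set y := x^-1; have y1 : 1 <= y by rewrite /y invf_ge1.
have y0 : 0 < y by rewrite invr_gt0.
have ey : y ^+ n.+2 / (n.+2)`!%:R <= expR y.
  by have := @expR_ge1Dxn R y n.+1 (ltW y0); lra.
have f0 : 0 < (n.+2)`!%:R :> R by rewrite ltr0n fact_gt0.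
rewrite normrM (ger0_norm (expR_ge0 _)).
have en : expR (- y) <= (n.+2)`!%:R / y ^+ n.+2.
  rewrite expRN -invf_div lef_pV2 ?posrE ?expR_gt0//.
  by rewrite divr_gt0// exprn_gt0.
apply: (le_trans (ler_pM (normr_ge0 _) (expR_ge0 _) (norm_horner_le p y1) en)).
rewrite -/S -/n le_eqVlt; apply/orP; left; apply/eqP.
have -> : x = y^-1 by rewrite /y invrK.
have yn0 : y ^+ n != 0 by rewrite expf_neq0// gt_eqF.
rewrite -addn2 exprD; field.
by rewrite yn0 gt_eqF.
Qed.

Lemma is_derive_flat p x : is_derive x 1 (flat p) (flat (flat_deriv p) x).
Proof.
have [x0|x0|->] := ltgtP x 0.
- have H : is_derive x 1 (cst 0 : R -> R) 0 by exact: is_derive_cst.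
  rewrite {2}/flat ltNge (ltW x0) /=; apply: near_eq_is_derive H.
  near=> y; rewrite /flat ifF//; apply/negbTE; rewrite -leNgt ltW//.
  by near: y; exact: lt_nbhsl.
- have xn0 : x != 0 by rewrite gt_eqF.
  have dV : is_derive x 1 (fun x : R => x^-1) (- x ^- 2).
    have H := has_grad_slice1 (has_gradV (z := (x, 0)) (f := @fst R R) xn0 (has_grad_fst (x, 0))).
    by apply: (is_derive_eq H); rewrite /= mul1r.
  have dp : is_derive x 1 (fun x => p.[x^-1]) (- x ^- 2 * (p^`()).[x^-1]).
    by apply: (is_derive_eq (is_derive1_comp (is_derive_poly p x^-1) dV)); rewrite mulrC.
  have dVN : is_derive x 1 (fun x : R => - x^-1) (x ^- 2).
    by apply: (is_derive_eq (is_deriveN dV)); rewrite opprK.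
  have de : is_derive x 1 (fun x => expR (- x^-1)) (x ^- 2 * expR (- x^-1)).
    have H2 := @is_derive1_comp R expR (fun x => - x^-1) x _ _ (is_derive_expR _) dVN.
    by apply: (is_derive_eq H2); rewrite mulrC.
  have H := is_derive_mul_fun dp de.
  rewrite (_ : flat (flat_deriv p) x =
    p.[x^-1] * (x ^- 2 * expR (- x^-1)) + - x ^- 2 * (p^`()).[x^-1] * expR (- x^-1)).
    apply: near_eq_is_derive H.
    near=> y; rewrite /flat ifT//.
    by near: y; exact: lt_nbhsr.
  by rewrite /flat x0 /flat_deriv hornerM hornerXn hornerD hornerN -!exprVn; ring.
- rewrite {2}/flat ltxx.
  have [C HC] := flat_le_sqr p.
  have f0 : flat p 0 = 0 by rewrite /flat ltxx.
  apply: (@has_grad_slice1 _ (fun z => flat p z.1) 0 0 0 0).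
  apply: (@has_grad_of_bound _ _ _ _ _ `|C|) => v v1 /=.
  rewrite f0 add0r !mul0r addr0 !subr0.
  have [h1 _] := pair_norm_bound v.
  have v11 : v.1 <= 1 by rewrite (le_trans (ler_norm _))// (le_trans h1).
  apply: (le_trans (HC _ v11)); rewrite (le_trans (ler_wpM2r (sqr_ge0 _) (ler_norm C)))//.
  by rewrite ler_wpM2l// -real_normK ?num_real// ler_sqr ?nnegrE.
Unshelve. all: by end_near. Qed.

Lemma has_grad_flat_fst p (k c : R) z : has_grad (fun z => flat p (k * z.1 + c)) z
  (k * flat (flat_deriv p) (k * z.1 + c)) 0.
Proof.
have H := has_gradD (has_gradM (has_grad_cst k z) (has_grad_fst z)) (has_grad_cst c z).
by apply: (has_grad_eq (has_grad_comp H (is_derive_flat p _))) => /=; ring.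
Qed.

Lemma has_grad_flat_snd p (k c : R) z : has_grad (fun z => flat p (k * z.2 + c)) z
  0 (k * flat (flat_deriv p) (k * z.2 + c)).
Proof.
have H := has_gradD (has_gradM (has_grad_cst k z) (has_grad_snd z)) (has_grad_cst c z).
by apply: (has_grad_eq (has_grad_comp H (is_derive_flat p _))) => /=; ring.
Qed.

Lemma Cn_flat_fst n p (k c : R) : Cn n setT (fun z => flat p (k * z.1 + c)).
Proof.
elim: n p => [|n IH] p.
  by move=> z _; exact: has_grad_continuous (has_grad_flat_fst p k c z).
split.
- by move=> z _; exact: has_grad_differentiable (has_grad_flat_fst p k c z).
- rewrite (_ : partial1 _ = fun z => k * flat (flat_deriv p) (k * z.1 + c)).
    by apply: CnM; [exact: Cn_cst|exact: IH].
  by apply/funext => z; case: (has_grad_partial (has_grad_flat_fst p k c z)).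
- rewrite (_ : partial2 _ = fun=> 0); first exact: Cn_cst.
  by apply/funext => z; case: (has_grad_partial (has_grad_flat_fst p k c z)).
Qed.

Lemma Cn_flat_snd n p (k c : R) : Cn n setT (fun z => flat p (k * z.2 + c)).
Proof.
elim: n p => [|n IH] p.
  by move=> z _; exact: has_grad_continuous (has_grad_flat_snd p k c z).
split.
- by move=> z _; exact: has_grad_differentiable (has_grad_flat_snd p k c z).
- rewrite (_ : partial1 _ = fun=> 0); first exact: Cn_cst.
  by apply/funext => z; case: (has_grad_partial (has_grad_flat_snd p k c z)).
- rewrite (_ : partial2 _ = fun z => k * flat (flat_deriv p) (k * z.2 + c)).
    by apply: CnM; [exact: Cn_cst|exact: IH].
  by apply/funext => z; case: (has_grad_partial (has_grad_flat_snd p k c z)).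
Qed.

(** The product of [flat 1] at (n + 1) times the distances to the four sides; as
    n grows it increases to the indicator function of the open box. *)
Definition box_bump (a b c d : R) (n : nat) z : R :=
  flat 1 (n.+1%:R * z.1 + - (n.+1%:R * a)) * flat 1 (- n.+1%:R * z.1 + n.+1%:R * b) *
  (flat 1 (n.+1%:R * z.2 + - (n.+1%:R * c)) * flat 1 (- n.+1%:R * z.2 + n.+1%:R * d)).

Lemma Cn_box_bump a b c d n k : Cn k setT (box_bump a b c d n).
Proof.
by apply: CnM; apply: CnM; solve [exact: Cn_flat_fst|exact: Cn_flat_snd].
Qed.

Lemma flat1_ge0 x : 0 <= flat 1 x.
Proof. by rewrite /flat; case: ifP => // _; rewrite hornerE mul1r expR_ge0. Qed.

Lemma flat1_le1 x : flat 1 x <= 1.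
Proof.
rewrite /flat; case: ifP => // x0; rewrite hornerE mul1r expR_le1 oppr_le0.
by rewrite invr_ge0 ltW.
Qed.

Lemma flat1_eq0 x : x <= 0 -> flat 1 x = 0.
Proof. by move=> x0; rewrite /flat ltNge x0. Qed.

Lemma flat1_cvg x : 0 < x -> flat 1 (n.+1%:R * x) @[n --> \oo] --> (1 : R).
Proof.
move=> x0; rewrite -[X in _ --> X](@expR0 R).
rewrite (_ : (fun n => _) = fun n : nat => expR (- (x^-1 * n.+1%:R^-1))).
  apply: continuous_cvg; first exact: continuous_expR.
  rewrite -[X in _ --> X]oppr0; apply: cvgN; rewrite -[X in _ --> X](mulr0 x^-1).
  by apply: cvgM; [exact: cvg_cst|exact: cvg_harmonic].
apply/funext => n; rewrite /flat ifT ?mulr_gt0// hornerE mul1r invfM mulrC.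
by [].
Qed.

Lemma box_bump_ge0 a b c d n z : 0 <= box_bump a b c d n z.
Proof. by rewrite /box_bump !mulr_ge0 ?flat1_ge0. Qed.

Lemma box_bump_le1 a b c d n z : box_bump a b c d n z <= 1.
Proof.
by rewrite /box_bump !mulr_ile1 ?mulr_ge0 ?flat1_ge0 ?flat1_le1.
Qed.

Lemma box_bump_out a b c d n z : ~ open_box a b c d z -> box_bump a b c d n z = 0.
Proof.
move=> nz; have n0 : 0 <= n.+1%:R :> R by [].
have [za|za] := leP z.1 a.
  rewrite /box_bump flat1_eq0 ?mul0r//.
  by have := ler_wpM2l n0 za; lra.
have [zb|zb] := leP b z.1.
  rewrite /box_bump [X in _ * X * _]flat1_eq0 ?mulr0 ?mul0r//.
  by have := ler_wpM2l n0 zb; lra.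
have [zc|zc] := leP z.2 c.
  rewrite /box_bump [X in _ * (X * _)]flat1_eq0 ?mul0r ?mulr0//.
  by have := ler_wpM2l n0 zc; lra.
have [zd|zd] := leP d z.2.
  rewrite /box_bump [X in _ * (_ * X)]flat1_eq0 ?mulr0//.
  by have := ler_wpM2l n0 zd; lra.
by exfalso; apply: nz; split; rewrite /= in_itv/= ?za ?zb ?zc ?zd.
Qed.

Lemma box_bump_cvg a b c d z :
  box_bump a b c d n z @[n --> \oo] --> (\1_(open_box a b c d) z : R).
Proof.
rewrite indicE; case: (boolP (z \in _)); rewrite ?inE ?notin_setE => zB; last first.
  by rewrite (_ : (fun n => _) = fun=> 0) ?cvg_cst//; [exact: cvg_cst|apply/funext => n; exact: box_bump_out].
move: zB => [/=]; rewrite !in_itv/= => /andP[z1 z2] /andP[z3 z4].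
rewrite [X in _ --> X](_ : _ = ((1 * 1) * (1 * 1) : R)); last by rewrite !mulr1.
have E (n : nat) (x y : R) : n.+1%:R * x + - (n.+1%:R * y) = n.+1%:R * (x - y) :> R by rewrite mulrBr.
have E' (n : nat) (x y : R) : - n.+1%:R * x + n.+1%:R * y = n.+1%:R * (y - x) :> R by rewrite mulrBr mulNr addrC.
apply: cvgM; apply: cvgM; (under eq_fun do rewrite ?E ?E'); apply: flat1_cvg; rewrite subr_gt0//.
Qed.

Lemma closed_closed_box (a b c d : R) : closed (closed_box a b c d).
Proof. by apply: compact_closed; [exact: norm_hausdorff|exact: compact_closed_box]. Qed.

Lemma box_bump_test (U : set (R * R)) a b c d n :
  closed_box a b c d `<=` U -> test_function U (box_bump a b c d n).
Proof.
move=> BU.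
have sub : closure [set z | box_bump a b c d n z != 0] `<=` closed_box a b c d.
  apply: (subset_trans (closure_subset (B := closed_box a b c d) _)).
    move=> z /= /eqP nz; apply: subset_open_closed_box; apply: contrapT => zB.
    by apply: nz; exact: box_bump_out.
  by have /closure_id <- := @closed_closed_box a b c d.
split; first by move=> k; exact: Cn_box_bump.
- apply: subclosed_compact; last exact: sub; first exact: closed_closure.
  exact: compact_closed_box.
- exact: (subset_trans sub).
Qed.

End Bumps.

(** * Weak gradients of continuously differentiable functions *)

Section FundamentalLemma.
Context {R : realType}.
Implicit Types (z : R * R) (u v p : R * R -> R).

Lemma ae_mono (P Q : R * R -> Prop) : (forall z, P z -> Q z) ->
  {ae lebesgue2, forall z, P z} -> {ae lebesgue2, forall z, Q z}.
Proof.
move=> PQ [N [mN N0 PN]]; exists N; split=> // z nQ; apply: PN => Pz.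
exact/nQ/PQ.
Qed.

Lemma ae_and (P Q : R * R -> Prop) :
  {ae lebesgue2, forall z, P z} -> {ae lebesgue2, forall z, Q z} ->
  {ae lebesgue2, forall z, P z /\ Q z}.
Proof.
move=> aP aQ.
exact: (@filterI _ _ (ae_filter_ringOfSetsType (@lebesgue2 R)) _ _ aP aQ).
Qed.

Lemma ae_all (P : R * R -> Prop) : (forall z, P z) -> {ae lebesgue2, forall z, P z}.
Proof.
move=> HP; have := @filterT _ _ (ae_filter_ringOfSetsType (@lebesgue2 R)).
by apply: ae_mono.
Qed.

Definition open_boxes : set (set (R * R)) :=
  [set Q | exists a b c d, Q = open_box a b c d].

Lemma open_boxI (a b c d a' b' c' d' : R) :
  open_box a b c d `&` open_box a' b' c' d' =
  open_box (Num.max a a') (Num.min b b') (Num.max c c') (Num.min d d').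
Proof.
apply/seteqP; split => [z [[/= z1 z2] [/= z1' z2']]|z [/=]]; move: z1 z2 z1' z2' || idtac.
- rewrite !in_itv/= => /andP[h1 h2] /andP[h3 h4] /andP[h5 h6] /andP[h7 h8].
  by split; rewrite /= in_itv/= gt_max lt_min ?h1 ?h2 ?h3 ?h4 ?h5 ?h6 ?h7 ?h8.
- rewrite !in_itv/= !gt_max !lt_min => /andP[/andP[h1 h2] /andP[h3 h4]] /andP[/andP[h5 h6] /andP[h7 h8]].
  by split; split; rewrite /= in_itv/= ?h1 ?h2 ?h3 ?h4 ?h5 ?h6 ?h7 ?h8.
Qed.

(** Together with [open_boxI] this makes the boxes a generating family to which
    induction on Dynkin systems applies. *)
Lemma measurable_open_boxes : (measurable : set (set (R * R))) = <<s open_boxes >>.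
Proof.
apply/seteqP; split => [S mS|]; last first.
  apply: smallest_sub; first exact: sigma_algebra_measurable.
  by move=> _ [a [b [c [d ->]]]]; exact: measurable_open_box.
have bnd (x : R) : exists n : nat, `|x| < n%:R.
  by exists (Num.truncn `|x|).+1; exact: truncnS_gt.
pose T' := g_sigma_algebraType open_boxes.
have m1 : measurable_fun setT (fst : T' -> R).
  apply: (measurability _ (RGenOpens.measurableE R)).
  move=> _ [_ [a [b ->]] <-]; rewrite setTI.
  have -> : (fst : T' -> R) @^-1` `]a, b[%classic =
      \bigcup_n (open_box a b (- n%:R) n%:R : set T').
    apply/seteqP; split => [z zab|z [n _ []//]].
    by have [n zn] := bnd z.2; exists n => //; split => //=; rewrite in_itv/= -ltr_norml.
  apply: bigcupT_measurable => n; apply: sub_sigma_algebra.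
  by exists a, b, (- n%:R), n%:R.
have m2 : measurable_fun setT (snd : T' -> R).
  apply: (measurability _ (RGenOpens.measurableE R)).
  move=> _ [_ [a [b ->]] <-]; rewrite setTI.
  have -> : (snd : T' -> R) @^-1` `]a, b[%classic =
      \bigcup_n (open_box (- n%:R) n%:R a b : set T').
    apply/seteqP; split => [z zab|z [n _ []//]].
    by have [n zn] := bnd z.1; exists n => //; split => //=; rewrite in_itv/= -ltr_norml.
  apply: bigcupT_measurable => n; apply: sub_sigma_algebra.
  by exists (- n%:R), n%:R, a, b.
have mid : measurable_fun setT (fun x : T' => (x : R * R)).
  by apply/measurable_fun_pairP; split.
by have := mid measurableT S mS; rewrite setTI.
Qed.

(** The sets over which the integral of v vanishes form a Dynkin system, so it
    vanishes over every measurable subset of the box. *)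
Lemma ae_eq0_of_boxes v (a b c d : R) :
  lebesgue2.-integrable (open_box a b c d) (EFin \o v) ->
  (forall a' b' c' d', closed_box a' b' c' d' `<=` closed_box a b c d ->
     (\int[lebesgue2]_(z in open_box a' b' c' d') (v z)%:E = 0)%E) ->
  {ae lebesgue2, forall z, open_box a b c d z -> v z = 0}.
Proof.
set B := open_box a b c d => iv v0; have mB : measurable B := measurable_open_box a b c d.
pose f := ((EFin \o v) \_ B)%E.
have If : lebesgue2.-integrable setT f.
  by apply/integrable_restrict => //; rewrite setTI.
have fE S : measurable S -> (\int[lebesgue2]_(z in S) f z =
    \int[lebesgue2]_(z in S `&` B) (v z)%:E)%E.
  by move=> mS; rewrite integral_mkcondr.
have IS S : measurable S -> lebesgue2.-integrable S f.
  by move=> mS; apply: integrableS If.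
have key S : measurable S -> (\int[lebesgue2]_(z in S) f z = 0)%E.
  move=> mS.
  have := @dynkin_induction _ (R * R)%type open_boxes
    (fun S => (\int[lebesgue2]_(z in S) f z = 0)%E) measurable_open_boxes.
  apply => //.
  - move=> _ _ [a1 [b1 [c1 [d1 ->]]]] [a2 [b2 [c2 [d2 ->]]]].
    by rewrite open_boxI; do 4 eexists.
  - by rewrite fE// setTI; exact: v0.
  - move=> _ [a' [b' [c' [d' ->]]]]; rewrite fE; last exact: measurable_open_box.
    rewrite open_boxI; apply: v0 => z [/=]; rewrite !in_itv/= !ge_max !le_min.
    move=> /andP[/andP[h1 h2] /andP[h3 h4]] /andP[/andP[h5 h6] /andP[h7 h8]].
    by split; rewrite /= in_itv/= ?h1 ?h2 ?h3 ?h4 ?h5 ?h6 ?h7 ?h8.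
  - move=> S' mS' S'0.
    have : (\int[lebesgue2]_(z in S' `|` ~` S') f z = 0)%E.
      by rewrite setUv fE// setTI; exact: v0.
    rewrite integral_setU//.
    + by rewrite S'0 add0e.
    + exact: measurableC.
    + by rewrite setUv; exact: (measurable_int _ If).
    + by apply/disj_setPCl.
  - move=> F mF tF F0; rewrite integral_bigcup//.
      by apply: eseries0 => i _ _; exact: F0.
    by apply: IS; exact: bigcupT_measurable.
  - by rewrite -measurable_open_boxes.
have := @integral_ae_eq _ _ _ lebesgue2 B mB (cst 0%E) (EFin \o v) iv.
have mc : measurable_fun B (cst 0%E : R * R -> \bar R) by exact: measurable_cst.
move=> /(_ mc) H.
have : ae_eq lebesgue2 B (EFin \o v) (cst 0%E).
  apply: H => E EB mE; rewrite integral0 -(key E mE) fE//.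
  by congr (integral _ _ _); apply/esym/setIidPl.
by apply: filterS => z /= h Bz; have [] := h Bz.
Qed.

Lemma Rintegral_vanish_out (U K : set (R * R)) (f : R * R -> R) :
  K `<=` U -> (forall z, ~ K z -> f z = 0) ->
  Rintegral lebesgue2 U f = Rintegral lebesgue2 K f.
Proof.
move=> KU f0; rewrite Rintegral_mkcond [RHS]Rintegral_mkcond; congr (Rintegral _ _ _).
apply/funext => z; rewrite !patchE.
case: ifPn => [|]; rewrite ?inE ?notin_setE => Uz.
  by case: ifPn => //; rewrite notin_setE => /f0.
by rewrite ifF//; apply/negbTE; rewrite notin_setE => /KU.
Qed.

Lemma partial_box_bump_out a b c d n z : ~ closed_box a b c d z ->
  partial1 (box_bump a b c d n) z = 0 /\ partial2 (box_bump a b c d n) z = 0.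
Proof.
move=> nz; have H : \forall y \near z, (cst 0 : R * R -> R) y = box_bump a b c d n y.
  have : nbhs z (~` closed_box a b c d).
    by apply: open_nbhs_nbhs; split=> //; apply: closed_openC; exact: closed_closed_box.
  apply: filterS => y /= ny; rewrite box_bump_out// => /subset_open_closed_box.
  exact: ny.
have dC (e : R * R) : 'D_e (box_bump a b c d n) z = 0.
  have [_ D0] := near_eq_is_derive H (is_derive_cst 0 z e).
  exact: D0.
by split; exact: dC.
Qed.

Section OneBox.
Variables (U A : set (R * R)) (u p q : R * R -> R) (w : R * R -> R * R).
Hypothesis wg : weak_gradient U u w.
Hypothesis AU : A `<=` U.
Hypothesis du : forall z, A z -> has_grad u z (p z) (q z).
Hypothesis cp : forall z, A z -> {for z, continuous p}.
Hypothesis cq : forall z, A z -> {for z, continuous q}.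

Let w1 := fst \o w.
Let w2 := snd \o w.

Lemma integrable_weak_box a b c d : closed_box a b c d `<=` A ->
  lebesgue2.-integrable (closed_box a b c d) (EFin \o w1) /\
  lebesgue2.-integrable (closed_box a b c d) (EFin \o w2).
Proof.
move=> BA; have [_ [_ i1] [_ i2] _] := wg.
by split; [apply: i1|apply: i2]; try exact: compact_closed_box;
  apply: (subset_trans BA).
Qed.

Lemma integrable_bump a b c d n (f : R * R -> R) (K : set (R * R)) :
  measurable K -> lebesgue2.-integrable K (EFin \o f) ->
  lebesgue2.-integrable K (EFin \o (fun z => f z * box_bump a b c d n z)).
Proof.
move=> mK /[dup] /measurable_int/measurable_EFinP mf; apply: le_integrable => //.
  apply/measurable_EFinP; apply: measurable_funM => //.
  apply: continuous_at_measurable2 => // z _.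
  exact: (Cn_continuous (Cn_box_bump a b c d n 0)).
move=> z _ /=; rewrite lee_fin normrM ler_piMr//.
by rewrite ger0_norm ?box_bump_ge0 ?box_bump_le1.
Qed.

(** Integration by parts against a bump, which vanishes on the boundary of the
    box: the weak and the classical gradient of u have the same moments. *)
Lemma weak_box_bump a b c d n : a <= b -> c <= d -> closed_box a b c d `<=` A ->
  Rintegral lebesgue2 (closed_box a b c d) (fun z => w1 z * box_bump a b c d n z) =
  Rintegral lebesgue2 (closed_box a b c d) (fun z => p z * box_bump a b c d n z) /\
  Rintegral lebesgue2 (closed_box a b c d) (fun z => w2 z * box_bump a b c d n z) =
  Rintegral lebesgue2 (closed_box a b c d) (fun z => q z * box_bump a b c d n z).
Proof.
move=> ab cd BA; set K := closed_box a b c d; set phi := box_bump a b c d n.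
have mK : measurable K := measurable_closed_box a b c d.
have KU : K `<=` U := subset_trans BA AU.
have phi0 z : ~ K z -> phi z = 0.
  by move=> nz; apply: box_bump_out => /subset_open_closed_box.
have V (f : R * R -> R) : (forall z, ~ K z -> f z = 0) ->
  Rintegral lebesgue2 U f = Rintegral lebesgue2 K f by exact: Rintegral_vanish_out.
have V1 : Rintegral lebesgue2 U (fun z => u z * partial1 phi z) =
    Rintegral lebesgue2 K (fun z => u z * partial1 phi z).
  by apply: V => z /partial_box_bump_out-/(_ n)[h _]; rewrite h mulr0.
have V2 : Rintegral lebesgue2 U (fun z => u z * partial2 phi z) =
    Rintegral lebesgue2 K (fun z => u z * partial2 phi z).
  by apply: V => z /partial_box_bump_out-/(_ n)[_ h]; rewrite h mulr0.
have V3 : Rintegral lebesgue2 U (fun z => (w z).1 * phi z) =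
    Rintegral lebesgue2 K (fun z => (w z).1 * phi z).
  by apply: V => z /phi0 h; rewrite h mulr0.
have V4 : Rintegral lebesgue2 U (fun z => (w z).2 * phi z) =
    Rintegral lebesgue2 K (fun z => (w z).2 * phi z).
  by apply: V => z /phi0 h; rewrite h mulr0.
have [_ _ _ wphi] := wg.
have [h1 h2] := wphi phi (@box_bump_test R U a b c d n KU).
rewrite V1 V3 in h1; rewrite V2 V4 in h2.
have [dphi C1 C2] := @Cn_box_bump R a b c d n 1.
have cphi : continuous phi := Cn_continuous (@Cn_box_bump R a b c d n 0).
have cphi1 : continuous (partial1 phi) := Cn_continuous (n := 0) C1.
have cphi2 : continuous (partial2 phi) := Cn_continuous (n := 0) C2.
have gphi z : has_grad phi z (partial1 phi z) (partial2 phi z).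
  by apply: differentiable_has_grad; apply: dphi; rewrite inE.
have cu z : K z -> {for z, continuous u} by move=> /BA/du; exact: has_grad_continuous.
have c1 z : K z -> {for z, continuous (fun z => u z * partial1 phi z)}.
  by move=> Kz; apply: continuousM; [exact: cu|exact: cphi1].
have c2 z : K z -> {for z, continuous (fun z => u z * partial2 phi z)}.
  by move=> Kz; apply: continuousM; [exact: cu|exact: cphi2].
have cpp z : K z -> {for z, continuous (fun z => p z * phi z)}.
  by move=> Kz; apply: continuousM; [exact/cp/BA|exact: cphi].
have cqp z : K z -> {for z, continuous (fun z => q z * phi z)}.
  by move=> Kz; apply: continuousM; [exact/cq/BA|exact: cphi].
have e1 y : phi (b, y) = 0 /\ phi (a, y) = 0.
  by split; apply: box_bump_out => -[/=]; rewrite in_itv/= ltxx ?andbF.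
have e2 x : phi (x, d) = 0 /\ phi (x, c) = 0.
  by split; apply: box_bump_out => -[/= _]; rewrite in_itv/= ltxx ?andbF.
have z1 : Rintegral lebesgue2 K (fun z => u z * partial1 phi z + p z * phi z) = 0.
  have dP (x y : R) : K (x, y) -> is_derive x 1 (fun x => u (x, y) * phi (x, y))
      (u (x, y) * partial1 phi (x, y) + p (x, y) * phi (x, y)).
    by move=> /BA/du dxy; exact: (has_grad_slice1 (has_gradM dxy (gphi _))).
  have cP z : K z -> {for z, continuous (fun z => u z * partial1 phi z + p z * phi z)}.
    by move=> Kz; apply: (@continuousD _ _ _ (fun z => u z * partial1 phi z)); [exact: c1|exact: cpp].
  rewrite (@Rintegral_closed_box_derive1 R a b c d (fun z => u z * phi z)
    (fun z => u z * partial1 phi z + p z * phi z) ab dP cP).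
  under eq_Rintegral do rewrite (e1 _).1 (e1 _).2 !mulr0 subrr.
  by rewrite Rintegral_cst// mul0r.
have z2 : Rintegral lebesgue2 K (fun z => u z * partial2 phi z + q z * phi z) = 0.
  have dP (x y : R) : K (x, y) -> is_derive y 1 (fun y => u (x, y) * phi (x, y))
      (u (x, y) * partial2 phi (x, y) + q (x, y) * phi (x, y)).
    by move=> /BA/du dxy; exact: (has_grad_slice2 (has_gradM dxy (gphi _))).
  have cP z : K z -> {for z, continuous (fun z => u z * partial2 phi z + q z * phi z)}.
    by move=> Kz; apply: (@continuousD _ _ _ (fun z => u z * partial2 phi z)); [exact: c2|exact: cqp].
  rewrite (@Rintegral_closed_box_derive2 R a b c d (fun z => u z * phi z)
    (fun z => u z * partial2 phi z + q z * phi z) cd dP cP).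
  under eq_Rintegral do rewrite (e2 _).1 (e2 _).2 !mulr0 subrr.
  by rewrite Rintegral_cst// mul0r.
rewrite (@RintegralD _ _ _ lebesgue2 K _ _ mK (integrable_closed_box c1) (integrable_closed_box cpp)) h1 in z1.
rewrite (@RintegralD _ _ _ lebesgue2 K _ _ mK (integrable_closed_box c2) (integrable_closed_box cqp)) h2 in z2.
by split; apply/esym/eqP; rewrite -subr_eq0 addrC; apply/eqP.
Qed.

End OneBox.

(** Dominated convergence, as the bumps tend to the indicator function of the
    open box. *)
Lemma integral_box_of_bumps v a b c d :
  lebesgue2.-integrable (closed_box a b c d) (EFin \o v) ->
  (forall n, Rintegral lebesgue2 (closed_box a b c d)
     (fun z => v z * box_bump a b c d n z) = 0) ->
  (\int[lebesgue2]_(z in open_box a b c d) (v z)%:E = 0)%E.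
Proof.
set K := closed_box a b c d; set O := open_box a b c d => iv v0.
have mK : measurable K := measurable_closed_box a b c d.
have mO : measurable O := measurable_open_box a b c d.
have ib n := integrable_bump a b c d n mK iv.
have OK : O = K `&` O.
  by apply/esym/setIidPr; exact: subset_open_closed_box.
rewrite OK integral_mkcondr.
have mlim : measurable_fun K ((EFin \o v) \_ O)%E.
  apply/(measurable_restrict _ mO mK); rewrite -OK.
  by apply: measurable_funS (measurable_int _ iv) => //; exact: subset_open_closed_box.
have cvg_ae : {ae lebesgue2, forall z, K z ->
    (fun n => (v z * box_bump a b c d n z)%:E) @ \oo --> ((EFin \o v) \_ O)%E z}.
  apply: nearW => z Kz; rewrite patchE.
  have := @box_bump_cvg R a b c d z; rewrite indicE.
  case: (boolP (z \in O)) => zO cb.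
    apply: cvg_EFin; first exact: nearW.
    by rewrite -[X in _ --> X]mulr1; apply: cvgM => //; exact: cvg_cst.
  apply: cvg_EFin; first exact: nearW.
  by rewrite -[X in _ --> X](mulr0 (v z)); apply: cvgM => //; exact: cvg_cst.
have dom_ae : {ae lebesgue2, forall z n, K z ->
    (`|(v z * box_bump a b c d n z)%:E| <= `|(EFin \o v) z|)%E}.
  apply: nearW => z n Kz; rewrite /= lee_fin normrM ler_piMr//.
  by rewrite ger0_norm ?box_bump_ge0 ?box_bump_le1.
have [_ _ H] := @dominated_convergence _ _ _ lebesgue2 K mK _ _ _
  (fun n => measurable_int _ (ib n)) mlim cvg_ae (integrable_norm iv) dom_ae.
have E0 n : (\int[lebesgue2]_(z in K) (v z * box_bump a b c d n z)%:E = 0)%E.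
  have fn := @integrable_fin_num _ _ _ lebesgue2 K mK _ (ib n).
  by rewrite -[LHS](fineK fn); congr EFin; exact: v0.
have E0' : (fun n => \int[lebesgue2]_(z in K) (v z * box_bump a b c d n z)%:E)%E = fun=> 0%E.
  by apply/funext.
rewrite E0' in H.
exact/esym/(cvg_unique _ (cvg_cst _) H).
Qed.

(** Countably many boxes cover an open set. *)
Lemma ae_eq0_open (A : set (R * R)) v : open A ->
  (forall a b c d, closed_box a b c d `<=` A ->
     lebesgue2.-integrable (closed_box a b c d) (EFin \o v)) ->
  (forall a b c d n, a <= b -> c <= d -> closed_box a b c d `<=` A ->
     Rintegral lebesgue2 (closed_box a b c d)
       (fun z => v z * box_bump a b c d n z) = 0) ->
  {ae lebesgue2, forall z, A z -> v z = 0}.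
Proof.
move=> oA iv v0.
have box0 a b c d : closed_box a b c d `<=` A ->
    (\int[lebesgue2]_(z in open_box a b c d) (v z)%:E = 0)%E.
  move=> BA; have [ab|ba] := leP a b; last first.
    rewrite (_ : open_box a b c d = set0) ?integral_set0//.
    apply/seteqP; split=> // z [/=]; rewrite in_itv/= => /andP[h1 h2] _.
    by have := lt_trans (lt_trans h1 h2) ba; rewrite ltxx.
  have [cd|dc] := leP c d; last first.
    rewrite (_ : open_box a b c d = set0) ?integral_set0//.
    apply/seteqP; split=> // z [/= _]; rewrite in_itv/= => /andP[h1 h2].
    by have := lt_trans (lt_trans h1 h2) dc; rewrite ltxx.
  by apply: integral_box_of_bumps; [exact: iv|move=> n; exact: v0].
have aebox n : rat_closed_box n `<=` A ->
    {ae lebesgue2, forall z, rat_open_box n z -> v z = 0}.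
  move=> BA; apply: ae_eq0_of_boxes.
    apply: integrableS (iv _ _ _ _ BA); [exact: measurable_closed_box|exact: measurable_open_box|].
    exact: subset_open_closed_box.
  by move=> a b c d sub; apply: box0; exact: subset_trans BA.
have aebox' n : {ae lebesgue2, forall z, rat_closed_box n `<=` A -> rat_open_box n z -> v z = 0}.
  have [BA|nBA] := pselect (rat_closed_box n `<=` A).
    by apply: (ae_mono _ (aebox n BA)) => z h _; exact: h.
  by apply: ae_all => z /nBA.
have : {ae lebesgue2, forall z, forall n, rat_closed_box n `<=` A -> rat_open_box n z -> v z = 0}.
  exact: ae_foralln aebox'.
by apply: ae_mono => z h Az; have [n [nz nA]] := open_rat_box oA Az; exact: h nz.
Qed.

(** The fundamental lemma of the calculus of variations, applied to the
    difference of the two gradients. *)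
Lemma weak_gradient_ae (U A : set (R * R)) u p q w :
  weak_gradient U u w -> open A -> A `<=` U ->
  (forall z, A z -> has_grad u z (p z) (q z)) ->
  (forall z, A z -> {for z, continuous p}) ->
  (forall z, A z -> {for z, continuous q}) ->
  {ae lebesgue2, forall z, A z -> w z = (p z, q z)}.
Proof.
move=> wg oA AU du cp cq.
have H1 : {ae lebesgue2, forall z, A z -> (w z).1 - p z = 0}.
  apply: ae_eq0_open => //.
    move=> a b c d BA; have [i1 _] := integrable_weak_box wg AU BA.
    have ip := @integrable_closed_box R a b c d p (fun z Bz => cp z (BA z Bz)).
    exact: (@integrableB _ _ _ lebesgue2 _ (measurable_closed_box a b c d) _ _ i1 ip).
  move=> a b c d n ab cd BA; have [h1 _] := weak_box_bump wg AU du cp cq n ab cd BA.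
  have [i1 _] := integrable_weak_box wg AU BA.
  have mB := @measurable_closed_box R a b c d.
  have ip := @integrable_closed_box R a b c d p (fun z Bz => cp z (BA z Bz)).
  under eq_Rintegral do rewrite mulrBl.
  rewrite (@RintegralB _ _ _ lebesgue2 _ _ _ mB (integrable_bump a b c d n mB i1) (integrable_bump a b c d n mB ip)).
  by rewrite h1 subrr.
have H2 : {ae lebesgue2, forall z, A z -> (w z).2 - q z = 0}.
  apply: ae_eq0_open => //.
    move=> a b c d BA; have [_ i1] := integrable_weak_box wg AU BA.
    have ip := @integrable_closed_box R a b c d q (fun z Bz => cq z (BA z Bz)).
    exact: (@integrableB _ _ _ lebesgue2 _ (measurable_closed_box a b c d) _ _ i1 ip).
  move=> a b c d n ab cd BA; have [_ h1] := weak_box_bump wg AU du cp cq n ab cd BA.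
  have [_ i1] := integrable_weak_box wg AU BA.
  have mB := @measurable_closed_box R a b c d.
  have ip := @integrable_closed_box R a b c d q (fun z Bz => cq z (BA z Bz)).
  under eq_Rintegral do rewrite mulrBl.
  rewrite (@RintegralB _ _ _ lebesgue2 _ _ _ mB (integrable_bump a b c d n mB i1) (integrable_bump a b c d n mB ip)).
  by rewrite h1 subrr.
apply: (ae_mono _ (ae_and H1 H2)) => z [h1 h2] Az.
rewrite [w z]surjective_pairing; congr (_, _); apply/eqP; rewrite -subr_eq0; apply/eqP.
  exact: h1.
exact: h2.
Qed.

End FundamentalLemma.

(** * Simple zeros *)

Section SimpleZeros.
Context {R : realType}.
Implicit Types (z w : R * R) (a b d e : R * R -> R).

Lemma has_grad_approx (f : R * R -> R) z p q (eps : R) : has_grad f z p q -> 0 < eps ->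
  \forall w \near z,
    `|f w - f z - (p * (w.1 - z.1) + q * (w.2 - z.2))| <= eps * `|w - z|.
Proof.
move=> [df ddf] e0.
have /diff_locallyP[_ /eqaddoP /(_ eps e0)] := df.
move=> /nbhs_ballP[r /= r0 H]; apply/nbhs_ballP; exists r => // w wz.
have := H (w - z); rewrite ddf /= !fctE /= subrK opprD addrA; apply.
by move: wz; rewrite -!ball_normE /= sub0r normrN distrC.
Qed.

(** Near z the function behaves like its differential, a similarity that
    vanishes only at z. *)
Lemma simple_zero_isolated a b z (d e : R) : holo a b z d e ->
  a z = 0 -> b z = 0 -> 0 < d ^+ 2 + e ^+ 2 ->
  \forall w \near z, a w = 0 -> b w = 0 -> w = z.
Proof.
move=> [da db] az bz de0; pose n := `|d| + `|e| + 1.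
have n0 : 0 < n by rewrite /n ltr_wpDl// addr_ge0.
(* the error is then at most half of the differential *)
pose eps := (d ^+ 2 + e ^+ 2) / (2 * n).
have e0 : 0 < eps by rewrite divr_gt0// mulr_gt0.
near=> w => aw bw.
have : `|a w - a z - (d * (w.1 - z.1) + (- e) * (w.2 - z.2))| <= eps * `|w - z|.
  by near: w; exact: has_grad_approx.
have : `|b w - b z - (e * (w.1 - z.1) + d * (w.2 - z.2))| <= eps * `|w - z|.
  by near: w; exact: has_grad_approx.
rewrite aw bw az bz !subr0 !sub0r !normrN => h2 h1.
set v1 := w.1 - z.1 in h1 h2 *; set v2 := w.2 - z.2 in h1 h2 *.
have b1 : (d ^+ 2 + e ^+ 2) * `|v1| <= n * (eps * `|w - z|).
  have -> : (d ^+ 2 + e ^+ 2) * `|v1| =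
      `|d * (d * v1 + - e * v2) + e * (e * v1 + d * v2)|.
    by rewrite -[X in X * _](ger0_norm (ltW de0)) -normrM; congr (`|_|); ring.
  apply: (le_trans (ler_normD _ _)); rewrite !normrM.
  have := ler_wpM2l (normr_ge0 d) h1; have := ler_wpM2l (normr_ge0 e) h2.
  have : 0 <= eps * `|w - z| by rewrite mulr_ge0// ltW.
  rewrite /n; nra.
have b2 : (d ^+ 2 + e ^+ 2) * `|v2| <= n * (eps * `|w - z|).
  have -> : (d ^+ 2 + e ^+ 2) * `|v2| =
      `|d * (e * v1 + d * v2) - e * (d * v1 + - e * v2)|.
    by rewrite -[X in X * _](ger0_norm (ltW de0)) -normrM; congr (`|_|); ring.
  apply: (le_trans (ler_normB _ _)); rewrite !normrM.
  have := ler_wpM2l (normr_ge0 d) h2; have := ler_wpM2l (normr_ge0 e) h1.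
  have : 0 <= eps * `|w - z| by rewrite mulr_ge0// ltW.
  rewrite /n; nra.
have en : n * (eps * `|w - z|) = (d ^+ 2 + e ^+ 2) * (`|w - z| / 2).
  by rewrite /eps; field; rewrite gt_eqF.
rewrite en !(ler_pM2l de0) in b1 b2.
apply/eqP; rewrite -subr_eq0 -normr_eq0 eq_le normr_ge0 andbT.
have : `|w - z| <= `|w - z| / 2 by rewrite [leLHS]prod_normE ge_max b1 b2.
by have := normr_ge0 (w - z); lra.
Unshelve. all: by end_near. Qed.

(** Each simple zero is the only zero in some box with rational vertices, so
    there are countably many of them. *)
Lemma simple_zeros_null a b d e : (forall z, holo a b z (d z) (e z)) ->
  {ae lebesgue2, forall z, a z = 0 -> b z = 0 -> d z ^+ 2 + e z ^+ 2 = 0}.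
Proof.
move=> H.
pose Z := [set z | [/\ a z = 0, b z = 0 & 0 < d z ^+ 2 + e z ^+ 2]].
pose lone n z := [/\ Z z, rat_open_box n z &
  forall w, rat_open_box n w -> a w = 0 -> b w = 0 -> w = z].
have single n : {ae lebesgue2, forall z, ~ lone n z}.
  have [[z0 lz0]|nl] := pselect (exists z, lone n z); last first.
    by apply: ae_all => z lz; apply: nl; exists z.
  exists [set z0]; split; [exact: measurable_point|exact: lebesgue2_point|].
  move=> z /= /contrapT [[az bz _] bz' _].
  by case: lz0 => _ _; apply.
have : {ae lebesgue2, forall z, forall n, ~ lone n z} by exact: ae_foralln.
apply: ae_mono => z nl az bz; apply/eqP; rewrite eq_le addr_ge0 ?sqr_ge0// andbT.
rewrite leNgt; apply/negP => de0.
have iso := simple_zero_isolated (H z) az bz de0.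
have Uz : interior [set w | a w = 0 -> b w = 0 -> w = z] z by exact: iso.
have [n [nz nU]] := open_rat_box (open_interior _) Uz.
apply: (nl n); split=> // w nw.
by apply: (interior_subset (nU w _)); exact: subset_open_closed_box.
Qed.

End SimpleZeros.

(** * The modulus of a Gabor transform and its gradient *)

Section ModulusGradient.
Context {R : realType}.
Implicit Types (z w : R * R) (a b d e : R * R -> R).

Lemma has_grad_near_eq (f g : R * R -> R) z p q :
  (\forall w \near z, f w = g w) -> has_grad f z p q -> has_grad g z p q.
Proof.
move=> fg [df ddf]; have fgz := nbhs_singleton fg.
have fg0 : \forall v \near (0 : (R * R)%type), f (v + z) = g (v + z).
  move/nbhs_ballP: fg => [r /= r0 H]; apply/nbhs_ballP; exists r => // v rv.
  by apply: H; move: rv; rewrite -!ball_normE /= sub0r normrN opprD addrCA subrr addr0 normrN.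
have Hg : forall e : R, 0 < e -> \forall v \near (0 : (R * R)%type),
    `|g (v + z) - (g z + 'd f z v)| <= e * `|v|.
  move=> e e0; have /diff_locallyP[_ /eqaddoP /(_ e e0) H] := df.
  near=> v; rewrite -fgz -(near fg0 v) //.
  by near: v; exact: H.
have dg : 'd g z = 'd f z :> (R * R -> R).
  by apply: diff_unique; [exact: diff_continuous|apply/eqaddoP => e e0; exact: Hg].
split; last by rewrite dg.
apply/diff_locallyP; split; rewrite dg; first exact: diff_continuous.
by apply/eqaddoP => e e0; exact: Hg.
Unshelve. all: by end_near. Qed.

Lemma has_grad_abs a b z (d e : R) : holo a b z d e -> 0 < a z ^+ 2 + b z ^+ 2 ->
  let m := Num.sqrt (a z ^+ 2 + b z ^+ 2) in
  has_grad (fun w => Num.sqrt (a w ^+ 2 + b w ^+ 2)) z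
    ((a z * d + b z * e) / m) ((b z * d - a z * e) / m).
Proof.
move=> [da db] n0 m; have m0 : m != 0 by rewrite gt_eqF// sqrtr_gt0.
have dn : has_grad (fun w => a w ^+ 2 + b w ^+ 2) z
    (2 * (a z * d + b z * e)) (2 * (b z * d - a z * e)).
  under [X in has_grad X]eq_fun do rewrite !expr2.
  by apply: (has_grad_eq (has_gradD (has_gradM da da) (has_gradM db db))); ring.
have ds : is_derive (a z ^+ 2 + b z ^+ 2) 1 Num.sqrt (2 * m)^-1 by exact: is_derive1_sqrt.
by apply: (has_grad_eq (has_grad_comp dn ds)); field.
Qed.

Definition gauss_weight z : R := expR (- (pi * z.1 ^+ 2)).
(** The modulus of the Gabor transform with entire part a + i b. *)
Definition gauss_abs a b z : R := gauss_weight z * Num.sqrt (a z ^+ 2 + b z ^+ 2).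
(** The gradient of the modulus, for a + i b with complex derivative d + i e. *)
Definition gauss_abs_dx a b d e z : R :=
  gauss_weight z * ((a z * d z + b z * e z) / Num.sqrt (a z ^+ 2 + b z ^+ 2)) -
  2 * pi * z.1 * gauss_abs a b z.
Definition gauss_abs_dy a b d e z : R :=
  gauss_weight z * ((b z * d z - a z * e z) / Num.sqrt (a z ^+ 2 + b z ^+ 2)).

Lemma has_grad_gauss_weight z : has_grad gauss_weight z (- (2 * pi * z.1) * gauss_weight z) 0.
Proof.
have d1 : has_grad (fun w : R * R => - (pi * w.1 ^+ 2)) z (- (2 * pi * z.1)) 0.
  have := has_gradN (has_gradM (has_grad_cst pi z) (has_gradM (has_grad_fst z) (has_grad_fst z))).
  under [X in has_grad X]eq_fun do rewrite /cst -expr2.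
  by move=> H; apply: (has_grad_eq H); rewrite /cst; ring.
apply: (has_grad_eq (has_grad_comp d1 (is_derive_expR _))); rewrite /gauss_weight; ring.
Qed.

Lemma has_grad_gauss_abs a b d e z : holo a b z (d z) (e z) -> 0 < a z ^+ 2 + b z ^+ 2 ->
  has_grad (gauss_abs a b) z (gauss_abs_dx a b d e z) (gauss_abs_dy a b d e z).
Proof.
move=> H n0; apply: (has_grad_eq (has_gradM (has_grad_gauss_weight z) (has_grad_abs H n0)));
  rewrite /gauss_abs_dx /gauss_abs_dy /gauss_abs; ring.
Qed.

Lemma gauss_weight_gt0 z : 0 < gauss_weight z. Proof. exact: expR_gt0. Qed.

Lemma continuous_gauss_weight : continuous gauss_weight.
Proof. by move=> z; apply: has_grad_continuous (has_grad_gauss_weight z). Qed.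

Lemma continuous_div (f g : R * R -> R) z : {for z, continuous f} -> {for z, continuous g} ->
  g z != 0 -> {for z, continuous (fun w => f w / g w)}.
Proof.
move=> cf cg g0; apply: (@continuousM _ _ f (fun w => (g w)^-1)) => //.
exact: (@cvgV _ _ _ _ g).
Qed.

Lemma continuous_gauss_abs_grad a b d e z : holo a b z (d z) (e z) -> 0 < a z ^+ 2 + b z ^+ 2 ->
  {for z, continuous d} -> {for z, continuous e} ->
  {for z, continuous (gauss_abs_dx a b d e)} /\ {for z, continuous (gauss_abs_dy a b d e)}.
Proof.
move=> H n0 cd ce.
have ca : {for z, continuous a} by exact: has_grad_continuous H.1.
have cb : {for z, continuous b} by exact: has_grad_continuous H.2.
have cm : {for z, continuous (fun w => Num.sqrt (a w ^+ 2 + b w ^+ 2))}.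
  exact: has_grad_continuous (has_grad_abs H n0).
have m0 : Num.sqrt (a z ^+ 2 + b z ^+ 2) != 0 by rewrite gt_eqF// sqrtr_gt0.
have cg := @continuous_gauss_weight z.
split; rewrite /gauss_abs_dx /gauss_abs_dy.
  apply: continuous_sub; first by apply: continuous_mul => //;
    apply: continuous_div => //; apply: continuous_add; apply: continuous_mul.
  apply: continuous_mul; last exact: continuous_mul.
  by apply: continuous_mul; [exact: cvg_cst|exact: cvg_fst].
by apply: continuous_mul => //; apply: continuous_div => //;
  apply: continuous_sub; apply: continuous_mul.
Qed.

End ModulusGradient.

(** * The quotient of two entire functions *)

(** Here (p, q) is the gradient of m = |h|, and (P, Q) that of N = |F1|. By the
    product rule for N m = |F2|, the vector N (p, q) is (1 - m) (P, Q) minus the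
    gradient of N - N m. *)
Lemma quotient_gradient_bound (R : realFieldType) (p q m N P Q delta Delta : R) :
  0 < delta -> delta <= N -> P ^+ 2 + Q ^+ 2 <= Delta ^+ 2 ->
  p ^+ 2 + q ^+ 2 <=
  2 * (((P - (N * p + P * m)) ^+ 2 + (Q - (N * q + Q * m)) ^+ 2) / delta ^+ 2 +
       (N - N * m) ^+ 2 * (Delta ^+ 2 / delta ^+ 4)).
Proof.
move=> d0 dN PQ; have N0 : 0 < N by exact: lt_le_trans dN.
have d2 : delta ^+ 2 <= N ^+ 2 by rewrite ler_sqr ?nnegrE// ltW.
set S := p ^+ 2 + q ^+ 2; set W := (_ ^+ 2 + _ ^+ 2); pose t := 1 - m.
have S0 : 0 <= S by rewrite addr_ge0 ?sqr_ge0.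
have W0 : 0 <= W by rewrite addr_ge0 ?sqr_ge0.
have h1 : N ^+ 2 * S <= 2 * (W + t ^+ 2 * (P ^+ 2 + Q ^+ 2)).
  rewrite -subr_ge0.
  have -> : 2 * (W + t ^+ 2 * (P ^+ 2 + Q ^+ 2)) - N ^+ 2 * S =
    (P * t + (P - (N * p + P * m))) ^+ 2 + (Q * t + (Q - (N * q + Q * m))) ^+ 2.
    by rewrite /W /S /t; ring.
  by rewrite addr_ge0 ?sqr_ge0.
have h2 : N ^+ 2 * S <= 2 * (W + t ^+ 2 * Delta ^+ 2).
  by apply: (le_trans h1); rewrite ler_pM2l// lerD2l ler_wpM2l ?sqr_ge0.
have h3 : delta ^+ 2 * S <= N ^+ 2 * S by rewrite ler_wpM2r.
have h4 : delta ^+ 2 * (delta ^+ 2 * S) <= delta ^+ 2 * (2 * (W + t ^+ 2 * Delta ^+ 2)).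
  by rewrite ler_wpM2l ?sqr_ge0// (le_trans h3).
have h5 : delta ^+ 2 * (t ^+ 2 * Delta ^+ 2) <= N ^+ 2 * (t ^+ 2 * Delta ^+ 2).
  by rewrite ler_wpM2r// mulr_ge0 ?sqr_ge0.
have d4 : 0 < delta ^+ 4 by rewrite exprn_gt0.
rewrite -(ler_pM2l d4).
have -> : delta ^+ 4 * (2 * (W / delta ^+ 2 + (N - N * m) ^+ 2 * (Delta ^+ 2 / delta ^+ 4))) =
    2 * (delta ^+ 2 * W + N ^+ 2 * (t ^+ 2 * Delta ^+ 2)).
  by rewrite /t; field; rewrite gt_eqF.
have -> : delta ^+ 4 * S = delta ^+ 2 * (delta ^+ 2 * S) by ring.
by apply: (le_trans h4); move: h5; rewrite !mulrDr; lra.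
Qed.

Section Quotient.
Context {R : realType}.
Implicit Types (z w : R * R).
Variables (a1 b1 d1 e1 a2 b2 d2 e2 : R * R -> R).
Hypothesis H1 : forall z, holo a1 b1 z (d1 z) (e1 z).
Hypothesis H2 : forall z, holo a2 b2 z (d2 z) (e2 z).

Let n1 z := a1 z ^+ 2 + b1 z ^+ 2.

(** The quotient E2 / E1 = E2 conj (E1) / |E1|^2 for E_i = a_i + i b_i. *)
Definition quo_re z : R := (a2 z * a1 z + b2 z * b1 z) / n1 z.
Definition quo_im z : R := (b2 z * a1 z - a2 z * b1 z) / n1 z.

(** Numerator of the derivative of h = E2 / E1 in the form (E2' - h E1') / E1;
    it vanishes where E2 and E2' do. *)
Definition quo_num_re z : R := d2 z - (quo_re z * d1 z - quo_im z * e1 z).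
Definition quo_num_im z : R := e2 z - (quo_re z * e1 z + quo_im z * d1 z).
Definition dquo_re z : R := (quo_num_re z * a1 z + quo_num_im z * b1 z) / n1 z.
Definition dquo_im z : R := (quo_num_im z * a1 z - quo_num_re z * b1 z) / n1 z.

Lemma holo_quo z : 0 < n1 z -> holo quo_re quo_im z (dquo_re z) (dquo_im z).
Proof.
move=> n0; have n0' : a1 z ^+ 2 + b1 z ^+ 2 != 0 by rewrite gt_eqF.
have [h1 h2] := holoM (H2 z) (holoV n0' (H1 z)).
split.
  have -> : quo_re = fun w => a2 w * (a1 w * (a1 w ^+ 2 + b1 w ^+ 2)^-1) -
      b2 w * (- b1 w * (a1 w ^+ 2 + b1 w ^+ 2)^-1).
    by apply/funext => w; rewrite /quo_re /n1; ring.
  by apply: (has_grad_eq h1); rewrite /dquo_re /dquo_im /quo_num_re /quo_num_im /quo_re /quo_im /n1; field.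
have -> : quo_im = fun w => a2 w * (- b1 w * (a1 w ^+ 2 + b1 w ^+ 2)^-1) +
      b2 w * (a1 w * (a1 w ^+ 2 + b1 w ^+ 2)^-1).
  by apply/funext => w; rewrite /quo_im /n1; ring.
by apply: (has_grad_eq h2); rewrite /dquo_re /dquo_im /quo_num_re /quo_num_im /quo_re /quo_im /n1; field.
Qed.

Lemma quo_mul z : 0 < n1 z ->
  quo_re z * a1 z - quo_im z * b1 z = a2 z /\
  quo_re z * b1 z + quo_im z * a1 z = b2 z.
Proof.
move=> n0; have : n1 z != 0 by rewrite gt_eqF.
by rewrite /quo_re /quo_im /n1 => n0'; split; field.
Qed.

Lemma sqr_quo z : 0 < n1 z ->
  quo_re z ^+ 2 + quo_im z ^+ 2 = (a2 z ^+ 2 + b2 z ^+ 2) / n1 z.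
Proof.
move=> n0; have : n1 z != 0 by rewrite gt_eqF.
by rewrite /quo_re /quo_im /n1 => n0'; field.
Qed.

Lemma gauss_abs_quo z : 0 < n1 z ->
  gauss_abs a2 b2 z = gauss_abs a1 b1 z * Num.sqrt (quo_re z ^+ 2 + quo_im z ^+ 2).
Proof.
move=> n0; rewrite sqr_quo// /gauss_abs -mulrA -sqrtrM ?ltW//.
by congr (_ * Num.sqrt _); rewrite -/(n1 z) mulrC divfK ?gt_eqF.
Qed.

Lemma near_nonzero (a b : R * R -> R) z : {for z, continuous a} -> {for z, continuous b} ->
  0 < a z ^+ 2 + b z ^+ 2 -> \forall w \near z, 0 < a w ^+ 2 + b w ^+ 2 :> R.
Proof.
move=> ca cb n0.
have cn : {for z, continuous (fun w : R * R => a w ^+ 2 + b w ^+ 2)}.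
  by apply: (@continuousD _ _ _ (fun w => a w ^+ 2) (fun w => b w ^+ 2)); exact: continuous_sqr.
by apply: (@cvgr_gt _ _ _ _ _ _ cn).
Qed.

Lemma continuous_dquo z : 0 < n1 z ->
  {for z, continuous d1} -> {for z, continuous e1} ->
  {for z, continuous d2} -> {for z, continuous e2} ->
  {for z, continuous dquo_re} /\ {for z, continuous dquo_im}.
Proof.
move=> n0 cd1 ce1 cd2 ce2.
have ca : {for z, continuous a1} by exact: has_grad_continuous (H1 z).1.
have cb : {for z, continuous b1} by exact: has_grad_continuous (H1 z).2.
have [hq1 hq2] := holo_quo n0.
have cp : {for z, continuous quo_re} by exact: has_grad_continuous hq1.
have cq : {for z, continuous quo_im} by exact: has_grad_continuous hq2.
have cnum1 : {for z, continuous quo_num_re}.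
  by rewrite /quo_num_re; apply: continuous_sub => //; apply: continuous_sub; apply: continuous_mul.
have cnum2 : {for z, continuous quo_num_im}.
  by rewrite /quo_num_im; apply: continuous_sub => //; apply: continuous_add; apply: continuous_mul.
have cn : {for z, continuous n1}.
  by rewrite /n1; apply: continuous_add; exact: continuous_sqr.
have n0' : n1 z != 0 by rewrite gt_eqF.
split; rewrite /dquo_re /dquo_im; apply: continuous_div => //.
  by apply: continuous_add; apply: continuous_mul.
by apply: continuous_sub; apply: continuous_mul.
Qed.

Lemma dquo_eq0 z : a2 z = 0 -> b2 z = 0 -> d2 z = 0 -> e2 z = 0 ->
  dquo_re z = 0 /\ dquo_im z = 0.
Proof.
move=> az bz dz ez; have p0 : quo_re z = 0 by rewrite /quo_re az bz !mul0r addr0 mul0r.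
have q0 : quo_im z = 0 by rewrite /quo_im az bz !mul0r subr0 mul0r.
by split; rewrite /dquo_re /dquo_im /quo_num_re /quo_num_im p0 q0 dz ez; ring.
Qed.

(** The modulus of h' is the length of the gradient of |h|, and |h| is the
    quotient of the two weighted moduli. *)
Lemma sqr_dquo_le z (delta Delta : R) :
  0 < delta -> delta <= gauss_abs a1 b1 z ->
  gauss_abs_dx a1 b1 d1 e1 z ^+ 2 + gauss_abs_dy a1 b1 d1 e1 z ^+ 2 <= Delta ^+ 2 ->
  0 < a2 z ^+ 2 + b2 z ^+ 2 ->
  dquo_re z ^+ 2 + dquo_im z ^+ 2 <=
  2 * (((gauss_abs_dx a1 b1 d1 e1 z - gauss_abs_dx a2 b2 d2 e2 z) ^+ 2 +
        (gauss_abs_dy a1 b1 d1 e1 z - gauss_abs_dy a2 b2 d2 e2 z) ^+ 2) / delta ^+ 2 +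
       (gauss_abs a1 b1 z - gauss_abs a2 b2 z) ^+ 2 * (Delta ^+ 2 / delta ^+ 4)).
Proof.
move=> de0 deN NDe n20.
have n0 : 0 < n1 z.
  have : 0 < gauss_abs a1 b1 z by exact: lt_le_trans deN.
  by rewrite /gauss_abs pmulr_rgt0 ?gauss_weight_gt0// sqrtr_gt0.
have q0 : 0 < quo_re z ^+ 2 + quo_im z ^+ 2 by rewrite sqr_quo// divr_gt0.
have gh := has_grad_abs (holo_quo n0) q0; cbv zeta in gh.
have gN1 := has_grad_gauss_abs (H1 z) n0; have gN2 := has_grad_gauss_abs (H2 z) n20.
have /has_grad_partial[E1 E2] := gN2.
set m := Num.sqrt _ in gh.
set p' := (_ / m) in gh; set q' := ((quo_im z * _ - _) / m) in gh.
have near_n1 : \forall w \near z, 0 < n1 w.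
  by apply: near_nonzero => //; [exact: has_grad_continuous (H1 z).1|exact: has_grad_continuous (H1 z).2].
have gN2' := has_grad_near_eq _ (has_gradM gN1 gh).
have : \forall w \near z, gauss_abs a1 b1 w * Num.sqrt (quo_re w ^+ 2 + quo_im w ^+ 2) = gauss_abs a2 b2 w.
  by near=> w; apply/esym/gauss_abs_quo; near: w.
move=> /gN2' /has_grad_partial; rewrite E1 E2.
set N1 := gauss_abs a1 b1 z in deN *.
rewrite (gauss_abs_quo n0) -/m -/N1 => -[-> ->].
set P1 := gauss_abs_dx _ _ _ _ _ in NDe *; set Q1 := gauss_abs_dy _ _ _ _ _ in NDe *.
have m0 : m != 0 by rewrite gt_eqF// sqrtr_gt0.
have m2 : m ^+ 2 = quo_re z ^+ 2 + quo_im z ^+ 2 by rewrite sqr_sqrtr// ltW.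
have -> : dquo_re z ^+ 2 + dquo_im z ^+ 2 = p' ^+ 2 + q' ^+ 2.
  have m20 : m ^+ 2 != 0 by rewrite expf_neq0.
  have -> : p' ^+ 2 + q' ^+ 2 = (quo_re z ^+ 2 + quo_im z ^+ 2) *
      (dquo_re z ^+ 2 + dquo_im z ^+ 2) / m ^+ 2 by rewrite /p' /q'; field.
  by rewrite -m2 mulrAC divff// mul1r.
exact: quotient_gradient_bound.
Unshelve. all: by end_near. Qed.

End Quotient.

(** * Choice of the phase *)

Section Alignment.
Context {R : realType}.

Lemma phase_exists (c1 c2 : R) : exists al : R,
  c1 = Num.sqrt (c1 ^+ 2 + c2 ^+ 2) * cos al /\
  c2 = Num.sqrt (c1 ^+ 2 + c2 ^+ 2) * sin al.
Proof.
have dE : dist2 (0, 0) (c1, c2) = Num.sqrt (c1 ^+ 2 + c2 ^+ 2) by rewrite /dist2 /= !subr0.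
set m := Num.sqrt _ in dE *.
have : 0 <= m by exact: sqrtr_ge0.
rewrite le_eqVlt => /orP[/eqP m0|m0].
  have : m == 0 by rewrite -m0.
  rewrite sqrtr_eq0 => n0; have : c1 ^+ 2 + c2 ^+ 2 == 0.
    by rewrite eq_le n0 addr_ge0 ?sqr_ge0.
  rewrite paddr_eq0 ?sqr_ge0// !sqrf_eq0 => /andP[/eqP-> /eqP->].
  by exists 0; rewrite -m0 !mul0r.
rewrite -dE in m0; have [al [_]] := polar_exists m0.
rewrite /polar /= !add0r lnK ?posrE// dE => -[h1 h2].
by exists al.
Qed.

(** The argument of the constant c close to h also serves for h: the distance
    from h to e^(i al) is at most |h - c| + ||c| - |h|| + ||h| - 1|, and the
    middle term is at most |h - c|. *)
Lemma phase_alignment (p q c1 c2 al m : R) :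
  let rh := Num.sqrt (c1 ^+ 2 + c2 ^+ 2) in
  c1 = rh * cos al -> c2 = rh * sin al -> m = Num.sqrt (p ^+ 2 + q ^+ 2) ->
  (cos al - p) ^+ 2 + (sin al - q) ^+ 2 <=
  6 * ((p - c1) ^+ 2 + (q - c2) ^+ 2) + 4 * (1 - m) ^+ 2.
Proof.
move=> rh h1 h2 mE; have := cos2Dsin2 al.
have rh0 : 0 <= rh by exact: sqrtr_ge0.
have m0 : 0 <= m by rewrite mE sqrtr_ge0.
have m2 : m ^+ 2 = p ^+ 2 + q ^+ 2 by rewrite mE sqr_sqrtr// addr_ge0 ?sqr_ge0.
set c := cos al in h1 *; set s := sin al in h2 * => cs.
have CS : p * c + q * s <= m.
  apply: (le_trans (ler_norm _)); rewrite -(@ler_sqr _ `|_|) ?nnegrE// real_normK ?num_real//.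
  rewrite m2 -subr_ge0 (_ : _ - _ = (p * s - q * c) ^+ 2) ?sqr_ge0//.
  by rewrite -[p ^+ 2 + q ^+ 2]mulr1 -cs; ring.
have k1 : (rh - m) ^+ 2 <= (p - c1) ^+ 2 + (q - c2) ^+ 2.
  rewrite h1 h2 -subr_ge0 (_ : _ - _ = 2 * rh * (m - (p * c + q * s))).
    by rewrite mulr_ge0 ?mulr_ge0// subr_ge0.
  have -> : (rh - m) ^+ 2 = rh ^+ 2 - 2 * rh * m + (p ^+ 2 + q ^+ 2) by rewrite -m2; ring.
  by transitivity (rh ^+ 2 * (c ^+ 2 + s ^+ 2) - rh ^+ 2 + 2 * rh * (m - (p * c + q * s))); [ring|rewrite cs mulr1 subrr add0r].
have k2 : (c - p) ^+ 2 + (s - q) ^+ 2 <= 2 * ((p - c1) ^+ 2 + (q - c2) ^+ 2) + 2 * (rh - 1) ^+ 2.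
  have -> : (rh - 1) ^+ 2 = (rh - 1) ^+ 2 * (c ^+ 2 + s ^+ 2) by rewrite cs mulr1.
  rewrite -subr_ge0.
  rewrite (_ : _ - _ = (c - c1 + p - c1) ^+ 2 + (s - c2 + q - c2) ^+ 2) ?addr_ge0 ?sqr_ge0//.
  by rewrite h1 h2; ring.
have k3 : (rh - 1) ^+ 2 <= 2 * (rh - m) ^+ 2 + 2 * (1 - m) ^+ 2.
  rewrite -subr_ge0 (_ : _ - _ = (rh - m - (m - 1)) ^+ 2) ?sqr_ge0//; ring.
by lra.
Qed.

End Alignment.

(** * The hole, with the weight of the Gabor transform *)

Section WeightedHole.
Context {R : realType}.
Variables (z0 : R * R) (A B d e : R * R -> R).
Hypothesis dH : forall z, holo A B z (d z) (e z).
Hypothesis cd : continuous d.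
Hypothesis ce : continuous e.

Let X z := - (pi * (z0.1 ^+ 2 + 2 * z0.1 * (z.1 - z0.1) +
  ((z.1 - z0.1) ^+ 2 - (z.2 - z0.2) ^+ 2) / 2)).
Let Y z := - (pi * (2 * z0.1 * (z.2 - z0.2) + (z.1 - z0.1) * (z.2 - z0.2))).
Let Mre z := expR (X z) * cos (Y z).
Let Mim z := expR (X z) * sin (Y z).
Let fre (z : R * R) := - (pi * (2 * z0.1 + (z.1 - z0.1))).
Let fim (z : R * R) := - (pi * (z.2 - z0.2)).

Let holo_fre_fim z : holo fre fim z (- pi) 0.
Proof.
have g1 := has_gradB (has_grad_fst z) (has_grad_cst z0.1 z).
have g2 := has_gradB (has_grad_snd z) (has_grad_cst z0.2 z).
split.
  apply: (has_grad_eq (has_gradN (has_gradM (has_grad_cst pi z)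
    (has_gradD (has_grad_cst (2 * z0.1) z) g1)))); rewrite /cst; ring.
by apply: (has_grad_eq (has_gradN (has_gradM (has_grad_cst pi z) g2))); rewrite /cst; ring.
Qed.

Let holoXY z : holo X Y z (fre z) (fim z).
Proof.
have g1 := has_gradB (has_grad_fst z) (has_grad_cst z0.1 z).
have g2 := has_gradB (has_grad_snd z) (has_grad_cst z0.2 z).
split.
  have -> : X = fun z => pi * (- z0.1 ^+ 2 + (- 2 * z0.1) * (z.1 - z0.1)
     + (- 2^-1) * ((z.1 - z0.1) * (z.1 - z0.1) - (z.2 - z0.2) * (z.2 - z0.2))).
    by apply/funext => w; rewrite /X; field.
  apply: (has_grad_eq (has_gradM (has_grad_cst pi z) (has_gradD
    (has_gradD (has_grad_cst (- z0.1 ^+ 2) z) (has_gradM (has_grad_cst (- 2 * z0.1) z) g1))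
    (has_gradM (has_grad_cst (- 2^-1) z) (has_gradB (has_gradM g1 g1) (has_gradM g2 g2))))));
  by rewrite /fre /fim /cst; field.
have -> : Y = fun z => (- pi) * (2 * z0.1 * (z.2 - z0.2) + (z.1 - z0.1) * (z.2 - z0.2)).
  by apply/funext => w; rewrite /Y; ring.
apply: (has_grad_eq (has_gradM (has_grad_cst (- pi) z)
  (has_gradD (has_gradM (has_grad_cst (2 * z0.1) z) g2) (has_gradM g1 g2))));
by rewrite /fre /fim /cst; ring.
Qed.

Let holoM' z : holo Mre Mim z (Mre z * fre z - Mim z * fim z) (Mre z * fim z + Mim z * fre z).
Proof.
have [dX dY] := holoXY z.
have eX := has_grad_comp dX (is_derive_expR (X z)).
have cY := has_grad_comp dY (is_derive_cos (Y z)).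
have sY := has_grad_comp dY (is_derive_sin (Y z)).
split; [apply: (has_grad_eq (has_gradM eX cY))|apply: (has_grad_eq (has_gradM eX sY))];
  rewrite /Mre /Mim; ring.
Qed.

(** The weight exp (- pi x^2) is centred on a line instead of at z0. With
    eta = z - z0, it equals |M(z)| exp (- pi |eta|^2 / 2) for the entire
    function M(z) = exp (- pi (x0^2 + 2 x0 eta + eta^2 / 2)), and
    [hole_estimate] applies to (A + i B) M. *)
Lemma weighted_hole_estimate r s : 0 <= r -> r < s ->
  (\int[lebesgue2]_(w in closed_disc z0 r) (gauss_weight w ^+ 2 * (A w ^+ 2 + B w ^+ 2))%:E <=
   (hole_const r s)%:E *
   \int[lebesgue2]_(w in annulus z0 r s) (gauss_weight w ^+ 2 * (A w ^+ 2 + B w ^+ 2))%:E)%E.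
Proof.
move=> r0 rs.
have cM (f g : R * R -> R) : continuous f -> continuous g ->
    continuous (fun w => f w * g w).
  by move=> cf cg z; exact: continuous_mul (@cf z) (@cg z).
have cD (f g : R * R -> R) : continuous f -> continuous g ->
    continuous (fun w => f w + g w).
  by move=> cf cg z; exact: continuous_add (@cf z) (@cg z).
have cB (f g : R * R -> R) : continuous f -> continuous g ->
    continuous (fun w => f w - g w).
  by move=> cf cg z; exact: continuous_sub (@cf z) (@cg z).
have cA : continuous A by move=> z; exact: has_grad_continuous (dH z).1.
have cb : continuous B by move=> z; exact: has_grad_continuous (dH z).2.
have c1 : continuous Mre by move=> z; exact: has_grad_continuous (holoM' z).1.
have c2 : continuous Mim by move=> z; exact: has_grad_continuous (holoM' z).2.
have cfi : continuous fim by move=> z; exact: has_grad_continuous (holo_fre_fim z).2.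
have cfr : continuous fre by move=> z; exact: has_grad_continuous (holo_fre_fim z).1.
have H z := holoM (dH z) (holoM' z).
have := @hole_estimate R z0 _ _ _ _ H _ _ r s r0 rs.
have E w : (A w * Mre w - B w * Mim w) ^+ 2 + (A w * Mim w + B w * Mre w) ^+ 2 =
   (A w ^+ 2 + B w ^+ 2) * expR (2 * X w).
  have -> : expR (2 * X w) = expR (X w) ^+ 2 * (cos (Y w) ^+ 2 + sin (Y w) ^+ 2).
    by rewrite cos2Dsin2 mulr1 expr2 -expRD; congr expR; ring.
  by rewrite /Mre /Mim; ring.
have E2 w : ((A w * Mre w - B w * Mim w) ^+ 2 + (A w * Mim w + B w * Mre w) ^+ 2) *
    expR (- (pi * dist2 z0 w ^+ 2)) = gauss_weight w ^+ 2 * (A w ^+ 2 + B w ^+ 2).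
  rewrite E -mulrA -expRD mulrC /gauss_weight [in RHS]expr2 -expRD; congr (expR _ * _).
  by rewrite /dist2 sqr_sqrtr ?addr_ge0 ?sqr_ge0// /X; field.
under eq_integral do rewrite E2.
under [in X in (_ <= X)%E]eq_integral do rewrite E2.
apply.
- by apply: (cB); [apply: (cD); apply: (cM) => //; apply: (cB); apply: (cM)|
     apply: (cD); apply: (cM) => //; apply: (cD); apply: (cM)].
- by apply: (cD); [apply: (cD); apply: (cM) => //; apply: (cD); apply: (cM)|
     apply: (cD); apply: (cM) => //; apply: (cB); apply: (cM)].
Qed.

End WeightedHole.

(** * The estimate on an annulus *)

Section AnnulusEstimate.
Context {R : realType}.
Implicit Types (z w : R * R).

Lemma ae_integral_le_combination (A : set (R * R)) (f x y : R * R -> R) (k l : R) :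
  measurable A -> 0 <= k -> 0 <= l ->
  (forall z, 0 <= f z) -> (forall z, 0 <= x z) -> (forall z, 0 <= y z) ->
  measurable_fun A f -> measurable_fun A x -> measurable_fun A y ->
  {ae lebesgue2, forall z, A z -> f z <= k * x z + l * y z} ->
  (\int[lebesgue2]_(z in A) (f z)%:E <=
   k%:E * \int[lebesgue2]_(z in A) (x z)%:E + l%:E * \int[lebesgue2]_(z in A) (y z)%:E)%E.
Proof.
move=> mA k0 l0 f0 x0 y0 mf mx my H.
have mkx : measurable_fun A (fun z => k * x z) by exact: measurable_funM.
have mly : measurable_fun A (fun z => l * y z) by exact: measurable_funM.
rewrite -(ge0_integralZl_EFin lebesgue2 mA _ _ k0); last first.
- exact/measurable_EFinP.
- by move=> z _; rewrite lee_fin.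
rewrite -(ge0_integralZl_EFin lebesgue2 mA _ _ l0); last first.
- exact/measurable_EFinP.
- by move=> z _; rewrite lee_fin.
rewrite -(ge0_integralD lebesgue2 mA); last 4 first.
- by move=> z _; rewrite -EFinM lee_fin mulr_ge0.
- by apply/measurable_EFinP.
- by move=> z _; rewrite -EFinM lee_fin mulr_ge0.
- by apply/measurable_EFinP.
apply: (@ae_ge0_le_integral _ _ _ lebesgue2 A mA).
- by move=> z _; rewrite lee_fin.
- exact/measurable_EFinP.
- by move=> z _; rewrite -!EFinM -EFinD lee_fin addr_ge0// mulr_ge0.
- by apply/measurable_EFinP; exact: measurable_funD.
- by apply: (ae_mono _ H) => z h Az; rewrite -!EFinM -EFinD lee_fin h.
Qed.

Lemma continuous_gauss_abs (a b : R * R -> R) : continuous a -> continuous b -> continuous (gauss_abs a b).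
Proof.
move=> ca cb z; apply: (@continuousM _ _ gauss_weight (fun z => Num.sqrt (a z ^+ 2 + b z ^+ 2))).
  exact: continuous_gauss_weight.
apply: (@continuous_comp _ _ _ (fun z => a z ^+ 2 + b z ^+ 2) Num.sqrt); last exact: sqrt_continuous.
by apply: (@continuousD _ _ _ (fun z => a z ^+ 2)); apply: continuous_sqr; [exact: ca|exact: cb].
Qed.

Lemma sqr_gauss_abs (a b : R * R -> R) z : gauss_abs a b z ^+ 2 = gauss_weight z ^+ 2 * (a z ^+ 2 + b z ^+ 2).
Proof. by rewrite /gauss_abs exprMn sqr_sqrtr// addr_ge0 ?sqr_ge0. Qed.

Lemma gauss_abs_ge0 (a b : R * R -> R) z : 0 <= gauss_abs a b z.
Proof. by rewrite /gauss_abs mulr_ge0 ?sqrtr_ge0// ltW// gauss_weight_gt0. Qed.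

(** The pair encodes E1 - e^(-i al) E2. *)
Definition phase_diff_re (al : R) (a1 a2 b2 : R * R -> R) z : R :=
  a1 z + (- cos al * a2 z - sin al * b2 z).
Definition phase_diff_im (al : R) (b1 a2 b2 : R * R -> R) z : R :=
  b1 z + (sin al * a2 z + - cos al * b2 z).

Variables (a1 b1 d1 e1 a2 b2 d2 e2 : R * R -> R).
Hypothesis H1 : forall z, holo a1 b1 z (d1 z) (e1 z).
Hypothesis H2 : forall z, holo a2 b2 z (d2 z) (e2 z).
Hypothesis cd1 : continuous d1.
Hypothesis ce1 : continuous e1.
Hypothesis cd2 : continuous d2.
Hypothesis ce2 : continuous e2.

Lemma holo_phase_diff al z :
  holo (phase_diff_re al a1 a2 b2) (phase_diff_im al b1 a2 b2) z
    (d1 z + (- cos al * d2 z - sin al * e2 z)) (e1 z + (sin al * d2 z + - cos al * e2 z)).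
Proof. exact: holoD (H1 z) (holo_scale (- cos al) (sin al) (H2 z)). Qed.

Variables (z0 : R * R) (r s delta Delta : R) (w : R * R -> R * R).
Hypothesis r0 : 0 <= r.
Hypothesis rs : r < s.
Hypothesis de0 : 0 < delta.
Hypothesis deD : delta <= Delta.
Let D0 : 0 < Delta. Proof. exact: lt_le_trans deD. Qed.
Let A := annulus z0 r s.
Hypothesis N1d : forall z, A z -> delta <= gauss_abs a1 b1 z.
Hypothesis N1D : forall z, A z -> gauss_abs a1 b1 z <= Delta.
Hypothesis gN1 : forall z, A z ->
  gauss_abs_dx a1 b1 d1 e1 z ^+ 2 + gauss_abs_dy a1 b1 d1 e1 z ^+ 2 <= Delta ^+ 2.
Hypothesis mw1 : measurable_fun A (fst \o w).
Hypothesis mw2 : measurable_fun A (snd \o w).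
Let u z := gauss_abs a1 b1 z - gauss_abs a2 b2 z.
Hypothesis wE : {ae lebesgue2, forall z, A z -> 0 < a2 z ^+ 2 + b2 z ^+ 2 ->
  w z = (gauss_abs_dx a1 b1 d1 e1 z - gauss_abs_dx a2 b2 d2 e2 z,
         gauss_abs_dy a1 b1 d1 e1 z - gauss_abs_dy a2 b2 d2 e2 z)}.

Let kap0 : 0 <= 2 * Delta ^+ 2 / delta ^+ 4.
Proof. by apply: divr_ge0; [rewrite mulr_ge0 ?sqr_ge0|rewrite exprn_ge0// ltW]. Qed.

(** Where E2 = 0, either E2' = 0 and so h' = 0, or the zero is simple; and the
    simple zeros form a null set. *)
Lemma sqr_dquo_ae : {ae lebesgue2, forall z, A z ->
  dquo_re a1 b1 d1 e1 a2 b2 d2 e2 z ^+ 2 + dquo_im a1 b1 d1 e1 a2 b2 d2 e2 z ^+ 2 <=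
  2 * Delta ^+ 2 / delta ^+ 4 * u z ^+ 2 + 2 * Delta ^+ 2 / delta ^+ 4 * norm2 (w z) ^+ 2}.
Proof.
have d2D : delta ^+ 2 <= Delta ^+ 2.
  by rewrite ler_sqr ?nnegrE//; [exact: ltW|exact: ltW D0].
apply: (ae_mono _ (ae_and wE (simple_zeros_null H2))) => z [wz sz] Az.
have nw : norm2 (w z) ^+ 2 = (w z).1 ^+ 2 + (w z).2 ^+ 2.
  by rewrite /norm2 sqr_sqrtr// addr_ge0 ?sqr_ge0.
have : 0 <= a2 z ^+ 2 + b2 z ^+ 2 by rewrite addr_ge0 ?sqr_ge0.
rewrite le_eqVlt => /orP[|n20]; last first.
  apply: (le_trans (sqr_dquo_le H1 H2 de0 (N1d Az) (gN1 Az) n20)).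
  rewrite nw wz//=; set W := _ ^+ 2 + _ ^+ 2; rewrite -/(u z).
  have W0 : 0 <= W by rewrite addr_ge0 ?sqr_ge0.
  have k : W / delta ^+ 2 <= W * (Delta ^+ 2 / delta ^+ 4).
    rewrite ler_wpM2l// ler_pdivlMr ?exprn_gt0//.
    suff -> : (delta ^+ 2)^-1 * delta ^+ 4 = delta ^+ 2 by [].
    by field; rewrite gt_eqF.
  have -> : 2 * Delta ^+ 2 / delta ^+ 4 * u z ^+ 2 + 2 * Delta ^+ 2 / delta ^+ 4 * W =
     2 * (W * (Delta ^+ 2 / delta ^+ 4) + u z ^+ 2 * (Delta ^+ 2 / delta ^+ 4)) by ring.
  by rewrite ler_pM2l// lerD2r.
rewrite eq_sym paddr_eq0 ?sqr_ge0// !sqrf_eq0 => /andP[/eqP az /eqP bz].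
have := sz az bz => /eqP; rewrite paddr_eq0 ?sqr_ge0// !sqrf_eq0 => /andP[/eqP dz /eqP ez].
have [-> ->] := @dquo_eq0 R a1 b1 d1 e1 a2 b2 d2 e2 z az bz dz ez.
by rewrite expr0n /= addr0; apply: addr_ge0; apply: mulr_ge0; rewrite ?sqr_ge0.
Qed.

(** The left-hand side is |F1|^2 |e^(i al) - h|^2. *)
Lemma phase_diff_le (z : R * R) (c1 c2 al : R) : A z ->
  c1 = Num.sqrt (c1 ^+ 2 + c2 ^+ 2) * cos al ->
  c2 = Num.sqrt (c1 ^+ 2 + c2 ^+ 2) * sin al ->
  gauss_weight z ^+ 2 * (phase_diff_re al a1 a2 b2 z ^+ 2 + phase_diff_im al b1 a2 b2 z ^+ 2) <=
  6 * Delta ^+ 2 * ((quo_re a1 b1 a2 b2 z - c1) ^+ 2 + (quo_im a1 b1 a2 b2 z - c2) ^+ 2) +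
  4 * u z ^+ 2.
Proof.
move=> Az c1E c2E; have N0 : 0 < gauss_abs a1 b1 z by exact: lt_le_trans (N1d Az).
have n0 : 0 < a1 z ^+ 2 + b1 z ^+ 2.
  by move: N0; rewrite /gauss_abs pmulr_rgt0 ?gauss_weight_gt0// sqrtr_gt0.
have [pq1 pq2] := @quo_mul R a1 b1 a2 b2 z n0.
set p := quo_re _ _ _ _ z in pq1 pq2 *; set q := quo_im _ _ _ _ z in pq1 pq2 *.
have := phase_alignment c1E c2E (erefl (Num.sqrt (p ^+ 2 + q ^+ 2))).
set m := Num.sqrt (p ^+ 2 + q ^+ 2) => PA.
have -> : gauss_weight z ^+ 2 * (phase_diff_re al a1 a2 b2 z ^+ 2 + phase_diff_im al b1 a2 b2 z ^+ 2) =
   gauss_abs a1 b1 z ^+ 2 * ((cos al - p) ^+ 2 + (sin al - q) ^+ 2).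
  rewrite sqr_gauss_abs /phase_diff_re /phase_diff_im -pq1 -pq2 -mulrA; congr (_ * _).
  have -> : (cos al - p) ^+ 2 + (sin al - q) ^+ 2 =
    cos al ^+ 2 + sin al ^+ 2 - 2 * (p * cos al + q * sin al) + p ^+ 2 + q ^+ 2 by ring.
  have cs := cos2Dsin2 al; rewrite cs.
  transitivity (a1 z ^+ 2 + b1 z ^+ 2 + (p ^+ 2 + q ^+ 2) * (a1 z ^+ 2 + b1 z ^+ 2) * (cos al ^+ 2 + sin al ^+ 2)
     - 2 * (p * cos al + q * sin al) * (a1 z ^+ 2 + b1 z ^+ 2)); first by ring.
  by rewrite cs; ring.
have -> : u z = gauss_abs a1 b1 z * (1 - m).
  by rewrite /u (@gauss_abs_quo R a1 b1 a2 b2 z n0) -/p -/q -/m; ring.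
have ND : gauss_abs a1 b1 z ^+ 2 <= Delta ^+ 2.
  by rewrite ler_sqr ?nnegrE ?gauss_abs_ge0 ?N1D//; exact: ltW D0.
apply: (le_trans (ler_wpM2l (sqr_ge0 _) PA)).
set N := gauss_abs a1 b1 z in ND *; set S := _ ^+ 2 + _ ^+ 2.
have S0 : 0 <= S by rewrite addr_ge0 ?sqr_ge0.
have -> : N ^+ 2 * (6 * S + 4 * (1 - m) ^+ 2) = 6 * (N ^+ 2 * S) + 4 * (N * (1 - m)) ^+ 2 by ring.
by rewrite lerD2r -mulrA ler_pM2l// ler_wpM2r.
Qed.

(** The factor 96 is 6 * 2 * 2^2 * 2, from [phase_alignment], the Poincare
    constant 2 (2 pi s)^2 and [sqr_dquo_ae]. *)
Lemma annulus_estimate : exists al : R,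
  (\int[lebesgue2]_(z in A)
     (gauss_weight z ^+ 2 * (phase_diff_re al a1 a2 b2 z ^+ 2 + phase_diff_im al b1 a2 b2 z ^+ 2))%:E <=
   ((Delta ^+ 2 / delta ^+ 2) ^+ 2 * (96 * pi ^+ 2 * s ^+ 2 + 4))%:E *
   (\int[lebesgue2]_(z in A) (u z ^+ 2)%:E + \int[lebesgue2]_(z in A) (norm2 (w z) ^+ 2)%:E))%E.
Proof.
have s0 : 0 < s by exact: le_lt_trans rs.
have mA : measurable A := measurable_annulus z0 r s.
have n0 z : A z -> 0 < a1 z ^+ 2 + b1 z ^+ 2.
  move=> Az; have : 0 < gauss_abs a1 b1 z by exact: lt_le_trans (N1d Az).
  by rewrite /gauss_abs pmulr_rgt0 ?gauss_weight_gt0// sqrtr_gt0.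
have hq z (Az : A z) := holo_quo H1 H2 (n0 z Az).
have cdq z (Az : A z) := continuous_dquo H1 H2 (n0 z Az) (@cd1 z) (@ce1 z) (@cd2 z) (@ce2 z).
have [c1 [c2 HP]] := annulus_poincare r0 rs hq cdq.
have [al [c1E c2E]] := phase_exists c1 c2.
exists al.
have ca1 : continuous a1 by move=> z; exact: has_grad_continuous (H1 z).1.
have cb1 : continuous b1 by move=> z; exact: has_grad_continuous (H1 z).2.
have ca2 : continuous a2 by move=> z; exact: has_grad_continuous (H2 z).1.
have cb2 : continuous b2 by move=> z; exact: has_grad_continuous (H2 z).2.
have mc (f : R * R -> R) : (forall z, A z -> {for z, continuous f}) -> measurable_fun A f.
  by move=> cf; exact: continuous_at_measurable2.
have msq (f : R * R -> R) : measurable_fun A f -> measurable_fun A (fun z => f z ^+ 2).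
  by move=> mf; exact: measurable_funX.
have mss (f g : R * R -> R) : measurable_fun A f -> measurable_fun A g ->
    measurable_fun A (fun z => f z ^+ 2 + g z ^+ 2).
  by move=> mf mg; apply: measurable_funD; apply: msq.
have mu_ : measurable_fun A (fun z => u z ^+ 2).
  apply: (msq u); apply: measurable_funB; apply: mc => z _; exact: continuous_gauss_abs.
have mw : measurable_fun A (fun z => norm2 (w z) ^+ 2).
  have -> : (fun z => norm2 (w z) ^+ 2) = fun z => (fst \o w) z ^+ 2 + (snd \o w) z ^+ 2.
    by apply/funext => z; rewrite /norm2 sqr_sqrtr// addr_ge0 ?sqr_ge0.
  exact: (mss (fst \o w) (snd \o w)).
have mdq : measurable_fun A (fun z => dquo_re a1 b1 d1 e1 a2 b2 d2 e2 z ^+ 2 +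
    dquo_im a1 b1 d1 e1 a2 b2 d2 e2 z ^+ 2).
  by apply: mss; apply: mc => z Az; have [? ?] := cdq z Az.
have mq : measurable_fun A (fun z => (quo_re a1 b1 a2 b2 z - c1) ^+ 2 + (quo_im a1 b1 a2 b2 z - c2) ^+ 2).
  apply: (mss (fun z => quo_re a1 b1 a2 b2 z - c1) (fun z => quo_im a1 b1 a2 b2 z - c2)); apply: measurable_funB => //;
    apply: mc => z Az; [exact: has_grad_continuous (hq z Az).1|exact: has_grad_continuous (hq z Az).2].
have mG : measurable_fun A (fun z => gauss_weight z ^+ 2 *
    (phase_diff_re al a1 a2 b2 z ^+ 2 + phase_diff_im al b1 a2 b2 z ^+ 2)).
  apply: measurable_funM; first by apply: msq; apply: mc => z _; exact: continuous_gauss_weight.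
  apply: (mss (phase_diff_re al a1 a2 b2) (phase_diff_im al b1 a2 b2)); apply: mc => z _.
    exact: has_grad_continuous (holo_phase_diff al z).1.
  exact: has_grad_continuous (holo_phase_diff al z).2.
have ss (x y : R) : 0 <= x ^+ 2 + y ^+ 2 by rewrite addr_ge0 ?sqr_ge0.
have I1 := ae_integral_le_combination mA kap0 kap0 (fun z => ss _ _) (fun z => sqr_ge0 _)
  (fun z => sqr_ge0 _) mdq mu_ mw sqr_dquo_ae.
have k60 : 0 <= 6 * Delta ^+ 2 by rewrite mulr_ge0 ?sqr_ge0.
have k40 : (0 : R) <= 4 by [].
have G0 z : 0 <= gauss_weight z ^+ 2 * (phase_diff_re al a1 a2 b2 z ^+ 2 + phase_diff_im al b1 a2 b2 z ^+ 2).
  by rewrite mulr_ge0 ?sqr_ge0.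
have PD : {ae lebesgue2, forall z, A z ->
  gauss_weight z ^+ 2 * (phase_diff_re al a1 a2 b2 z ^+ 2 + phase_diff_im al b1 a2 b2 z ^+ 2) <=
  6 * Delta ^+ 2 * ((quo_re a1 b1 a2 b2 z - c1) ^+ 2 + (quo_im a1 b1 a2 b2 z - c2) ^+ 2) +
  4 * u z ^+ 2}.
  by apply: ae_all => z Az; exact: phase_diff_le.
have I2 := ae_integral_le_combination mA k60 k40 G0 (fun z => ss _ _)
  (fun z => sqr_ge0 _) mG mq mu_ PD.
cbv beta in I1, I2; apply: (le_trans I2).
set Iu := (\int[lebesgue2]_(z in A) (u z ^+ 2)%:E)%E in I1 I2 *.
set Iw := (\int[lebesgue2]_(z in A) (norm2 (w z) ^+ 2)%:E)%E in I1 I2 *.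
have Iu0 : (0 <= Iu)%E by apply: integral_ge0 => z _; rewrite lee_fin sqr_ge0.
have Iw0 : (0 <= Iw)%E by apply: integral_ge0 => z _; rewrite lee_fin sqr_ge0.
rewrite -ge0_muleDr// in I1.
have T0 : (0 <= (2 * ((pi *+ 2 : R) * s) ^+ 2)%:E)%E by rewrite lee_fin mulr_ge0 ?sqr_ge0.
have k60' : (0 <= (6 * Delta ^+ 2)%:E)%E by rewrite lee_fin.
have k40' : (0 <= (4 : R)%:E)%E by rewrite lee_fin.
have HP2 := le_trans HP (lee_wpmul2l T0 I1).
rewrite muleA -EFinM in HP2.
apply: (le_trans (leeD (lee_wpmul2l k60' HP2) (lee_wpmul2l k40' (leeDl Iu Iw0)))).
rewrite muleA -EFinM -ge0_muleDl ?lee_fin//; last first.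
  by apply: mulr_ge0 => //; apply: mulr_ge0 => //; rewrite mulr_ge0 ?sqr_ge0.
apply: lee_wpmul2r; first exact: adde_ge0.
rewrite -EFinD lee_fin.
have x1 : 1 <= (Delta ^+ 2 / delta ^+ 2) ^+ 2.
  apply: exprn_ege1; rewrite ler_pdivlMr ?exprn_gt0// mul1r.
  by rewrite ler_sqr ?nnegrE//; [exact: ltW|exact: ltW D0].
have -> : 6 * Delta ^+ 2 * (2 * (pi *+ 2 * s) ^+ 2 * (2 * Delta ^+ 2 / delta ^+ 4)) =
    (Delta ^+ 2 / delta ^+ 2) ^+ 2 * (96 * pi ^+ 2 * s ^+ 2).
  by field; rewrite gt_eqF.
by rewrite mulrDr lerD2l; lra.
Qed.

End AnnulusEstimate.

(** * The estimate on a disc *)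

Section DiscEstimate.
Context {R : realType}.
Implicit Types (z : R * R).

Lemma closed_closed_disc (z0 : R * R) r : closed (closed_disc z0 r).
Proof.
have -> : closed_disc z0 r = dist2 z0 @^-1` `]-oo, r]%classic.
  by apply/seteqP; split => z; rewrite /closed_disc /= in_itv.
apply: closed_comp; last exact: interval_closed.
by move=> z _; exact: (@continuous_dist2 R z0 z).
Qed.

Lemma annulus_sub_disc_diff z0 r s : annulus z0 r s `<=` disc z0 s `\` closure (disc z0 r).
Proof.
move=> z /andP[rz zs]; split=> // cz.
have : closed_disc z0 r z.
  have /closure_id -> := @closed_closed_disc z0 r.
  by apply: closure_subset cz => w /ltW.
by rewrite /closed_disc /= leNgt rz.
Qed.

Lemma disc_annulus z0 r s : r < s -> disc z0 s = annulus z0 r s `|` closed_disc z0 r.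
Proof.
move=> rs; apply/seteqP; split=> [z zs|z [/andP[]//|zr]].
  have [zr|rz] := leP (dist2 z0 z) r; [by right|by left; apply/andP].
exact: le_lt_trans zr rs.
Qed.

Lemma absf_gabor (f : R -> R[i]) (a b : R * R -> R) z :
  gabor f z = ((expR (- (pi * z.1 ^+ 2)) * a z) +i* (- (expR (- (pi * z.1 ^+ 2)) * b z)))%C ->
  absf (gabor f) z = gauss_abs a b z.
Proof.
move=> fE; rewrite /absf modulusE fE /= -/(gauss_weight z) sqrrN !exprMn -mulrDr.
by rewrite sqrtrM ?sqr_ge0// sqrtr_sqr ger0_norm// ltW// gauss_weight_gt0.
Qed.

Lemma sqr_absf_phase_diff (f g : R -> R[i]) (a1 b1 a2 b2 : R * R -> R) al z :
  gabor f z = ((expR (- (pi * z.1 ^+ 2)) * a1 z) +i* (- (expR (- (pi * z.1 ^+ 2)) * b1 z)))%C ->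
  gabor g z = ((expR (- (pi * z.1 ^+ 2)) * a2 z) +i* (- (expR (- (pi * z.1 ^+ 2)) * b2 z)))%C ->
  absf (fun w => gabor f w - expi al * gabor g w) z ^+ 2 =
  gauss_weight z ^+ 2 * (phase_diff_re al a1 a2 b2 z ^+ 2 + phase_diff_im al b1 a2 b2 z ^+ 2).
Proof.
move=> fE gE; rewrite /absf modulusE fE gE sqr_sqrtr ?addr_ge0 ?sqr_ge0// /expi /=.
rewrite -/(gauss_weight z) /phase_diff_re /phase_diff_im; ring.
Qed.

(** The estimate on the annulus extends to the hole. The difference of the moduli
    is differentiable only off the zeros of the transform of g, so
    [weak_gradient_ae] is applied to the open set where that transform does not
    vanish. *)
Lemma disc_estimate (f g : R -> R[i]) (z0 : R * R) (r s delta Delta : R)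
    (U : set (R * R)) (w : R * R -> R * R) :
  L2 f -> L2 g -> 0 <= r -> r < s -> 0 < delta -> delta <= Delta ->
  atoll (disc z0 s) (disc z0 r) delta Delta (gabor f) ->
  open U -> disc z0 s `\` closure (disc z0 r) `<=` U ->
  weak_gradient U (fun w => absf (gabor f) w - absf (gabor g) w) w ->
  exists al : R,
  (\int[lebesgue2]_(z in disc z0 s)
     (absf (fun w => gabor f w - expi al * gabor g w) z ^+ 2)%:E <=
   ((1 + hole_const r s) * ((Delta ^+ 2 / delta ^+ 2) ^+ 2 * (96 * pi ^+ 2 * s ^+ 2 + 4)))%:E *
   (\int[lebesgue2]_(z in U) ((absf (gabor f) z - absf (gabor g) z) ^+ 2)%:E +
    \int[lebesgue2]_(z in U) (norm2 (w z) ^+ 2)%:E))%E.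
Proof.
move=> L2f L2g r0 rs de0 deD [_ bD bG bd] oU DU wg; have D0 : 0 < Delta by exact: lt_le_trans deD.
have [a1 [b1 [d1 [e1 [H1 cd1 ce1 fE]]]]] := gabor_entire L2f.
have [a2 [b2 [d2 [e2 [H2 cd2 ce2 gE]]]]] := gabor_entire L2g.
have fN z := absf_gabor (fE z); have gN z := absf_gabor (gE z).
pose A := annulus z0 r s; have oA : open A by exact: open_annulus.
have mA : measurable A by exact: measurable_annulus.
have mU : measurable U by exact: open2_measurable.
have AD : A `<=` disc z0 s by move=> z /andP[].
have AU : A `<=` U by apply: subset_trans DU; exact: annulus_sub_disc_diff.
have N1d z : A z -> delta <= gauss_abs a1 b1 z by move=> Az; rewrite -fN; apply: bd; exact: annulus_sub_disc_diff.
have N1D z : A z -> gauss_abs a1 b1 z <= Delta by move=> Az; rewrite -fN; apply: bD; exact: AD.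
have n0 z : A z -> 0 < a1 z ^+ 2 + b1 z ^+ 2.
  move=> Az; have : 0 < gauss_abs a1 b1 z by exact: lt_le_trans (N1d _ Az).
  by rewrite /gauss_abs pmulr_rgt0 ?gauss_weight_gt0// sqrtr_gt0.
have fNE : absf (gabor f) = gauss_abs a1 b1 by apply/funext.
have gNE : absf (gabor g) = gauss_abs a2 b2 by apply/funext.
have gN1 z : A z -> gauss_abs_dx a1 b1 d1 e1 z ^+ 2 + gauss_abs_dy a1 b1 d1 e1 z ^+ 2 <= Delta ^+ 2.
  move=> Az; have gz := has_grad_gauss_abs (H1 z) (n0 z Az).
  have := bG z (AD z Az); rewrite fNE => /(_ (has_grad_differentiable gz)).
  have [p1 p2] := has_grad_partial gz; rewrite /norm2 /grad p1 p2 /= => h.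
  rewrite -[leLHS]sqr_sqrtr ?addr_ge0 ?sqr_ge0// ler_sqr ?nnegrE ?sqrtr_ge0//; exact: ltW D0.
have [[mu_ _] [mw1 _] [mw2 _] _] := wg.
pose A' := A `&` [set z | 0 < a2 z ^+ 2 + b2 z ^+ 2].
have ca2 : continuous a2 by move=> z; exact: has_grad_continuous (H2 z).1.
have cb2 : continuous b2 by move=> z; exact: has_grad_continuous (H2 z).2.
have oA' : open A'.
  apply: openI => //.
  have -> : [set z | 0 < a2 z ^+ 2 + b2 z ^+ 2] =
      (fun z => a2 z ^+ 2 + b2 z ^+ 2) @^-1` `]0, +oo[%classic.
    by apply/seteqP; split => z; rewrite /= in_itv/= andbT.
  apply: open_comp; last exact: interval_open.
  move=> z _; apply: (@continuousD _ _ _ (fun z => a2 z ^+ 2) (fun z => b2 z ^+ 2));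
    apply: continuous_sqr; [exact: ca2|exact: cb2].
have gu z : A' z -> has_grad (fun w => absf (gabor f) w - absf (gabor g) w) z
    (gauss_abs_dx a1 b1 d1 e1 z - gauss_abs_dx a2 b2 d2 e2 z) (gauss_abs_dy a1 b1 d1 e1 z - gauss_abs_dy a2 b2 d2 e2 z).
  move=> [Az n2]; rewrite fNE gNE.
  exact: has_gradB (has_grad_gauss_abs (H1 z) (n0 z Az)) (has_grad_gauss_abs (H2 z) n2).
have cp z : A' z -> {for z, continuous (fun z => gauss_abs_dx a1 b1 d1 e1 z - gauss_abs_dx a2 b2 d2 e2 z)}.
  move=> [Az n2].
  have [c1 _] := continuous_gauss_abs_grad (H1 z) (n0 z Az) (@cd1 z) (@ce1 z).
  have [c2 _] := continuous_gauss_abs_grad (H2 z) n2 (@cd2 z) (@ce2 z).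
  exact: (@continuousB _ _ _ (gauss_abs_dx a1 b1 d1 e1)).
have cq z : A' z -> {for z, continuous (fun z => gauss_abs_dy a1 b1 d1 e1 z - gauss_abs_dy a2 b2 d2 e2 z)}.
  move=> [Az n2].
  have [_ c1] := continuous_gauss_abs_grad (H1 z) (n0 z Az) (@cd1 z) (@ce1 z).
  have [_ c2] := continuous_gauss_abs_grad (H2 z) n2 (@cd2 z) (@ce2 z).
  exact: (@continuousB _ _ _ (gauss_abs_dy a1 b1 d1 e1)).
have wE : {ae lebesgue2, forall z, A z -> 0 < a2 z ^+ 2 + b2 z ^+ 2 ->
  w z = (gauss_abs_dx a1 b1 d1 e1 z - gauss_abs_dx a2 b2 d2 e2 z,
         gauss_abs_dy a1 b1 d1 e1 z - gauss_abs_dy a2 b2 d2 e2 z)}.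
  apply: (ae_mono _ (weak_gradient_ae wg oA' _ gu cp cq)); last by move=> z [/AU].
  by move=> z h Az n2; exact: h.
have mw1A : measurable_fun A (fst \o w) by exact: measurable_funS mw1.
have mw2A : measurable_fun A (snd \o w) by exact: measurable_funS mw2.
have [al HA] := annulus_estimate H1 H2 cd1 ce1 cd2 ce2 r0 rs de0 deD N1d N1D gN1 mw1A mw2A wE.
exists al.
pose G z := gauss_weight z ^+ 2 * (phase_diff_re al a1 a2 b2 z ^+ 2 + phase_diff_im al b1 a2 b2 z ^+ 2).
have -> : (\int[lebesgue2]_(z in disc z0 s)
     (absf (fun w => gabor f w - expi al * gabor g w) z ^+ 2)%:E =
     \int[lebesgue2]_(z in disc z0 s) (G z)%:E)%E.
  by apply: eq_integral => z _; rewrite (sqr_absf_phase_diff al (fE z) (gE z)).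
have HD z := holo_phase_diff H1 H2 al z.
have cG : continuous G.
  move=> z; apply: (@continuousM _ _ (fun z => gauss_weight z ^+ 2)).
    by apply: continuous_sqr; exact: continuous_gauss_weight.
  apply: (@continuousD _ _ _ (fun z => phase_diff_re al a1 a2 b2 z ^+ 2)); apply: continuous_sqr.
    exact: has_grad_continuous (HD z).1.
  exact: has_grad_continuous (HD z).2.
have cdd : continuous (fun z => d1 z + (- cos al * d2 z - sin al * e2 z)).
  move=> z; apply: (@continuousD _ _ _ d1); first exact: cd1.
  by apply: (@continuousB _ _ _ (fun z => - cos al * d2 z)); apply: continuousM;
    solve [exact: cvg_cst|exact: cd2|exact: ce2].
have cee : continuous (fun z => e1 z + (sin al * d2 z + - cos al * e2 z)).
  move=> z; apply: (@continuousD _ _ _ e1); first exact: ce1.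
  by apply: (@continuousD _ _ _ (fun z => sin al * d2 z)); apply: continuousM;
    solve [exact: cvg_cst|exact: cd2|exact: ce2].
have HH := weighted_hole_estimate z0 HD cdd cee r0 rs.
have mC : measurable (closed_disc z0 r) := measurable_closed_disc z0 r.
have mG (B : set (R * R)) : measurable B -> measurable_fun B (fun z => (G z)%:E).
  by move=> mB; apply/measurable_EFinP; apply: continuous_at_measurable2 => // z _; exact: cG.
have G0 z : (0 <= (G z)%:E)%E by rewrite lee_fin mulr_ge0 ?sqr_ge0// addr_ge0 ?sqr_ge0.
rewrite (disc_annulus z0 rs) (ge0_integral_setU lebesgue2 mA mC) //; first last.
- by apply/disj_setPS => z [/andP[h _]]; rewrite /closed_disc /= leNgt h.
- by apply: mG; exact: measurableU.
have h0 : 0 <= hole_const r s by exact: hole_const_ge0.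
have IA0 : (0 <= \int[lebesgue2]_(z in A) (G z)%:E)%E by exact: integral_ge0.
apply: (@le_trans _ _ ((1 + hole_const r s)%:E * \int[lebesgue2]_(z in A) (G z)%:E)%E).
  by rewrite EFinD ge0_muleDl ?lee_fin// mul1e; apply: leeD.
rewrite EFinM -muleA; apply: lee_wpmul2l; first by rewrite lee_fin addr_ge0.
apply: (le_trans HA); apply: lee_wpmul2l.
  rewrite lee_fin; apply: mulr_ge0; first exact: sqr_ge0.
  by apply: addr_ge0 => //; rewrite mulr_ge0 ?sqr_ge0// mulr_ge0 ?sqr_ge0.
have mu2 : measurable_fun U (fun z => ((absf (gabor f) z - absf (gabor g) z) ^+ 2)%:E).
  by apply/measurable_EFinP; apply: measurable_funX mu_.
have mw2' : measurable_fun U (fun z => (norm2 (w z) ^+ 2)%:E).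
  apply/measurable_EFinP.
  have -> : (fun z => norm2 (w z) ^+ 2) = fun z => (fst \o w) z ^+ 2 + (snd \o w) z ^+ 2.
    by apply/funext => z; rewrite /norm2 sqr_sqrtr// addr_ge0 ?sqr_ge0.
  by apply: measurable_funD; apply: measurable_funX.
apply: leeD.
  rewrite fNE gNE in mu2 *.
  by apply: (ge0_subset_integral lebesgue2 mA mU mu2 _ AU) => z _; rewrite lee_fin sqr_ge0.
by apply: (ge0_subset_integral lebesgue2 mA mU mw2' _ AU) => z _; rewrite lee_fin sqr_ge0.
Qed.

End DiscEstimate.

(** * The stability constant *)

Section Constants.
Context {R : realType}.

(** At t = r / s this is s / (s - r), the reciprocal of the relative width of
    the annulus. *)
Definition recip_gap (t : R) : R := (1 - t)^-1.

Lemma continuous_recip_gap : {within [set` `[0%R, 1%R[], continuous recip_gap}.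
Proof.
apply: continuous_in_subspaceT => t; rewrite inE /= in_itv/= => /andP[_ t1].
apply: (@cvgV _ _ _ _ (fun t => 1 - t)); first by rewrite subr_eq0 gt_eqF.
by apply: (@continuousB _ _ _ (cst (1 : R)) id); [exact: cvg_cst|exact: cvg_id].
Qed.

Definition disc_factor (r s delta Delta : R) : R :=
  Delta ^+ 2 / delta ^+ 2 * (1 + recip_gap (r / s) * s) *
  (1 + Num.sqrt r * recip_gap (r / s) * (Num.sqrt s + (Num.sqrt s)^-1)
       * expR (r ^+ 2 * pi / 2)).

Lemma recip_gap_ge1 (r s : R) : 0 <= r -> r < s -> 1 <= recip_gap (r / s).
Proof.
move=> r0 rs; have s0 : 0 < s by exact: le_lt_trans rs.
have h : r / s < 1 by rewrite ltr_pdivrMr// mul1r.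
have h' : 0 <= r / s by rewrite divr_ge0// ltW.
by rewrite /recip_gap invf_ge1 ?subr_gt0//; lra.
Qed.

Lemma disc_factor_gt0 (r s delta Delta : R) :
  0 <= r -> r < s -> 0 < delta -> delta <= Delta -> 0 < disc_factor r s delta Delta.
Proof.
move=> r0 rs de0 deD; have s0 : 0 < s by exact: le_lt_trans rs.
have g0 : 0 <= recip_gap (r / s) by exact: le_trans (recip_gap_ge1 r0 rs).
apply: mulr_gt0; last first.
  apply: ltr_wpDr => //; apply: mulr_ge0; last exact: expR_ge0.
  apply: mulr_ge0; last by apply: addr_ge0; rewrite ?invr_ge0 sqrtr_ge0.
  by apply: mulr_ge0; [exact: sqrtr_ge0|].
apply: mulr_gt0; last by apply: ltr_wpDr => //; apply: mulr_ge0 => //; exact: ltW.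
by rewrite divr_gt0 ?exprn_gt0// (lt_le_trans de0).
Qed.

(** With rho = s / (s - r), the bounds r^2 <= r rho^2 s and
    r^2 / (s^2 - r^2) <= r rho^2 / s explain the factor (s^(1/2) + s^(-1/2)) in
    the theorem. *)
Lemma hole_const_le (r s : R) : 0 <= r -> r < s ->
  forall M : R, M = Num.sqrt r * recip_gap (r / s) * (Num.sqrt s + (Num.sqrt s)^-1)
           * expR (r ^+ 2 * pi / 2) ->
  hole_const r s <= 2 * expR pi * M ^+ 2.
Proof.
move=> r0 rs M ME; have s0 : 0 < s by exact: le_lt_trans rs.
have ss0 : 0 < Num.sqrt s by rewrite sqrtr_gt0.
have sr0 : 0 < s - r by rewrite subr_gt0.
have rE : recip_gap (r / s) = s / (s - r).
  by rewrite /recip_gap; field; rewrite !gt_eqF.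
have M2 : M ^+ 2 = r * (s / (s - r)) ^+ 2 * (s + 2 + s^-1) * expR (pi * r ^+ 2).
  have -> : M ^+ 2 = Num.sqrt r ^+ 2 * recip_gap (r / s) ^+ 2 *
      (Num.sqrt s ^+ 2 + 2 + (Num.sqrt s ^+ 2)^-1) * expR (r ^+ 2 * pi / 2) ^+ 2.
    by rewrite ME; field; rewrite gt_eqF.
  rewrite (sqr_sqrtr r0) (sqr_sqrtr (ltW s0)) rE [expR _ ^+ 2]expr2 -expRD; congr (_ * expR _).
  by field.
rewrite M2 /hole_const.
have -> : 2 * expR pi * (r * (s / (s - r)) ^+ 2 * (s + 2 + s^-1) * expR (pi * r ^+ 2)) =
   expR pi * expR (pi * r ^+ 2) * (2 * (r * (s / (s - r)) ^+ 2 * (s + 2 + s^-1))) by ring.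
apply: ler_wpM2l; first by rewrite mulr_ge0 ?expR_ge0.
have t1 : 1 <= s / (s - r) by rewrite ler_pdivlMr// mul1r; lra.
have k1 : r ^+ 2 <= r * (s / (s - r)) ^+ 2 * s.
  have h : 1 <= (s / (s - r)) ^+ 2 by exact: exprn_ege1.
  have : r * s <= r * s * (s / (s - r)) ^+ 2.
    by rewrite ler_peMr// mulr_ge0// ltW.
  have : r * r <= r * s by rewrite ler_wpM2l// ltW.
  by rewrite expr2; lra.
have sr : 0 < s + r by rewrite ltr_wpDr.
have k2 : r ^+ 2 / (s ^+ 2 - r ^+ 2) <= r * (s / (s - r)) ^+ 2 * s^-1.
  rewrite -subr_ge0.
  have -> : r * (s / (s - r)) ^+ 2 * s^-1 - r ^+ 2 / (s ^+ 2 - r ^+ 2) =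
     r * (s ^+ 2 + r ^+ 2) / ((s - r) ^+ 2 * (s + r)).
    by rewrite subr_sqr; field; rewrite !gt_eqF.
  apply: divr_ge0; first by rewrite mulr_ge0// addr_ge0 ?sqr_ge0.
  by rewrite mulr_ge0 ?sqr_ge0// ltW.
have k3 : 0 <= r * (s / (s - r)) ^+ 2 * 2 by rewrite mulr_ge0// mulr_ge0 ?sqr_ge0.
have k0 := sqr_ge0 r.
set X := r * _ ^+ 2 in k1 k2 k3 *.
have -> : 2 * (X * (s + 2 + s^-1)) = 2 * (X * s) + 2 * (X * 2) + 2 * (X * s^-1) by ring.
by lra.
Qed.

(** The two factors on the left are at most 2 exp pi (1 + M)^2 and
    Q^2 96 pi^2 (1 + rho s)^2, where Q = Delta^2 / delta^2 and 1 + M is the last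
    factor of [disc_factor]; and 192 exp pi <= 256 exp (2 pi). *)
Lemma stability_constant (r s delta Delta : R) : 0 <= r -> r < s ->
  (1 + hole_const r s) * ((Delta ^+ 2 / delta ^+ 2) ^+ 2 * (96 * pi ^+ 2 * s ^+ 2 + 4)) <=
  (16 * pi * expR pi * disc_factor r s delta Delta) ^+ 2.
Proof.
move=> r0 rs; rewrite /disc_factor; set Q := Delta ^+ 2 / delta ^+ 2; have s0 : 0 < s by exact: le_lt_trans rs.
set M := Num.sqrt r * recip_gap (r / s) * (Num.sqrt s + (Num.sqrt s)^-1)
  * expR (r ^+ 2 * pi / 2).
have hM := hole_const_le r0 rs (erefl M).
have p1 : 1 <= pi :> R by exact: pi_ge1.
have g1 := recip_gap_ge1 r0 rs.
have M0 : 0 <= M.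
  apply: mulr_ge0; last exact: expR_ge0.
  apply: mulr_ge0; last by apply: addr_ge0; rewrite ?invr_ge0 sqrtr_ge0.
  by apply: mulr_ge0; [exact: sqrtr_ge0|exact: le_trans g1].
have e1 : 1 <= expR pi :> R by rewrite -expR0 ler_expR; lra.
have i1 : 1 + hole_const r s <= 2 * expR pi * (1 + M) ^+ 2.
  have -> : 2 * expR pi * (1 + M) ^+ 2 = 2 * expR pi + 2 * expR pi * M ^+ 2 + 4 * (expR pi * M) by ring.
  have : 0 <= expR pi * M by rewrite mulr_ge0 ?expR_ge0.
  lra.
have i2 : 96 * pi ^+ 2 * s ^+ 2 + 4 <= 96 * pi ^+ 2 * (1 + recip_gap (r / s) * s) ^+ 2.
  have h1 : s <= recip_gap (r / s) * s by rewrite ler_peMl// ltW.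
  have h2 : 1 + s ^+ 2 <= (1 + recip_gap (r / s) * s) ^+ 2.
    apply: (@le_trans _ _ ((1 + s) ^+ 2)); first by rewrite sqrrD; lra.
    by rewrite ler_sqr ?nnegrE; lra.
  have pp : 1 <= pi ^+ 2 :> R by exact: exprn_ege1.
  have : 96 * pi ^+ 2 * (1 + s ^+ 2) <= 96 * pi ^+ 2 * (1 + recip_gap (r / s) * s) ^+ 2.
    by rewrite ler_wpM2l// mulr_ge0 ?sqr_ge0.
  by rewrite mulrDr; lra.
set S := 1 + recip_gap (r / s) * s in i2 *.
have h0 : 0 <= 1 + hole_const r s.
  by rewrite addr_ge0// hole_const_ge0.
have j : (1 + hole_const r s) * (96 * pi ^+ 2 * s ^+ 2 + 4) <=
    2 * expR pi * (1 + M) ^+ 2 * (96 * pi ^+ 2 * S ^+ 2).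
  apply: ler_pM => //; apply: addr_ge0 => //.
  by rewrite mulr_ge0 ?sqr_ge0// mulr_ge0 ?sqr_ge0.
have -> : (1 + hole_const r s) * (Q ^+ 2 * (96 * pi ^+ 2 * s ^+ 2 + 4)) =
   Q ^+ 2 * ((1 + hole_const r s) * (96 * pi ^+ 2 * s ^+ 2 + 4)) by ring.
apply: (le_trans (ler_wpM2l (sqr_ge0 Q) j)).
have -> : (16 * pi * expR pi * (Q * S * (1 + M))) ^+ 2 =
  256 * (Q ^+ 2 * pi ^+ 2 * S ^+ 2 * (1 + M) ^+ 2) * expR pi * expR pi by ring.
have -> : Q ^+ 2 * (2 * expR pi * (1 + M) ^+ 2 * (96 * pi ^+ 2 * S ^+ 2)) =
  192 * (Q ^+ 2 * pi ^+ 2 * S ^+ 2 * (1 + M) ^+ 2) * expR pi by ring.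
have W0 : 0 <= Q ^+ 2 * pi ^+ 2 * S ^+ 2 * (1 + M) ^+ 2 by do 3![apply: mulr_ge0; last exact: sqr_ge0]; exact: sqr_ge0.
set W := Q ^+ 2 * _ * _ * _ in W0 *.
apply: (@le_trans _ _ (256 * W * expR pi)); first by rewrite ler_wpM2r ?expR_ge0//; lra.
have We0 : 0 <= 256 * W * expR pi.
  by apply: mulr_ge0; [apply: mulr_ge0; [exact: ler0n|]|exact: expR_ge0].
exact: ler_peMr We0 e1.
Qed.

End Constants.

(** * Sobolev stability of phase retrieval *)

Section Assembly.
Context {R : realType}.

Lemma open_disc (z0 : R * R) r : open (disc z0 r).
Proof.
have -> : disc z0 r = dist2 z0 @^-1` `]-oo, r[%classic.
  by apply/seteqP; split => z; rewrite /disc /= in_itv.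
apply: open_comp; last exact: interval_open.
by move=> z _; exact: (@continuous_dist2 R z0 z).
Qed.

Lemma Lp_norm_ge0 (D : set (R * R)) (u : R * R -> R) : (0 <= Lp_norm 2%:E D u)%E.
Proof. exact: Lnorm_ge0. Qed.

Lemma disc_stability (f g : R -> R[i]) (z0 : R * R) (r s delta Delta : R)
    (U : set (R * R)) (w : R * R -> R * R) :
  L2 f -> L2 g -> 0 <= r -> r < s -> 0 < delta -> delta <= Delta ->
  atoll (disc z0 s) (disc z0 r) delta Delta (gabor f) ->
  open U -> disc z0 s `\` closure (disc z0 r) `<=` U ->
  weak_gradient U (fun w => absf (gabor f) w - absf (gabor g) w) w ->
  exists al : R,
  (L2norm (disc z0 s) (fun w => gabor f w - expi al * gabor g w)%R <=
   (16 * pi * expR pi * disc_factor r s delta Delta)%:E *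
   (Lp_norm 2%:E U (fun w => absf (gabor f) w - absf (gabor g) w)%R +
    Lp_norm 2%:E U (norm2 \o w)))%E.
Proof.
move=> L2f L2g r0 rs de0 deD atf oU DU wg.
have [al H] := disc_estimate L2f L2g r0 rs de0 deD atf oU DU wg.
exists al; apply: le_of_sqr_le; rewrite ?Lp_norm_ge0//.
  by rewrite mulr_gt0 ?disc_factor_gt0// mulr_gt0 ?expR_gt0// mulr_gt0 ?pi_gt0.
rewrite /L2norm !Lp_norm2_sqr.
apply: (le_trans H); apply: lee_wpmul2r.
  by apply: adde_ge0; apply: integral_ge0 => z _; rewrite lee_fin sqr_ge0.
rewrite lee_fin; exact: stability_constant.
Qed.

End Assembly.
(* rho and c are absolute: all dependence of the stability constant on the data
   is through the explicit expression. *)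
Theorem theorem3p7 (R : realType) :
  exists (rho : R -> R) (c : R),
    [/\ {within [set` `[0, 1[], continuous rho},
        forall t, 0 <= t < 1 -> 0 < rho t,
        0 < c
      & forall (f : R -> R[i]) (k : nat) (z : 'I_k -> R * R)
               (r s delta Delta : 'I_k -> R),
          L2 f ->
          (1 <= k)%N ->
          (forall j, 0 <= r j < s j) ->
          (forall j, 0 < delta j <= Delta j) ->
          (forall j, atoll (disc (z j) (s j)) (disc (z j) (r j))
                           (delta j) (Delta j) (gabor f)) ->
          forall g : R -> R[i], L2 g ->
          (ereal_inf [set \sum_(j < k)
               L2norm (disc (z j) (s j))
                      (fun w => gabor f w - expi (alpha j) * gabor g w)%R
             | alpha in [set: 'I_k -> R]]
           <= (c * \sum_(j < k)
                 Delta j ^+ 2 / delta j ^+ 2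
                 * (1 + rho (r j / s j) * s j)
                 * (1 + Num.sqrt (r j) * rho (r j / s j)
                        * (Num.sqrt (s j) + (Num.sqrt (s j))^-1)
                        * expR (r j ^+ 2 * pi / 2)))%R%:E
              * sobolev_norm 2%:E
                  (\bigcup_(j in [set: 'I_k])
                     (disc (z j) (s j) `\` closure (disc (z j) (r j))))
                  (fun w => absf (gabor f) w - absf (gabor g) w)%R)%E].
Proof.
exists recip_gap, (16 * pi * expR pi); split.
- exact: continuous_recip_gap.
- by move=> t /andP[_ t1]; rewrite /recip_gap invr_gt0 subr_gt0.
- by rewrite mulr_gt0 ?expR_gt0// mulr_gt0 ?pi_gt0.
move=> f k z r s delta Delta L2f k1 rs deD atf g L2g.
set U := \bigcup_(j in _) _; set u := fun w => (absf (gabor f) w - absf (gabor g) w)%R.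
pose C j := disc_factor (r j) (s j) (delta j) (Delta j).
have C0 j : 0 < C j.
  by have /andP[? ?] := rs j; have /andP[? ?] := deD j; exact: disc_factor_gt0.
pose c : R := 16 * pi * expR pi.
have c0 : 0 < c by rewrite mulr_gt0 ?expR_gt0// mulr_gt0 ?pi_gt0.
have K0 : 0 < c * \sum_(j < k) C j.
  apply: mulr_gt0 => //; rewrite (bigD1 (Ordinal k1))//=.
  by apply: ltr_wpDr => //; apply: sumr_ge0 => j _; exact: ltW.
have oU : open U.
  apply: bigcup_open => j _; rewrite setDE; apply: openI; first exact: open_disc.
  exact/closed_openC/closed_closure.
(* the phases depend on the weak gradient, so its infimum is taken last *)
rewrite -(lee_pdivrMl _ _ K0); apply: le_ereal_inf_tmp => _ [w wg <-].
rewrite (lee_pdivrMl _ _ K0).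
have /boolp.choice[al Hal] : forall j, exists al : R,
    (L2norm (disc (z j) (s j)) (fun w => gabor f w - expi al * gabor g w)%R <=
     (c * C j)%:E * (Lp_norm 2%:E U u + Lp_norm 2%:E U (norm2 \o w)))%E.
  move=> j; have /andP[r0 rsj] := rs j; have /andP[de0 deDj] := deD j.
  by apply: disc_stability => // x Dx; exists j.
apply: (le_trans (ereal_inf_lbound (ex_intro2 _ _ al I erefl))).
apply: (le_trans (lee_sum _ (fun j _ => Hal j))).
rewrite -ge0_sume_distrl; last first.
  by move=> j _; rewrite lee_fin ltW// mulr_gt0.
by rewrite sumEFin mulr_sumr.
Qed.
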